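(* Let $\mathbf{X}$ and $\mathbf{Y}$ be independent stochastic processes with sample paths in $\mathbb{D}=\mathbb{D}([0,1],\mathbb{R}^d)$. Suppose that $\mathbf{X}\in\mathrm{RV}_\alpha((a_n),m,\overline{\mathbb{D}}_0)$, that $\mathrm{E}(|\mathbf{Y}|_\infty^{\alpha+\delta})<\infty$ for some $\delta>0$, and that $\min_{k=1,\ldots,d}|Y^{(k)}|_\infty>0$ a.s. If $\mathrm{E}(m(\mathrm{Disc}(\phi_{\mathbf{Y}})))=0$, then, as $n\to\infty$, $$n\,\mathrm{P}(a_n^{-1}\mathbf{Y}\mathbf{X}\in\cdot)\xrightarrow{\hat w}\mathrm{E}(m\circ\phi_{\mathbf{Y}}^{-1}(\cdot))=\mathrm{E}(m\{\mathbf{x}\in\overline{\mathbb{D}}_0:\mathbf{Y}\mathbf{x}\in\cdot\})\qquad\text{on }\mathcal{B}(\overline{\mathbb{D}}_0).$$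
   Context: $|\cdot|$ is the Euclidean norm; products are componentwise (and pointwise in time). $|\mathbf{x}|_\infty=\sup_{t\in[0,1]}|\mathbf{x}_t|$. For $\mathbf{y}\in\mathbb{D}$, $\phi_{\mathbf{y}}:\mathbb{D}\to\mathbb{D}$ is $\phi_{\mathbf{y}}(\mathbf{x})=\mathbf{y}\mathbf{x}=(y^{(1)}x^{(1)},\ldots,y^{(d)}x^{(d)})$, and $\mathrm{Disc}(\phi_{\mathbf{y}})$ is its set of discontinuity points with respect to the $J_1$-metric. $\mathbb{D}$ is the space of càdlàg functions $[0,1]\to\mathbb{R}^d$ with Billingsley's complete $J_1$-metric $d^\circ(\mathbf{x},\mathbf{y})=\inf_\lambda\max\{\sup_{s<t}|\log\frac{\lambda(t)-\lambda(s)}{t-s}|,\ \sup_t|\mathbf{x}_t-\mathbf{y}_{\lambda(t)}|\}$, the infimum being over increasing bijections $\lambda$ of $[0,1]$. Let $\mathbb{S}_\mathbb{D}=\{\mathbf{x}\in\mathbb{D}:|\mathbf{x}|_\infty=1\}$ and $\overline{\mathbb{D}}_0=(0,\infty]\times\mathbb{S}_\mathbb{D}$ with metric $\max\{|1/x^*-1/y^*|,d^\circ(\widetilde{\mathbf{x}},\widetilde{\mathbf{y}})\}$; $\mathbb{D}\setminus\{\mathbf{0}\}$ is identified with $(0,\infty)\times\mathbb{S}_\mathbb{D}$ via $\mathbf{x}\mapsto(|\mathbf{x}|_\infty,\mathbf{x}/|\mathbf{x}|_\infty)$, so that bounded subsets of $\overline{\mathbb{D}}_0$ are those on which $|\mathbf{x}|_\infty$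 is bounded away from $0$. Measures $m_n$, finite on bounded sets, satisfy $m_n\xrightarrow{\hat w}m$ if $m_n(B)\to m(B)$ for every bounded Borel set $B$ with $m(\partial B)=0$. $\mathbf{X}\in\mathrm{RV}((a_n),m,\overline{\mathbb{D}}_0)$ means: $\mathbf{X}$ is a process with sample paths in $\mathbb{D}$, $0<a_n\uparrow\infty$, $m$ is a nonzero measure on $\mathcal{B}(\overline{\mathbb{D}}_0)$, finite on bounded sets, with $m(\overline{\mathbb{D}}_0\setminus\mathbb{D})=0$, and $n\mathrm{P}(a_n^{-1}\mathbf{X}\in\cdot)\xrightarrow{\hat w}m(\cdot)$ on $\mathcal{B}(\overline{\mathbb{D}}_0)$. Then $m(u\cdot)=u^{-\alpha}m(\cdot)$ for all $u>0$ for some $\alpha>0$, and one writes $\mathrm{RV}_\alpha$ to indicate the index. Since $m(\overline{\mathbb{D}}_0\setminus\mathbb{D})=0$, $m\circ\phi_{\mathbf{Y}}^{-1}(B)$ is understood as $m\{\mathbf{x}\in\mathbb{D}\setminus\{\mathbf{0}\}:\mathbf{Y}\mathbf{x}\in B\}$. *)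

(* Defs.v *)
From HB Require Import structures.
From mathcomp Require Import all_boot all_order all_algebra.
From mathcomp Require Import all_classical all_reals all_analysis.
From mathcomp Require Import ring lra.

Set Implicit Arguments.
Unset Strict Implicit.
Unset Printing Implicit Defensive.

Import Order.TTheory GRing.Theory Num.Theory.
Import numFieldNormedType.Exports.

Local Open Scope classical_set_scope.
Local Open Scope ring_scope.

Section euclidean_norm.
Context {R : realType} {d : nat}.
Implicit Types u v : 'rV[R]_d.

Definition enorm v : R := Num.sqrt (\sum_i v 0 i ^+ 2).

Definition mulv u v : 'rV[R]_d := \row_i (u 0 i * v 0 i).

Lemma enorm_ge0 v : 0 <= enorm v. Proof. exact: sqrtr_ge0. Qed.

Lemma sumsq_ge0 v : 0 <= \sum_i v 0 i ^+ 2.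
Proof. by apply: sumr_ge0 => i _; exact: sqr_ge0. Qed.

Lemma enorm_sq v : enorm v ^+ 2 = \sum_i v 0 i ^+ 2.
Proof. by rewrite sqr_sqrtr// sumsq_ge0. Qed.

Lemma enorm0 : enorm 0 = 0.
Proof.
by rewrite /enorm big1 ?sqrtr0// => i _; rewrite mxE expr0n.
Qed.

Lemma enorm_eq0 v : enorm v = 0 -> v = 0.
Proof.
move=> v0; have := enorm_sq v; rewrite v0 expr0n/= => /esym/eqP.
rewrite psumr_eq0; last by move=> i _; exact: sqr_ge0.
move=> /allP v0i; apply/rowP => i; rewrite mxE.
by apply/eqP; rewrite -sqrf_eq0; apply: (v0i i); rewrite mem_index_enum.
Qed.

Lemma enormZ (a : R) v : enorm (a *: v) = `|a| * enorm v.
Proof.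
rewrite -sqrtr_sqr -sqrtrM ?sqr_ge0// mulr_sumr; congr Num.sqrt.
by apply: eq_bigr => i _; rewrite mxE exprMn.
Qed.

Lemma enormN v : enorm (- v) = enorm v.
Proof. by rewrite -scaleN1r enormZ normrN1 mul1r. Qed.

Lemma dot_le u v : \sum_i u 0 i * v 0 i <= enorm u * enorm v.
Proof.
have [u0|u0] := eqVneq (enorm u) 0.
  by rewrite u0 mul0r (enorm_eq0 u0) big1// => i _; rewrite mxE mul0r.
have [v0|v0] := eqVneq (enorm v) 0.
  by rewrite v0 mulr0 (enorm_eq0 v0) big1// => i _; rewrite mxE mulr0.
have Au : 0 < enorm u by rewrite lt_neqAle eq_sym u0 enorm_ge0.
have Bv : 0 < enorm v by rewrite lt_neqAle eq_sym v0 enorm_ge0.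
have : 0 <= \sum_i (enorm v * u 0 i - enorm u * v 0 i) ^+ 2.
  by apply: sumr_ge0 => i _; exact: sqr_ge0.
under eq_bigr do rewrite sqrrB !exprMn.
rewrite big_split sumrB/= -!mulr_sumr -!enorm_sq.
have -> : \sum_i (enorm v * u 0 i * (enorm u * v 0 i)) *+ 2 =
    (enorm u * enorm v) * (\sum_i u 0 i * v 0 i) *+ 2.
  by rewrite mulr_sumr -sumrMnl; apply: eq_bigr => i _; congr (_ *+ 2); ring.
move=> h; have {}h : 0 <= (enorm u * enorm v) *
    (enorm u * enorm v - \sum_i u 0 i * v 0 i) by lra.
by rewrite -subr_ge0; rewrite pmulr_rge0 ?mulr_gt0 in h.
Qed.

Lemma enormD u v : enorm (u + v) <= enorm u + enorm v.
Proof.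
rewrite -(@ler_pXn2r _ 2)// ?nnegrE ?addr_ge0 ?enorm_ge0//.
have -> : enorm (u + v) ^+ 2 =
    enorm u ^+ 2 + (\sum_i u 0 i * v 0 i) *+ 2 + enorm v ^+ 2.
  rewrite !enorm_sq -sumrMnl -!big_split/=; apply: eq_bigr => i _.
  by rewrite mxE sqrrD.
by rewrite sqrrD lerD2r lerD2l lerMn2r/= dot_le.
Qed.

Lemma abs_le_enorm v i : `|v 0 i| <= enorm v.
Proof.
rewrite -(@ler_pXn2r _ 2)// ?nnegrE ?enorm_ge0// enorm_sq real_normK ?num_real//.
by rewrite (bigD1 i)//= lerDl sumr_ge0// => j _; exact: sqr_ge0.
Qed.

Lemma enorm_le (e : R) v : (forall i, `|v 0 i| <= e) -> enorm v <= d%:R * e.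
Proof.
move=> ve; have [d0|d0] := posnP d.
  rewrite /enorm big1 ?sqrtr0 => [|i _]; last first.
    by have := ltn_ord i; rewrite [X in (_ < X)%N]d0.
  by rewrite [X in X%:R]d0 mul0r.
have e0 : 0 <= e by apply: le_trans (ve (Ordinal d0)).
rewrite -(@ler_pXn2r _ 2)// ?nnegrE ?enorm_ge0 ?mulr_ge0// enorm_sq.
apply: (@le_trans _ _ (\sum_(i < d) e ^+ 2)).
  apply: ler_sum => i _; rewrite -[leLHS]real_normK ?num_real//.
  by rewrite ler_pXn2r ?nnegrE.
rewrite sumr_const card_ord exprMn -[leLHS]mulr_natl; apply: ler_wpM2r; first exact: sqr_ge0.
by rewrite -natrX ler_nat -[X in (X <= _)%N]expn1 leq_pexp2l.
Qed.

Lemma enorm_mulv u v : enorm (mulv u v) <= enorm u * enorm v.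
Proof.
rewrite -(@ler_pXn2r _ 2)// ?nnegrE ?mulr_ge0 ?enorm_ge0//.
rewrite exprMn !enorm_sq mulr_suml; apply: ler_sum => i _.
rewrite mxE exprMn; apply: ler_wpM2l; first exact: sqr_ge0.
rewrite -enorm_sq -[leLHS]real_normK ?num_real//.
by rewrite ler_pXn2r ?nnegrE ?enorm_ge0// abs_le_enorm.
Qed.

Lemma cvg_rowP {T : Type} (F : set_system T) {FF : Filter F}
    (f : T -> 'rV[R]_d) (l : 'rV[R]_d) :
  f @ F --> l <-> forall i, f t 0 i @[t --> F] --> l 0 i.
Proof.
split=> [fl i|fl].
  exact: (cvg_comp _ _ fl (@coord_continuous R 1 d 0 i l)).
apply/cvg_ballP => e e0.
have : \forall t \near F, forall i : 'I_d, ball (l 0 i) e (f t 0 i).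
  by apply: filter_forall => i; move/cvg_ballP : (fl i); exact.
by apply: filterS => t ft; split=> // i j; rewrite (ord1 i); exact: ft.
Qed.

Lemma cvg_mulv {T : Type} (F : set_system T) {FF : Filter F}
    (f g : T -> 'rV[R]_d) (a b : 'rV[R]_d) :
  f @ F --> a -> g @ F --> b -> mulv (f t) (g t) @[t --> F] --> mulv a b.
Proof.
move=> /cvg_rowP fa /cvg_rowP gb; apply/cvg_rowP => i; rewrite mxE.
have -> : (fun t => mulv (f t) (g t) 0 i) = (fun t => f t 0 i * g t 0 i).
  by apply/funext => t; rewrite mxE.
exact: cvgM.
Qed.

Lemma cvg_enorm {T : Type} (F : set_system T) {FF : Filter F}
    (f : T -> 'rV[R]_d) (a : 'rV[R]_d) :
  f @ F --> a -> forall e, 0 < e -> \forall t \near F, enorm (f t - a) < e.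
Proof.
move=> /cvg_ballP fa e e0.
have e'0 : 0 < e / (d%:R + 1) by rewrite divr_gt0// ltr_wpDl.
apply: filterS (fa _ e'0) => t [_ /(_ 0) fat].
apply: (@le_lt_trans _ _ (d%:R * (e / (d%:R + 1)))).
  apply: enorm_le => i; rewrite !mxE distrC ltW//.
  exact: fat.
by rewrite mulrCA gtr_pMr// ltr_pdivrMr ?ltr_wpDl// mul1r ltrDl.
Qed.

End euclidean_norm.

Notation unitI R := (set_type (`[0%R : R, 1%R : R]%classic : set R)).

Section cadlag.
Context {R : realType} {d : nat}.
Implicit Types (x y : unitI R -> 'rV[R]_d) (s t : unitI R).

Definition cadlag x : Prop := forall t,
  x s @[s --> within [set s | val t <= val s] (nbhs t)] --> x t /\
  exists l : 'rV[R]_d, x s @[s --> within [set s | val s < val t] (nbhs t)] --> l.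

Lemma unitIP t : 0 <= val t <= 1.
Proof. by have := set_valP t; rewrite /= in_itv. Qed.

Definition mk_unitI (r : R) (r01 : 0 <= r <= 1) : unitI R :=
  exist _ r (mem_set (r01 : `[0%R, 1%R]%classic r)).

Lemma unitI0_subproof : 0 <= (0 : R) <= 1. Proof. by rewrite lexx ler01. Qed.
Definition unitI0 : unitI R := mk_unitI unitI0_subproof.

Lemma unitI1_subproof : 0 <= (1 : R) <= 1. Proof. by rewrite lexx ler01. Qed.
Definition unitI1 : unitI R := mk_unitI unitI1_subproof.

Lemma nbhs_unitIP t (A : set (unitI R)) :
  nbhs t A <-> exists2 e : R, 0 < e & forall s, `|val t - val s| < e -> A s.
Proof.
split=> [/nbhs_ballP[e e0 tA]|[e e0 tA]]; last apply/nbhs_ballP.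
  by exists e => // s ts; exact: tA.
by exists e => // s ts; exact: tA.
Qed.

Lemma cadlag_bounded x : cadlag x -> exists M : R, forall t, enorm (x t) <= M.
Proof.
move=> cx.
have /compact_near_coveringP/near_covering_withinP :=
  @segment_compact R (0%R : R) (1%R : R).
move=> /(_ R (pinfty_nbhs R)
  (fun M r => forall t, val t = r -> enorm (x t) <= M) _).
have H : forall r : R, `[0%R, 1%R]%classic r ->
    \forall r' \near r & M \near pinfty_nbhs R, `[0%R, 1%R]%classic r' ->
    forall t, val t = r' -> enorm (x t) <= M.
  move=> r r01; pose t := mk_unitI r01.
  have [rx [l lx]] := cx t.
  have h1 := cvg_enorm (FF := within_filter _ (nbhs_filter _)) rx ltr01; rewrite near_withinE in h1.
  have [e1 e10 re] := iffLR (nbhs_unitIP t _) h1.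
  have h2 := cvg_enorm (FF := within_filter _ (nbhs_filter _)) lx ltr01; rewrite near_withinE in h2.
  have [e2 e20 le] := iffLR (nbhs_unitIP t _) h2.
  pose e := Num.min e1 e2.
  have e0 : 0 < e by rewrite lt_min e10.
  pose K := 1 + Num.max (enorm (x t)) (enorm l).
  exists ([set r' | `|r - r'| < e], [set M | K <= M]); first split => /=.
  - by apply/nbhs_ballP; exists e.
  - by apply: nbhs_pinfty_ge; rewrite num_real.
  - move=> [r' M] [/= rr' KM] _ s sr'.
    apply: le_trans KM; rewrite /K.
    have [ts|st] := leP (val t) (val s).
      have /= := re s _ ts; rewrite -[X in enorm X <= _](subrK (x t)).
      move=> h; apply: le_trans (enormD _ _) _; apply: lerD.
        by apply/ltW/h; rewrite sr'; apply: lt_le_trans rr' _; rewrite ge_min lexx.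
      by rewrite le_max lexx.
    have /= := le s _ st; rewrite -[X in enorm X <= _](subrK l).
    move=> h; apply: le_trans (enormD _ _) _; apply: lerD.
      by apply/ltW/h; rewrite sr'; apply: lt_le_trans rr' _; rewrite ge_min lexx orbT.
    by rewrite le_max lexx orbT.
move=> /(_ H) [M [_ MP]].
exists (M + 1) => t; apply: (MP (M + 1) _ (val t)) => //.
- by rewrite ltrDl.
- exact: set_valP.
Qed.

Lemma cadlag_mul x y : cadlag x -> cadlag y -> cadlag (fun t => mulv (x t) (y t)).
Proof.
move=> cx cy t; have [rx [lx lxP]] := cx t; have [ry [ly lyP]] := cy t.
split; first exact: cvg_mulv.
by exists (mulv lx ly); exact: cvg_mulv.
Qed.

Lemma cadlag_scale (a : R) x : cadlag x -> cadlag (fun t => a *: x t).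
Proof.
move=> cx t; have [rx [lx lxP]] := cx t.
by split; [exact: cvgZr|exists (a *: lx); exact: cvgZr].
Qed.

Lemma cadlag_cst (v : 'rV[R]_d) : cadlag (fun=> v).
Proof. by move=> t; split; [|exists v]; exact: cvg_cst. Qed.

End cadlag.

(* Two càdlàg paths are equal iff they are equal as functions: the proof field
   is irrelevant. *)
Record skorokhod (R : realType) (d : nat) := Skorokhod {
  path_fun :> unitI R -> 'rV[R]_d ;
  path_cadlag : cadlag path_fun }.

Section skorokhod_ops.
Context {R : realType} {d : nat}.
Implicit Types x y : skorokhod R d.

Lemma skorokhod_eq x y : (forall t, x t = y t) -> x = y.
Proof.
case: x y => [x cx] [y cy] /= /funext xy; subst y.
by congr Skorokhod; exact: Prop_irrelevance.
Qed.

Definition path_cst (v : 'rV[R]_d) : skorokhod R d :=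
  Skorokhod (cadlag_cst v).

Definition path_scale (a : R) x : skorokhod R d :=
  Skorokhod (cadlag_scale a (path_cadlag x)).

Definition path_mul y x : skorokhod R d :=
  Skorokhod (cadlag_mul (path_cadlag y) (path_cadlag x)).

Definition supnorm x : R := sup (range (fun t => enorm (x t))).

Definition coord_supnorm (k : 'I_d) x : R := sup (range (fun t => `|x t 0 k|)).

Lemma supnorm_has_sup x : has_sup (range (fun t => enorm (x t))).
Proof.
split.
  by exists (enorm (x unitI0)), unitI0.
by have [M xM] := cadlag_bounded (path_cadlag x); exists M => _ [t _ <-].
Qed.

Lemma enorm_le_supnorm x t : enorm (x t) <= supnorm x.
Proof. by apply: ub_le_sup; [case: (supnorm_has_sup x)|exists t]. Qed.

Lemma supnorm_le x M : (forall t, enorm (x t) <= M) -> supnorm x <= M.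
Proof.
move=> xM; apply: ge_sup; first by case: (supnorm_has_sup x).
by move=> _ [t _ <-].
Qed.

Lemma supnorm_ge0 x : 0 <= supnorm x.
Proof.
exact: le_trans (enorm_ge0 _) (enorm_le_supnorm x unitI0).
Qed.

Lemma supnorm_gt0 x : x <> path_cst 0 -> 0 < supnorm x.
Proof.
move=> x0; rewrite lt_neqAle supnorm_ge0 andbT eq_sym; apply/eqP => sx0.
apply: x0; apply: skorokhod_eq => t /=; apply: enorm_eq0.
by apply/eqP; rewrite eq_le enorm_ge0 -sx0 enorm_le_supnorm.
Qed.

Lemma supnormZ (a : R) x : supnorm (path_scale a x) = `|a| * supnorm x.
Proof.
apply/eqP; rewrite eq_le; apply/andP; split.
  by apply: supnorm_le => t /=; rewrite enormZ ler_wpM2l// enorm_le_supnorm.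
have [->|a0] := eqVneq a 0; first by rewrite normr0 mul0r supnorm_ge0.
rewrite -ler_pdivlMl ?normr_gt0//; apply: supnorm_le => t.
by rewrite ler_pdivlMl ?normr_gt0// -enormZ (enorm_le_supnorm (path_scale a x)).
Qed.

End skorokhod_ops.

Section J1_metric.
Context {R : realType} {d : nat}.
Implicit Types (x y z : skorokhod R d) (s t : unitI R) (l : unitI R -> unitI R).

Definition time_change : set (unitI R -> unitI R) :=
  [set l | (forall s t, val s < val t -> val (l s) < val (l t)) /\ bijective l].

Definition log_slope l s t : R :=
  `|ln ((val (l t) - val (l s)) / (val t - val s))|.

Definition time_skew l : \bar R :=
  ereal_sup [set (log_slope l p.1 p.2)%:E | p in
    [set p : unitI R * unitI R | val p.1 < val p.2]].

Definition path_gap x y l : \bar R :=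
  ereal_sup [set (enorm (x t - y (l t)))%:E | t in [set: unitI R]].

(* The infimum is finite, see J1_dist_fin below. *)
Definition J1_dist x y : R :=
  fine (ereal_inf [set maxe (time_skew l) (path_gap x y l) | l in time_change]).

Definition J1_close x y l (e : R) :=
  (forall s t, val s < val t -> log_slope l s t <= e) /\
  (forall t, enorm (x t - y (l t)) <= e).

Lemma J1_closeP x y l e : 
  (maxe (time_skew l) (path_gap x y l) <= e%:E)%E <-> J1_close x y l e.
Proof.
rewrite ge_max; split=> [/andP[h1 h2]|[h1 h2]].
  split=> [s t st|t].
    rewrite -lee_fin; apply: le_trans h1; apply: ereal_sup_ubound.
    by exists (s, t).
  by rewrite -lee_fin; apply: le_trans h2; apply: ereal_sup_ubound; exists t.
apply/andP; split; apply: ge_ereal_sup.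
  by move=> _ [[s t] /= st <-]; rewrite lee_fin; exact: h1.
by move=> _ [t _ <-]; rewrite lee_fin.
Qed.

Lemma time_change_id : time_change id.
Proof. by split=> //; exists id. Qed.

Lemma log_slope_id s t : val s < val t -> log_slope id s t = 0.
Proof. by move=> st; rewrite /log_slope divff ?ln1 ?normr0// subr_eq0 gt_eqF. Qed.

Lemma J1_close_id x y : J1_close x y id (supnorm x + supnorm y).
Proof.
split=> [s t st|t]; first by rewrite log_slope_id// addr_ge0 ?supnorm_ge0.
by rewrite (le_trans (enormD _ _))// enormN lerD ?enorm_le_supnorm.
Qed.

Lemma J1_dist_fin x y : 
  ereal_inf [set maxe (time_skew l) (path_gap x y l) | l in time_change] = (J1_dist x y)%:E /\ 0 <= J1_dist x y.
Proof.
rewrite /J1_dist; set I := ereal_inf _.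
have I0 : (0 <= I)%E.
  apply: le_ereal_inf_tmp => _ [l _ <-]; rewrite le_max; apply/orP; right.
  apply: le_trans (_ : (enorm (x unitI0 - y (l unitI0)))%:E <= _)%E.
    by rewrite lee_fin enorm_ge0.
  by apply: ereal_sup_ubound; exists unitI0.
have IM : (I <= (supnorm x + supnorm y)%:E)%E.
  apply: le_trans (iffRL (J1_closeP _ _ _ _) (J1_close_id x y)); apply: ereal_inf_lbound; exists id => //.
  exact: time_change_id.
have If : I \is a fin_num by rewrite ge0_fin_numE// (le_lt_trans IM)// ltry.
by rewrite fineK// fine_ge0.
Qed.

Lemma J1_dist_ge0 x y : 0 <= J1_dist x y.
Proof. by have [] := J1_dist_fin x y. Qed.

Lemma J1_dist_le x y l e : time_change l -> J1_close x y l e -> J1_dist x y <= e.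
Proof.
move=> lc /J1_closeP xye; rewrite -lee_fin; have [<- _] := J1_dist_fin x y.
by apply: le_trans xye; apply: ereal_inf_lbound; exists l.
Qed.

Lemma J1_dist_lt x y e :
  J1_dist x y < e -> exists2 l, time_change l & J1_close x y l e.
Proof.
rewrite -lte_fin; have [<- _] := J1_dist_fin x y.
move=> /ereal_inf_lt[_ [l lc <-] /ltW/J1_closeP xye].
by exists l.
Qed.

Lemma J1_distxx x : J1_dist x x = 0.
Proof.
apply/eqP; rewrite eq_le J1_dist_ge0 andbT.
apply: (J1_dist_le time_change_id); split=> [s t st|t].
  by rewrite log_slope_id.
by rewrite subrr enorm0.
Qed.

Lemma time_change_inv l : time_change l ->
  exists g, [/\ time_change g, cancel l g & cancel g l].
Proof.
move=> [li [g lg gl]]; exists g; split=> //; split; last by exists l.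
move=> s t st; rewrite ltNge le_eqVlt negb_or; apply/andP; split; last first.
  by apply/negP => /li; rewrite !gl ltNge (ltW st).
by apply/eqP => /val_inj /(congr1 l); rewrite !gl => ts; rewrite ts ltxx in st.
Qed.

Lemma J1_sym_le x y : J1_dist y x <= J1_dist x y.
Proof.
apply/ler_addgt0Pl => e e0.
have : J1_dist x y < e + J1_dist x y by rewrite ltrDr.
move=> /J1_dist_lt[l lc [l1 l2]].
have [g [gc lg gl]] := time_change_inv lc.
apply: (J1_dist_le gc); split=> [s t st|t].
  have := l1 _ _ (gc.1 _ _ st); rewrite /log_slope !gl.
  rewrite -[X in `|ln X|]invrK invf_div lnV ?normrN// posrE.
  by rewrite divr_gt0// subr_gt0// gc.1.
by rewrite -enormN opprB -[X in enorm (_ - y X)]gl l2.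
Qed.

Lemma J1_sym x y : J1_dist x y = J1_dist y x.
Proof. by apply/eqP; rewrite eq_le !J1_sym_le. Qed.

Lemma J1_triangle y x z : J1_dist x z <= J1_dist x y + J1_dist y z.
Proof.
apply/ler_addgt0Pl => e e0.
have e20 : 0 < e / 2 by rewrite divr_gt0.
have : J1_dist x y < e / 2 + J1_dist x y by rewrite ltrDr.
move=> /J1_dist_lt[l lc [l1 l2]].
have : J1_dist y z < e / 2 + J1_dist y z by rewrite ltrDr.
move=> /J1_dist_lt[m mc [m1 m2]].
have mlc : time_change (m \o l).
  split=> [s t st|]; first by apply: mc.1; exact: lc.1.
  by apply: bij_comp; [exact: mc.2|exact: lc.2].
rewrite {1}(splitr e) addrACA.
apply: (J1_dist_le mlc); split=> [s t st|t].
  apply: le_trans (lerD (l1 _ _ st) (m1 _ _ (lc.1 _ _ st))).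
  rewrite /log_slope/=; apply: le_trans (ler_normD _ _).
  have st0 : 0 < val t - val s by rewrite subr_gt0.
  have lst0 : 0 < val (l t) - val (l s) by rewrite subr_gt0 lc.1.
  have mst0 : 0 < val (m (l t)) - val (m (l s)) by rewrite subr_gt0 mc.1 ?lc.1.
  rewrite -lnM ?posrE ?divr_gt0//; move: st0 lst0 mst0.
  move: (val t - _) (val (l t) - _) (val (m (l t)) - _) => c a b c0 a0 b0.
  by rewrite (_ : a / c * (b / a) = b / c)//; field; rewrite !gt_eqF.
apply: le_trans (lerD (l2 t) (m2 (l t))); apply: le_trans (enormD _ _).
by rewrite /= addrA subrK.
Qed.

Lemma time_change0 l : time_change l -> val (l unitI0) = 0.
Proof.
move=> lc; have [g [gc lg gl]] := time_change_inv lc.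
apply/eqP; rewrite eq_le; have /andP[-> _] := unitIP (l unitI0).
rewrite andbT leNgt; apply/negP => l0; have := gc.1 unitI0 (l unitI0) l0.
by rewrite lg /= ltNge; have /andP[-> _] := unitIP (g unitI0).
Qed.

Lemma time_change1 l : time_change l -> l unitI1 = unitI1.
Proof.
move=> lc; have [g [gc lg gl]] := time_change_inv lc.
apply/val_inj/eqP; rewrite eq_le; have /andP[_ ->] := unitIP (l unitI1).
rewrite leNgt; apply/negP => l0; have := gc.1 (l unitI1) unitI1 l0.
by rewrite lg /= ltNge; have /andP[_ ->] := unitIP (g unitI1).
Qed.

Lemma time_change_near (e : R) : 0 < e -> exists2 e', 0 < e' &
  forall l, time_change l ->
    (forall s t, val s < val t -> log_slope l s t <= e') ->
  forall t, `|val t - val (l t)| <= e.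
Proof.
move=> e0; have e10 : 0 < 1 + e by rewrite addr_gt0.
exists (ln (1 + e)); first by rewrite ln_gt0// ltrDl.
move=> l lc le t; have /andP[t0 t1] := unitIP t.
have [->|tn0] := eqVneq t unitI0; first by rewrite time_change0// subrr normr0 ltW.
have {tn0}t0 : val unitI0 < val t.
  by rewrite lt_neqAle t0 andbT eq_sym; apply: contra_neq tn0 => /val_inj.
have lt0 := lc.1 _ _ t0.
have := le _ _ t0; rewrite /log_slope time_change0//= !subr0.
rewrite time_change0//= in lt0; have {}t0 : 0 < val t by [].
have q0 : 0 < val (l t) / val t by rewrite divr_gt0.
rewrite ler_norml => /andP[]; rewrite -lnV ?posrE// !ler_ln ?posrE ?invr_gt0//.
rewrite ler_pdivrMr// ler_pdivlMr// ler_pdivrMl// => h1 h2.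
have e1 : e * val t <= e by rewrite ger_pMr.
have e2 : e * val (l t) <= e.
  by rewrite ger_pMr//; have /andP[] := unitIP (l t).
rewrite /= in e1 e2 h1 h2 *; rewrite ler_norml; apply/andP; split; lra.
Qed.

Lemma J1_positivity x y : J1_dist x y = 0 -> x = y.
Proof.
move=> xy0; apply: skorokhod_eq => t.
suff h : forall e, 0 < e -> enorm (x t - y t) <= e.
  apply/eqP; rewrite -subr_eq0; apply/eqP/enorm_eq0/eqP.
  rewrite eq_le enorm_ge0 andbT; apply/ler_addgt0Pl => e e0.
  by rewrite addr0 h.
move=> e e0.
have [t1|t1] := eqVneq t unitI1.
  have /J1_dist_lt[l lc [_ le]] : J1_dist x y < e by rewrite xy0.
  by have := le t; rewrite t1 time_change1.
have e30 : 0 < e / 3 by rewrite divr_gt0.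
have h1 := cvg_enorm (FF := within_filter _ (nbhs_filter _))
  (path_cadlag x t).1 e30.
rewrite near_withinE in h1.
have {h1}[e1 e10 re] := iffLR (nbhs_unitIP t _) h1.
have h2 := cvg_enorm (FF := within_filter _ (nbhs_filter _))
  (path_cadlag y t).1 e30.
rewrite near_withinE in h2.
have {h2}[e2 e20 le] := iffLR (nbhs_unitIP t _) h2.
have /andP[t0 tle1] := unitIP t.
have {t1 tle1}t1 : val t < 1.
  by rewrite lt_neqAle tle1 andbT; apply: contra_neq t1 => t1; exact: val_inj.
pose D := Num.min (Num.min e1 e2) (1 - val t).
have D0 : 0 < D by rewrite !lt_min e10 e20 subr_gt0.
have [De1 De2 Dt] : [/\ D <= e1, D <= e2 & D <= 1 - val t].
  by rewrite /D !ge_min !lexx/= !orbT.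
have s01 : 0 <= val t + D / 2 <= 1 by apply/andP; split; lra.
pose s := mk_unitI s01.
have D40 : 0 < D / 4 by rewrite divr_gt0.
have [e' e'0 near] := time_change_near D40.
have /J1_dist_lt[l lc [lc1 lc2]] : J1_dist x y < Num.min e' (e / 3).
  by rewrite xy0 lt_min e'0.
have mle : Num.min e' (e / 3) <= e' by rewrite ge_min lexx.
have {}near := near l lc (fun s t st => le_trans (lc1 s t st) mle) s.
rewrite ler_norml in near; have /andP[near1 near2] := near.
have xs : enorm (x s - x t) < e / 3.
  apply: re => /=; first by rewrite ltr_norml; apply/andP; split; lra.
  by rewrite lerDl ltW// divr_gt0.
have yls : enorm (y (l s) - y t) < e / 3.
  rewrite /= in near1 near2.
  apply: le => /=; first by rewrite ltr_norml; apply/andP; split; lra.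
  by lra.
have xyls : enorm (x s - y (l s)) <= e / 3.
  by apply: le_trans (lc2 s) _; rewrite ge_min lexx orbT.
have -> : x t - y t = - (x s - x t) + ((x s - y (l s)) + (y (l s) - y t)).
  by rewrite opprB !addrA !subrK.
apply: le_trans (enormD _ _) _; rewrite enormN.
by have := enormD (x s - y (l s)) (y (l s) - y t); lra.
Qed.

Lemma J1_dist_le_supnorm x y : J1_dist x y <= supnorm x + supnorm y.
Proof. exact: (J1_dist_le time_change_id (J1_close_id x y)). Qed.

End J1_metric.

HB.instance Definition _ (R : realType) (d : nat) :=
  gen_eqMixin (skorokhod R d).
HB.instance Definition _ (R : realType) (d : nat) :=
  gen_choiceMixin (skorokhod R d).
HB.instance Definition _ (R : realType) (d : nat) :=
  isMetric.Build R (skorokhod R d) (@J1_distxx R d) (@J1_positivity R d)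
    (@J1_sym R d) (@J1_triangle R d).

(* (0, +oo] times the unit sphere of D for the uniform norm *)
Record Dbar0 (R : realType) (d : nat) := Polar {
  radius : \bar R ;
  angle : skorokhod R d ;
  radius_gt0 : (0 < radius)%E ;
  angle_norm : supnorm angle = 1 }.

Section Dbar0_metric.
Context {R : realType} {d : nat}.
Implicit Types (b c e : Dbar0 R d) (x : skorokhod R d).

(* The extended inverse sends +oo to 0 and is finite on (0, +oo]. *)
Definition polar_dist b c : R :=
  Num.max `|fine (radius b)^-1%E - fine (radius c)^-1%E|
          (mdist (angle b) (angle c)).

Lemma Dbar0_eq b c : radius b = radius c -> angle b = angle c -> b = c.
Proof.
case: b c => [r x r0 x1] [s y s0 y1] /= rs xy; subst s y.
by congr Polar; exact: Prop_irrelevance.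
Qed.

Lemma polar_distxx b : polar_dist b b = 0.
Proof. by rewrite /polar_dist subrr normr0 mdistxx maxxx. Qed.

Lemma polar_dist_sym b c : polar_dist b c = polar_dist c b.
Proof. by rewrite /polar_dist distrC metric_sym. Qed.

Lemma polar_dist_triangle c b e :
  polar_dist b e <= polar_dist b c + polar_dist c e.
Proof.
rewrite /polar_dist ge_max; apply/andP; split.
  by apply: le_trans (ler_distD (fine (radius c)^-1%E) _ _) _;
    apply: lerD; rewrite le_max lexx.
by apply: le_trans (metric_triangle _ (angle c) _) _;
  apply: lerD; rewrite le_max lexx orbT.
Qed.

Lemma fine_inv_inj (r s : \bar R) : (0 < r)%E -> (0 < s)%E ->
  fine r^-1%E = fine s^-1%E -> r = s.
Proof.
case: r s => [r| |] [s| |]//=; rewrite ?lte_fin /inve => r0 s0.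
- by rewrite !gt_eqF//= => /invr_inj ->.
- rewrite gt_eqF//= => /eqP; rewrite invr_eq0 => /eqP r00.
  by rewrite r00 ltxx in r0.
- rewrite gt_eqF//= => /esym/eqP; rewrite invr_eq0 => /eqP s00.
  by rewrite s00 ltxx in s0.
Qed.

Lemma polar_dist_positivity b c : polar_dist b c = 0 -> b = c.
Proof.
move=> bc0; apply: Dbar0_eq.
  apply: fine_inv_inj; [exact: radius_gt0|exact: radius_gt0|].
  apply/eqP; rewrite -subr_eq0 -normr_eq0 eq_le normr_ge0 andbT.
  by rewrite -bc0 /polar_dist le_max lexx.
apply: mdist_positivity; apply/eqP; rewrite eq_le mdist_ge0 andbT.
by rewrite -bc0 /polar_dist le_max lexx orbT.
Qed.

End Dbar0_metric.

HB.instance Definition _ (R : realType) (d : nat) := gen_eqMixin (Dbar0 R d).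
HB.instance Definition _ (R : realType) (d : nat) :=
  gen_choiceMixin (Dbar0 R d).
HB.instance Definition _ (R : realType) (d : nat) :=
  isMetric.Build R (Dbar0 R d) (@polar_distxx R d)
    (@polar_dist_positivity R d) (@polar_dist_sym R d)
    (@polar_dist_triangle R d).

Section Dbar0_point.
Context {R : realType} {d : nat}.

Lemma supnorm_path_cst (v : 'rV[R]_d) : supnorm (path_cst v) = enorm v.
Proof.
apply/eqP; rewrite eq_le supnorm_le//=.
exact: (enorm_le_supnorm (path_cst v) unitI0).
Qed.

Lemma enorm_delta (k : 'I_d) : enorm (delta_mx 0 k : 'rV[R]_d) = 1.
Proof.
rewrite /enorm (bigD1 k)//= mxE !eqxx/= expr1n big1 ?addr0 ?sqrtr1// => i ik.
by rewrite mxE (negbTE ik) expr0n.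
Qed.

Lemma angle_cst_norm (k : 'I_d) : supnorm (path_cst (delta_mx 0 k)) = 1 :> R.
Proof. by rewrite supnorm_path_cst enorm_delta. Qed.

End Dbar0_point.

(* Measurable types are pointed, hence the positive dimension. *)
HB.instance Definition _ (R : realType) (d : nat) :=
  isPointed.Build (Dbar0 R d.+1)
    (Polar (ltry 0 : (0 < +oo :> \bar R)%E) (@angle_cst_norm R d.+1 0)).

HB.instance Definition _ (R : realType) (d : nat) :=
  @isMeasurable.Build (sigma_display (@open (Dbar0 R d.+1))) (Dbar0 R d.+1)
    <<s @open (Dbar0 R d.+1) >> (@sigma_algebra0 _ setT _)
    (@sigma_algebraC _ _) (@sigma_algebra_bigcup _ setT _).

(* Boundedness in Dbar0 amounts to radii bounded away from 0, see
   Dbar0_boundedP below. *)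
Definition metric_bounded {R : realType} {M : metricType R} (B : set M) :=
  exists c r, B `<=` ball c r.

Definition boundary {M : topologicalType} (B : set M) : set M :=
  closure B `\` interior B.

Section identification.
Context {R : realType} {d : nat}.

(* [polar_coord x b] says that the identification of D \ {0} with a subset of
   Dbar0 maps x to b; no b corresponds to x = 0, as radii are positive. *)
Definition polar_coord (x : skorokhod R d) (b : Dbar0 R d) : Prop :=
  radius b = (supnorm x)%:E /\ angle b = path_scale (supnorm x)^-1 x.

Definition in_Dbar0 (A : set (skorokhod R d)) : set (Dbar0 R d) :=
  [set b | exists2 x, A x & polar_coord x b].

Definition in_D (B : set (Dbar0 R d)) : set (skorokhod R d) :=
  [set x | exists2 b, B b & polar_coord x b].

Lemma polar_coord_exists x : x <> path_cst 0 -> exists b, polar_coord x b.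
Proof.
move=> /supnorm_gt0 x0.
have x1 : supnorm (path_scale (supnorm x)^-1 x) = 1.
  by rewrite supnormZ ger0_norm ?invr_ge0 ?ltW// mulVf// gt_eqF.
have x0' : (0 < (supnorm x)%:E)%E by rewrite lte_fin.
by exists (Polar x0' x1).
Qed.

Lemma polar_coord_unique x b c : polar_coord x b -> polar_coord x c -> b = c.
Proof. by move=> [rb ab] [rc ac]; apply: Dbar0_eq; rewrite ?rb ?ab. Qed.

Lemma polar_coord_inj x y b : polar_coord x b -> polar_coord y b -> x = y.
Proof.
move=> [rx ax] [ry ay].
have xy : supnorm x = supnorm y by apply: EFin_inj; rewrite -rx -ry.
have x0 : supnorm x != 0.
  by have := radius_gt0 b; rewrite rx lte_fin => /gt_eqF ->.
apply: skorokhod_eq => t.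
have : path_scale (supnorm x)^-1 x t = path_scale (supnorm y)^-1 y t.
  by rewrite -ax -ay.
by rewrite -xy /= => /scalerI; apply; rewrite invr_eq0.
Qed.

Lemma in_Dbar0_setT : in_Dbar0 setT = [set b | (radius b < +oo)%E].
Proof.
apply/seteqP; split=> [b [x _ [rb _]]|b]; first by rewrite /= rb ltry.
case: b => [[r| |]//= x r0' x1] _.
have r0 : 0 < r by rewrite lte_fin in r0'.
exists (path_scale r x) => //; rewrite /polar_coord supnormZ x1 mulr1.
rewrite gtr0_norm//=; split=> //; apply: skorokhod_eq => t /=.
by rewrite scalerA mulVf ?scale1r// gt_eqF.
Qed.

End identification.

Lemma Dbar0_boundedP (R : realType) (d : nat) (B : set (Dbar0 R d.+1)) :
  metric_bounded B <->
  exists2 e : R, 0 < e & forall b, B b -> (e%:E <= radius b)%E.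
Proof.
split=> [[c [r Br]]|[e e0 Be]].
  pose k := fine (radius c)^-1%E + `|r|.
  exists (k + 1)^-1.
    rewrite invr_gt0 ltr_wpDl// addr_ge0//; have := radius_gt0 c.
    case: (radius c) => [s| |]//=; rewrite ?lte_fin => s0.
    by rewrite /inve gt_eqF//= invr_ge0 ltW.
  move=> b /Br; rewrite ballEmdist/= => bc.
  have {}bc : `|fine (radius c)^-1%E - fine (radius b)^-1%E| < r.
    by apply: le_lt_trans bc; rewrite /mdist/= /polar_dist le_max lexx.
  have {}bc : fine (radius b)^-1%E <= k + 1.
    have := ler_norm r; move: bc; rewrite ltr_norml /k => /andP[b1 b2] b3.
    by lra.
  have := radius_gt0 b; move: bc.
  case: (radius b) => [s| |]//=; rewrite ?lte_fin ?lee_fin; last first.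
    by rewrite leey.
  move=> + s0; rewrite /inve gt_eqF//= => sk.
  by rewrite -[leRHS]invrK lef_pV2// posrE ?invr_gt0// (lt_le_trans _ sk)// invr_gt0.
exists point, (e^-1 + 3) => b Bb.
rewrite ballEmdist/= /mdist/= /polar_dist gt_max; apply/andP; split.
  rewrite /inve/= sub0r normrN.
  have := Be b Bb; have := radius_gt0 b.
  case: (radius b) => [s| |]//=; rewrite ?lte_fin ?lee_fin.
    move=> s0 es; rewrite gt_eqF//= gtr0_norm ?invr_gt0//.
    by apply: (@le_lt_trans _ _ e^-1); rewrite ?lef_pV2 ?ltrDl.
  by rewrite normr0 addr_gt0// invr_gt0.
apply: le_lt_trans (J1_dist_le_supnorm _ _) _.
rewrite !angle_norm; have : 0 < e^-1 by rewrite invr_gt0.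
by lra.
Qed.

Section hatw_convergence.
Context {R : realType} {d : nat}.
Implicit Types (mu : set (Dbar0 R d.+1) -> \bar R).

Definition boundedly_finite mu : Prop :=
  forall B : set (Dbar0 R d.+1),
    measurable B -> metric_bounded B -> (mu B < +oo)%E.

(* [mu] need only agree with a measure on the Borel sets, since its values
   outside the Borel sets carry no information. *)
Definition boundedly_finite_measure mu : Prop :=
  (exists nu : {measure set (Dbar0 R d.+1) -> \bar R},
    forall B : set (Dbar0 R d.+1), measurable B -> mu B = nu B) /\
  boundedly_finite mu.

Definition hatw_cvg (mu_ : nat -> set (Dbar0 R d.+1) -> \bar R) mu : Prop :=
  [/\ forall n, boundedly_finite_measure (mu_ n),
      boundedly_finite_measure mu &
      forall B : set (Dbar0 R d.+1),
        measurable B -> metric_bounded B -> mu (boundary B) = 0%E ->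
        mu_ n B @[n --> \oo] --> mu B].

Definition Dbar0_scale (u : R) (B : set (Dbar0 R d.+1)) :
    set (Dbar0 R d.+1) :=
  [set b | exists2 c, B c &
    radius b = (u%:E * radius c)%E /\ angle b = angle c].

End hatw_convergence.

Section processes.
Context {R : realType} {d : nat} {disp : measure_display}.
Context {T : measurableType disp}.
Implicit Types (P : probability T R) (X Y : T -> skorokhod R d.+1).

Definition stochastic_process X : Prop :=
  forall (t : unitI R) (k : 'I_d.+1),
    measurable_fun [set: T] (fun w => X w t 0 k).

Definition sigma_process X : set (set T) :=
  <<s [set E | exists (t : unitI R) (k : 'I_d.+1) (A : set R),
         measurable A /\ E = (fun w => X w t 0 k) @^-1` A] >>.

Definition independent_processes P X Y : Prop :=
  forall A B, sigma_process X A -> sigma_process Y B ->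
    P (A `&` B) = (P A * P B)%E.

(* n P(X / a_n \in B) *)
Definition scaled_law P (a : nat -> R) X (n : nat)
    (B : set (Dbar0 R d.+1)) : \bar R :=
  (n%:R%:E * P [set w | in_D B (path_scale (a n)^-1 (X w))])%E.

Definition regularly_varying P X (a : nat -> R)
    (m : {measure set (Dbar0 R d.+1) -> \bar R}) : Prop :=
  [/\ stochastic_process X,
      [/\ forall n, 0 < a n, nondecreasing_seq a & a @ \oo --> +oo],
      m [set: Dbar0 R d.+1] <> 0%E /\ boundedly_finite m,
      m (~` in_Dbar0 setT) = 0%E &
      hatw_cvg (scaled_law P a X) m].

Definition regularly_varying_index P (alpha : R) X (a : nat -> R)
    (m : {measure set (Dbar0 R d.+1) -> \bar R}) : Prop :=
  [/\ regularly_varying P X a m, 0 < alpha &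
      forall (u : R) (B : set (Dbar0 R d.+1)), 0 < u -> measurable B ->
        m (Dbar0_scale u B) = ((u `^ (- alpha))%:E * m B)%E].

End processes.

(* J_1-discontinuity points of x |-> y x *)
Definition Disc {R : realType} {d : nat} (y : skorokhod R d) :
    set (skorokhod R d) :=
  [set x | ~ {for x, continuous (path_mul y)}].

(* Main.v *)
From HB Require Import structures.
Require Import Defs.
From mathcomp Require Import all_boot all_order all_algebra.
From mathcomp Require Import all_classical all_reals all_analysis.
From mathcomp Require Import measurable_realfun finmap ring lra.
Import Defs.

(** Condition on [Y]. For a fixed path [y] the set of those [x] with [y * x] in
[B] is a bounded Borel set. Apart from points at infinity, which form a null
set of [m], its boundary is contained in the discontinuity set of
multiplication by [y] together with the preimage of the boundary of [B]
([boundary_mul_preimage]). If [m] charges neither, the regular variation of [X]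
gives the convergence for this [y] ([fixed_multiplier_cvg]). By assumption the
means over [Y] of the two masses vanish, so they vanish for almost every path
of [Y], and it remains to integrate the convergence over [Y] with dominated
convergence. If [B] keeps a distance [e] from the zero path, then [y * X / a n]
lies in [B] only if the norm of [X] exceeds [a n * e] divided by the norm of
[y]; by the Potter bound for the tail of the norm of [X] ([tail_bound]), [n]
times the probability of this is at most a constant times one plus the power
[alpha + delta] of the norm of [y], which is integrable.

Three points need work beyond this outline.

Measurability. Processes are measurable coordinate by coordinate, whereas [B]
is a Borel set of the Skorokhod metric. The two structures agree: a path is the
limit of its step approximations, which are continuous functions of finitely
many coordinates ([measurable_process]), and the coordinates are Borel
([measurable_coord]). Hence multiplication is jointly measurable, the limit is
the image of a product measure ([limit_measure]), and [X] and [Y] can be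
integrated separately by Fubini's theorem on the sigma-algebras that they
generate ([independent_fubini]).

The discontinuity set. To pass from its mean mass to almost every path of [Y],
its mass must be measurable in [Y]. Multiplication by [y] is discontinuous at
[x] exactly when at some time inside the interval both paths jump and the value
obtained by shifting one jump against the other is new ([tame_jumps],
[tame_continuous], [continuous_tame]). This condition involves only the values
of the two paths at rational times ([tame_jumps_rational]).

Skorokhod distances. The bounds in presence of jumps rest on one device: a path
has finitely many cells of small oscillation ([split_cells]), and the cell boundaries can be
moved to any nearby places by a time change close to the identity
([cell_warp]), built by adding narrow hats to the identity. *)

Set Implicit Arguments.
Unset Strict Implicit.
Unset Printing Implicit Defensive.

Import Order.TTheory GRing.Theory Num.Theory.
Import numFieldNormedType.Exports.

Local Open Scope classical_set_scope.
Local Open Scope ring_scope.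

(** * Cells of small oscillation *)

Section cells.
Context {R : realType}.
Implicit Types (F : seq R) (u v t : unitI R) (E : unitI R -> unitI R -> Prop).

(** The points of [F] cut [0, 1] into cells, closed on the left. Encoding a cell
by comparisons with [F] avoids sorting [F], and makes it evident that a
monotone bijection carries cells to cells. *)
Definition same_cell F (u v : R) := forall f : R, f \in F -> (f <= u) = (f <= v).

Definition locally_split E := forall t, exists2 e : R, 0 < e & forall u v,
  `|val u - val t| < e -> `|val v - val t| < e ->
  (val t <= val u) = (val t <= val v) -> E u v.

Lemma locally_splitI E1 E2 : locally_split E1 -> locally_split E2 ->
  locally_split (fun u v => E1 u v /\ E2 u v).
Proof.
move=> s1 s2 t; have [e1 e10 h1] := s1 t; have [e2 e20 h2] := s2 t.
exists (Num.min e1 e2); first by rewrite lt_min e10.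
by move=> u v; rewrite !lt_min => /andP[? ?] /andP[? ?] ?; split; auto.
Qed.

(** Compactness of [0, 1]: finitely many of the neighbourhoods given by the local
splitting cover it. Their centres and end points serve as cell boundaries, so
that a cell never leaves the neighbourhood it meets nor crosses its centre. *)
Lemma split_cells E : locally_split E ->
  exists F, forall u v, same_cell F (val u) (val v) -> E u v.
Proof.
move=> sE.
have {}sE (r : R) : exists e : R, 0 < e /\ (0 <= r <= 1 -> forall u v,
    `|val u - r| < e -> `|val v - r| < e -> (r <= val u) = (r <= val v) -> E u v).
  have [r01|r01] := boolP (0 <= r <= 1); last by exists 1.
  by have [e e0 eE] := sE (mk_unitI r01); exists e; split=> // _; exact: eE.
have [e eP] := choice sE.
have := @segment_compact R (0%R : R) (1%R : R).
rewrite compact_cover => /(_ _ `[0%R, 1%R]%classic (fun r : R => ball r (e r / 2))).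
case=> [r _|r r01|D Dsub Dcov].
- exact: ball_open.
- exists r => //=; apply: ballxx; rewrite divr_gt0//; exact: (eP r).1.
pose N r := [:: r; r + e r / 2; r - e r / 2].
exists (flatten [seq N r | r <- enum_fset D]) => u v uv.
have [r /= rD] := Dcov (val u) (set_valP u).
have r01 : 0 <= r <= 1.
  by have := Dsub r rD; rewrite in_setE /= in_itv.
have [er0 /(_ r01) erE] := eP r.
rewrite /ball/= ltr_distlC => /andP[ru1 ru2].
have NE s : s \in N r -> (s <= val u) = (s <= val v).
  by move=> sr; apply: uv; apply/flattenP; exists (N r) => //; exact: map_f.
have v2 : val v < r + e r / 2.
  by rewrite ltNge -NE ?inE ?eqxx ?orbT// -ltNge; rewrite /= in ru1 ru2 *; lra.
have v1 : r - e r / 2 <= val v.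
  by rewrite -NE ?inE ?eqxx ?orbT//; rewrite /= in ru1 ru2 *; lra.
rewrite /= in ru1 ru2 v1 v2.
apply: erE.
- by rewrite ltr_norml /=; apply/andP; split; lra.
- by rewrite ltr_norml /=; apply/andP; split; lra.
- by apply: NE; rewrite inE eqxx.
Qed.

Lemma cadlag_split d (x : unitI R -> 'rV[R]_d) (e : R) : cadlag x -> 0 < e ->
  locally_split (fun u v => enorm (x u - x v) <= e).
Proof.
move=> cx e0 t; have [rx [l lx]] := cx t.
have e20 : 0 < e / 2 by rewrite divr_gt0.
have h1 := cvg_enorm (FF := within_filter _ (nbhs_filter _)) rx e20.
have h2 := cvg_enorm (FF := within_filter _ (nbhs_filter _)) lx e20.
rewrite !near_withinE in h1 h2.
have [e1 e10 re] := iffLR (nbhs_unitIP t _) h1.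
have [e2 e20' le] := iffLR (nbhs_unitIP t _) h2.
have close z u v : enorm (x u - z) < e / 2 -> enorm (x v - z) < e / 2 ->
    enorm (x u - x v) <= e.
  move=> uz vz; rewrite (_ : x u - x v = (x u - z) + - (x v - z)); last first.
    by rewrite opprB addrA subrK.
  by apply: le_trans (enormD _ _) _; rewrite enormN; lra.
exists (Num.min e1 e2); first by rewrite lt_min e10.
move=> u v; rewrite !lt_min !(distrC _ (val t)) => /andP[u1 u2] /andP[v1 v2].
case: (leP (val t) (val u)) => tu; case: (leP (val t) (val v)) => tv // _.
  by apply: (close (x t)); apply: re.
by apply: (close l); apply: le.
Qed.

Lemma seq_norm_gap (s : seq R) :
  exists2 g : R, 0 < g & forall a : R, a \in s -> a != 0 -> g <= `|a|.
Proof.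
elim: s => [|b s [g g0 gs]]; first by exists 1.
exists (if b == 0 then g else Num.min g `|b|).
  by case: eqP => // /eqP b0; rewrite lt_min g0 normr_gt0.
move=> a; rewrite inE => /predU1P[->|/gs as_] a0.
  by rewrite (negbTE a0) ge_min lexx orbT.
by case: eqP => _; rewrite ?ge_min as_.
Qed.

Lemma seq_gap F : exists2 g : R, 0 < g & forall a b : R, a \in F -> b \in F ->
  a != b -> g <= `|a - b|.
Proof.
have [g g0 gF] := seq_norm_gap [seq a - b | a <- F, b <- F].
exists g => // a b aF bF ab; apply: gF; last by rewrite subr_eq0.
by apply/allpairsP; exists (a, b).
Qed.

End cells.

(** * Time changes with prescribed values *)

Section time_warp.
Context {R : realType}.
Implicit Types (F : seq R) (s t : unitI R) (p : R -> R) (a b u v : R).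

Lemma lipschitz_continuous p (L : R) : (forall u v : R, `|p u - p v| <= L * `|u - v|) ->
  continuous p.
Proof.
move=> pL u; apply/cvgrPdist_lt => e e0.
have L0 : 0 < `|L| + 1 by rewrite ltr_wpDl.
apply/nbhs_ballP; exists (e / (`|L| + 1)) => /=; first by rewrite divr_gt0.
move=> v; rewrite /ball/= ltr_pdivlMr// => uv.
apply: le_lt_trans (pL u v) (le_lt_trans _ uv).
rewrite mulrC ler_wpM2l//; apply: le_trans (ler_norm _) _.
by rewrite lerDl.
Qed.

(** A contraction vanishing at both ends of the interval perturbs the identity
into a time change; surjectivity is the intermediate value theorem. *)
Lemma perturbed_time_change p (L : R) : 0 <= L <= 1 / 2 -> p 0 = 0 -> p 1 = 0 ->
  (forall u v : R, `|p u - p v| <= L * `|u - v|) ->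
  exists l : unitI R -> unitI R, [/\ time_change l,
    forall s t, val s < val t -> log_slope l s t <= 2 * L,
    forall s t, `|val (l s) - val (l t)| <= 2 * `|val s - val t| &
    forall t, val (l t) = val t + p (val t)].
Proof.
move=> /andP[L0 L1] p0 p1 pL; pose f (u : R) := u + p u.
have f0 : f 0 = 0 by rewrite /f p0 addr0.
have f1 : f 1 = 1 by rewrite /f p1 addr0.
have slope (u v : R) : u < v -> (1 - L) * (v - u) <= f v - f u <= (1 + L) * (v - u).
  move=> uv; have := pL v u; rewrite [X in _ * X]gtr0_norm ?subr_gt0//.
  rewrite ler_norml => /andP[h1 h2]; rewrite /f; apply/andP; split; lra.
have mono (u v : R) : u < v -> f u < f v.
  move=> uv; have /andP[h _] := slope u v uv; rewrite -subr_gt0.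
  by apply: lt_le_trans h; rewrite mulr_gt0//; lra.
have f01 (u : R) : 0 <= u <= 1 -> 0 <= f u <= 1.
  move=> /andP[]; rewrite !le_eqVlt => /predU1P[<- _|u0 /predU1P[->|u1]].
  - by rewrite f0 eqxx ltr01 orbT.
  - by rewrite f1 eqxx ltr01 orbT.
  - by have := mono _ _ u0; have := mono _ _ u1; rewrite f0 f1 => -> ->; rewrite !orbT.
pose l (t : unitI R) : unitI R := mk_unitI (f01 _ (unitIP t)).
have slopel s t : val s < val t ->
    1 - L <= (val (l t) - val (l s)) / (val t - val s) <= 1 + L.
  move=> st; have /andP[h1 h2] := slope _ _ st.
  by rewrite ler_pdivlMr ?subr_gt0// ler_pdivrMr ?subr_gt0// h1.
exists l; split=> //.
- split; first by move=> s t; exact: mono.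
  rewrite -setTT_bijective; split=> // [s t _ _ /(congr1 val)/= st|t _].
    apply: val_inj; apply/eqP; rewrite eq_le !leNgt.
    by apply/andP; split; apply/negP => /mono; rewrite st ltxx.
  have cf : continuous f.
    by move=> u; apply: cvgD; [exact: cvg_id|exact: (lipschitz_continuous pL)].
  have /(IVT ler01) : {within `[(0 : R), 1], continuous f}.
    exact: continuous_subspaceT.
  move=> /(_ (val t)); rewrite f0 f1 min_l// max_r// => /(_ (unitIP t))[c c01 fc].
  have {}c01 : 0 <= c <= 1 by rewrite in_itv in c01.
  by exists (mk_unitI c01) => //; apply: val_inj.
- move=> s t /slopel /andP[]; rewrite /log_slope; set q := _ / _ => q1 q2.
  have q0 : 0 < q by apply: lt_le_trans q1; lra.
  rewrite ler_norml; apply/andP; split.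
    rewrite lerNl -lnV ?posrE// (_ : q^-1 = 1 + (q^-1 - 1)); last by rewrite addrC subrK.
    apply: le_trans (le_ln1Dx _) _; first by rewrite ltrBrDl subrr invr_gt0.
    rewrite lerBlDr -(@ler_pM2r _ q)// mulVf ?gt_eqF//.
    have : 0 <= (q - (1 - L)) * (2 * L + 1) by rewrite mulr_ge0//; lra.
    have : 0 <= L * (1 - 2 * L) by rewrite mulr_ge0//; lra.
    lra.
  rewrite (_ : q = 1 + (q - 1)); last by rewrite addrC subrK.
  by apply: le_trans (le_ln1Dx _) _; lra.
- move=> s t /=; rewrite /f opprD addrACA; apply: le_trans (ler_normD _ _) _.
  apply: le_trans (lerD (lexx _) (pL _ _)) _.
  have : L * `|val s - val t| <= 1 * `|val s - val t| by rewrite ler_wpM2r//; lra.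
  by rewrite /=; lra.
Qed.

Definition hat (a : R) := Num.max 0 (1 - `|a|).

Lemma hat_lipschitz a b : `|hat a - hat b| <= `|a - b|.
Proof.
rewrite /hat; have h1 := lerB_dist a b; have h2 := lerB_dist b a.
rewrite [X in _ <= X]distrC in h2; have := normr_ge0 (a - b).
rewrite ler_norml; case: (leP 0 (1 - `|a|)); case: (leP 0 (1 - `|b|));
  move=> *; apply/andP; split; lra.
Qed.

Lemma hat_eq0 a : 1 <= `|a| -> hat a = 0.
Proof. by move=> a1; rewrite /hat max_l// subr_le0. Qed.

Lemma hat0 : hat 0 = 1.
Proof. by rewrite /hat normr0 subr0 max_r. Qed.

(** Adding to the identity a hat of height [f - r f] at each [r f] gives a time
change with slopes close to 1 that takes the value [f] at [r f], since the
hats at the other points vanish there. *)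
Lemma time_warp F (r : R -> R) (w dlt L : R) : uniq F -> 0 < w ->
  0 <= L <= 1 / 2 -> (size F)%:R * dlt <= L * w ->
  (forall f, f \in F -> `|f - r f| <= dlt) ->
  (forall f, f \in F -> w <= r f <= 1 - w) ->
  (forall f g, f \in F -> g \in F -> f != g -> w <= `|r f - r g|) ->
  exists l : unitI R -> unitI R, [/\ time_change l,
    forall s t, val s < val t -> log_slope l s t <= 2 * L,
    forall s t, `|val (l s) - val (l t)| <= 2 * `|val s - val t| &
    forall f t, f \in F -> val t = r f -> val (l t) = f].
Proof.
move=> uF w0 L01 dL rd rw rr.
pose p (u : R) := \sum_(f <- F) (f - r f) * hat ((u - r f) / w).
have hat_far a : w <= `|a| -> hat (a / w) = 0.
  move=> wa; apply: hat_eq0; rewrite normrM [Num.norm w^-1]gtr0_norm ?invr_gt0//.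
  by rewrite ler_pdivlMr// mul1r.
have p0 : p 0 = 0.
  rewrite /p big_seq big1// => f fF; rewrite hat_far ?mulr0//.
  by rewrite sub0r normrN; have /andP[h _] := rw _ fF; rewrite (le_trans h)// ler_norm.
have p1 : p 1 = 0.
  rewrite /p big_seq big1// => f fF; rewrite hat_far ?mulr0//.
  by have /andP[_ h] := rw _ fF; rewrite (le_trans _ (ler_norm _))//; lra.
have pL (u v : R) : `|p u - p v| <= L * `|u - v|.
  rewrite /p -sumrB; apply: le_trans (ler_norm_sum _ _ _) _.
  apply: (@le_trans _ _ (\sum_(f <- F) dlt * (`|u - v| / w))).
    rewrite big_seq [leRHS]big_seq; apply: ler_sum => f fF.
    rewrite -mulrBr normrM; apply: ler_pM => //; first exact: rd.
    apply: le_trans (hat_lipschitz _ _) _.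
    rewrite -mulrBl opprB addrA subrK normrM.
    by rewrite [Num.norm w^-1]gtr0_norm// invr_gt0.
  rewrite big_const_seq count_predT iter_addr_0 -[leLHS]mulr_natl mulrA.
  by rewrite [X in _ * X]mulrC mulrA ler_wpM2r// ler_pdivrMr.
have [l [lc ls ll lp]] := perturbed_time_change L01 p0 p1 pL.
exists l; split=> // f t fF tf; rewrite lp tf /p (bigD1_seq f)//= subrr mul0r hat0.
rewrite mulr1 big_seq_cond big1 ?addr0; last first.
  by move=> g /andP[gF gf]; rewrite hat_far ?mulr0// rr// eq_sym.
by rewrite addrC subrK.
Qed.

Lemma time_change_outside l (f : R) t : time_change l -> ~~ (0 < f < 1) ->
  (f <= val (l t)) = (f <= val t).
Proof.
move=> lc f01; have /andP[t0 t1] := unitIP t; have /andP[lt0 lt1] := unitIP (l t).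
have [f0|f0] := leP f 0; first by rewrite !(le_trans f0).
have {f01}f1 : 1 <= f by move: f01; rewrite f0/= -leNgt.
have [tE|tn1] := eqVneq t unitI1; first by rewrite tE time_change1.
have t1' : val t < val unitI1.
  by rewrite lt_neqAle t1 andbT; apply: contra_neq tn1 => /val_inj.
have := lc.1 _ _ t1'; rewrite time_change1// => lt1'.
by rewrite !leNgt (lt_le_trans t1' f1) (lt_le_trans lt1' f1).
Qed.

(** Small displacements of the cell boundaries are realised by time changes
that are close to the identity; boundaries outside [(0, 1)] must stay put,
since time changes fix both ends. *)
Lemma cell_warp F (e : R) : 0 < e -> exists2 dlt : R, 0 < dlt &
  forall r : R -> R, (forall f, f \in F -> `|f - r f| <= dlt) ->
    (forall f, f \in F -> ~~ (0 < f < 1) -> r f = f) ->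
  exists l : unitI R -> unitI R, [/\ time_change l,
    forall s t, val s < val t -> log_slope l s t <= e &
    forall f t, f \in F -> (r f <= val t) = (f <= val (l t))].
Proof.
move=> e0; have [g g0 gF] := seq_gap (0 :: 1 :: F).
pose F' := undup [seq f <- F | 0 < f < 1].
pose L := Num.min (e / 2) (1 / 2); pose w := g / 2.
have L0 : 0 < L by rewrite lt_min !divr_gt0.
have w0 : 0 < w by rewrite divr_gt0.
have n0 : 0 < (size F')%:R + 1 :> R by rewrite ltr_wpDl.
exists (Num.min (g / 4) (L * w / ((size F')%:R + 1))).
  by rewrite lt_min !divr_gt0// mulr_gt0.
move=> r rd r_out.
have inF' f : (f \in F') = (f \in F) && (0 < f < 1).
  by rewrite mem_undup mem_filter andbC.
have rd4 f : f \in F -> `|f - r f| <= g / 4.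
  by move=> /rd; rewrite le_min => /andP[].
have fg0 f : f \in F' -> g <= f.
  rewrite inF' => /andP[fF /andP[f0 _]].
  have := gF f 0; rewrite !inE fF eqxx !orbT subr0 (gt_eqF f0) => /(_ isT isT isT).
  by rewrite gtr0_norm.
have fg1 f : f \in F' -> f <= 1 - g.
  rewrite inF' => /andP[fF /andP[_ f1]].
  have := gF 1 f; rewrite !inE fF eqxx !orbT gt_eqF// gtr0_norm ?subr_gt0//.
  by move=> /(_ isT isT isT); rewrite lerBrDl -lerBrDr.
have := @time_warp F' r w (Num.min (g / 4) (L * w / ((size F')%:R + 1))) L.
case=> //.
- exact: undup_uniq.
- by rewrite (ltW L0) ge_min lexx orbT.
- apply: (@le_trans _ _ ((size F')%:R * (L * w / ((size F')%:R + 1)))).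
    by rewrite ler_wpM2l// ge_min lexx orbT.
  rewrite mulrCA ger_pMr; last by rewrite mulr_gt0.
  by rewrite ler_pdivrMr// mul1r lerDl.
- by move=> f; rewrite inF' => /andP[/rd].
- move=> f fF'; have := fg0 f fF'; have := fg1 f fF'.
  move: fF'; rewrite inF' => /andP[/rd4 + _]; rewrite ler_norml /w.
  by move=> /andP[h1 h2] h3 h4; apply/andP; split; lra.
- move=> f h; rewrite !inF' => /andP[fF _] /andP[hF _] fh.
  have := gF f h; rewrite !inE fF hF !orbT => /(_ isT isT fh).
  have := rd4 f fF; have := rd4 h hF.
  have := ler_distD (r f) f h; have := ler_distD (r h) (r f) h.
  by rewrite (distrC (r h) h) /w; lra.
move=> l [lc ls ll lF]; exists l; split=> //.
  move=> s t st; apply: le_trans (ls s t st) _.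
  have : L <= e / 2 by rewrite ge_min lexx.
  by lra.
move=> f t fF; have [f01|f01] := boolP (0 < f < 1); last first.
  by rewrite r_out// time_change_outside.
have fF' : f \in F' by rewrite inF' fF.
have r01 : 0 <= r f <= 1.
  have := fg0 f fF'; have := fg1 f fF'; have := rd4 f fF; rewrite ler_norml.
  by move=> /andP[h1 h2] h3 h4; apply/andP; split; lra.
have lr := lF f (mk_unitI r01) fF' erefl.
have [rt|tr] := ltP (val t) (r f).
  have := lc.1 t (mk_unitI r01) rt; rewrite lr => h.
  by rewrite leNgt h.
move: tr; rewrite le_eqVlt => /predU1P[tr|tr].
  by rewrite (_ : t = mk_unitI r01) ?lr ?lexx//; apply: val_inj.
by have := lc.1 (mk_unitI r01) t tr; rewrite lr => /ltW.
Qed.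

End time_warp.

(** * Step paths *)

Section step_paths.
Context {R : realType} {d : nat}.
Implicit Types (x y z : skorokhod R d) (s t : unitI R).

Definition step_fun (n : nat) (v : nat -> 'rV[R]_d) t := v (Num.truncn (n%:R * val t)).

Lemma cadlag_step n v : cadlag (step_fun n v).
Proof.
move=> t; have /andP[t0 t1] := unitIP t.
have n0 : 0 <= n%:R :> R := ler0n _ _.
have nt0 : 0 <= n%:R * val t by rewrite mulr_ge0.
have n1 : 0 < n%:R + 1 :> R by rewrite ltr_wpDl.
have /andP[k1 k2] := truncn_itv nt0.
set k := Num.truncn _ in k1 k2.
split.
  apply: cvg_near_cst; rewrite near_withinE; apply/nbhs_unitIP.
  exists ((k.+1%:R - n%:R * val t) / (n%:R + 1)); first by rewrite divr_gt0// subr_gt0.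
  move=> s st ts; rewrite /= in ts; congr (v _); apply: truncn_def.
  move: st; rewrite distrC ger0_norm ?subr_ge0// ltr_pdivlMr// => st.
  have h1 : n%:R * val t <= n%:R * val s by rewrite ler_wpM2l.
  apply/andP; split; first by apply: le_trans h1.
  by rewrite /= in ts st h1 *; lra.
have [kE|kn] := eqVneq k%:R (n%:R * val t).
  exists (v k.-1); apply: cvg_near_cst; rewrite near_withinE; apply/nbhs_unitIP.
  exists (n%:R + 1)^-1; first by rewrite invr_gt0.
  move=> s st ts; rewrite /= in ts; congr (v _).
  have [n00|npos] := posnP n.
    by move: kE; rewrite n00 !mul0r => /eqP; rewrite pnatr_eq0 => /eqP ->; rewrite truncn0.
  have npos' : 0 < n%:R :> R by rewrite ltr0n.
  apply: truncn_def.
  have kpos : (0 < k)%N.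
    rewrite -(ltr_nat R) kE mulr_gt0//; apply: le_lt_trans ts.
    by have /andP[] := unitIP s.
  rewrite prednK// kE ltr_pM2l// [val s < _]ts andbT -subn1 natrB// kE.
  move: st; rewrite gtr0_norm ?subr_gt0// -(@ltr_pM2r _ (n%:R + 1))// mulVf ?gt_eqF// => st.
  by rewrite /= in ts st *; lra.
exists (v k); apply: cvg_near_cst; rewrite near_withinE; apply/nbhs_unitIP.
exists ((n%:R * val t - k%:R) / (n%:R + 1)).
  by rewrite divr_gt0// subr_gt0 lt_neqAle kn.
move=> s st ts; rewrite /= in ts; congr (v _); apply: truncn_def.
have h1 : n%:R * val s <= n%:R * val t by rewrite ler_wpM2l// ltW.
apply/andP; split; last by apply: le_lt_trans k2.
move: st; rewrite gtr0_norm ?subr_gt0// ltr_pdivlMr// => st.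
by rewrite /= in ts st h1 *; lra.
Qed.

Definition step_path n v : skorokhod R d := Skorokhod (cadlag_step n v).

Lemma clip_subproof (a : R) : 0 <= Num.min 1 (Num.max 0 a) <= 1.
Proof. by rewrite ge_min lexx le_min ler01 le_max lexx. Qed.

Definition clip (a : R) : unitI R := mk_unitI (clip_subproof a).

Lemma clipE (a : R) : 0 <= a <= 1 -> val (clip a) = a.
Proof. by move=> /andP[a0 a1]; rewrite /= max_r// min_r. Qed.

Definition sample x n (k : nat) : 'rV[R]_d := x (clip (k%:R / n%:R)).

Lemma nat_ceil (a : R) : 0 <= a ->
  exists c : nat, a <= c%:R <= a + 1 /\ forall k : nat, (a <= k%:R) = (c%:R <= k%:R :> R).
Proof.
move=> a0; have ex : exists k : nat, a <= k%:R.
  by exists (Num.truncn a).+1; apply/ltW; have /andP[] := truncn_itv a0.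
case: (ex_minnP ex) => c ac cmin; exists c; split.
  rewrite ac/=; case: c cmin ac => [|c] cmin ac; first by rewrite addr_ge0.
  rewrite -natr1 lerD2r leNgt; apply/negP => /ltW /cmin.
  by rewrite ltnn.
move=> k; apply/idP/idP => [/cmin|]; first by rewrite ler_nat.
exact: le_trans.
Qed.

(** The jumps of the sampled path sit at the grid points that follow the jumps
of the path, so a small time change realigns the cells. *)
Lemma step_path_cvg x (e : R) : 0 < e -> exists N, forall n, (N <= n)%N ->
  J1_dist (step_path n (sample x n)) x <= e.
Proof.
move=> e0; have [F FE] := split_cells (cadlag_split (path_cadlag x) e0).
have [dlt d0 warp] := cell_warp F e0.
have [N Nd] : exists N : nat, dlt^-1 <= N%:R.
  exists (Num.truncn dlt^-1).+1; apply/ltW.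
  by have /andP[] : _ && (dlt^-1 < _) := truncn_itv (ltW (etrans (invr_gt0 _) d0)).
exists N => n Nn.
have dn : dlt^-1 <= n%:R by apply: le_trans Nd _; rewrite ler_nat.
have n0 : 0 < n%:R :> R by apply: lt_le_trans dn; rewrite invr_gt0.
have n_dlt : n%:R^-1 <= dlt by rewrite -[dlt]invrK lef_pV2// posrE invr_gt0.
have cP (f : R) : exists c : nat, 0 < f -> n%:R * f <= c%:R <= n%:R * f + 1 /\
    forall k : nat, (n%:R * f <= k%:R) = (c%:R <= k%:R :> R).
  have [f0|] := ltP 0 f; last by exists 0%N.
  by have [|c] := @nat_ceil (n%:R * f); [rewrite mulr_ge0// ltW|exists c].
have [c {}cP] := choice cP.
pose r (f : R) := if 0 < f < 1 then (c f)%:R / n%:R else f.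
have [||l [lc ls lF]] := warp r.
- move=> f fF; rewrite /r; case: ifPn => [/andP[f0 f1]|_]; last first.
    by rewrite subrr normr0 ltW.
  have [/andP[c1 c2] _] := cP f f0.
  apply: le_trans n_dlt; rewrite distrC ger0_norm.
    by rewrite lerBlDr ler_pdivrMr// mulrDl mulVf ?gt_eqF//; lra.
  by rewrite subr_ge0 ler_pdivlMr//; lra.
- by move=> f _; rewrite /r => /negbTE ->.
apply: (J1_dist_le lc); split=> // t.
rewrite /= /step_fun /sample; set k := Num.truncn _.
have /andP[t0 t1] := unitIP t.
have nt0 : 0 <= n%:R * val t by rewrite mulr_ge0// ltW.
have /andP[k1 k2] := truncn_itv nt0.
rewrite -/k in k1 k2.
(* Both [r f <= t] and [f <= k / n] say that the first grid point not
   before [f] is reached at time [t]. *)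
have kn01 : 0 <= (k%:R / n%:R : R) <= 1.
  by rewrite divr_ge0//= ler_pdivrMr// (le_trans k1)// [leRHS]mulrC ler_wpM2l// ltW.
apply: FE => f fF; rewrite clipE// -lF// /r.
case: ifPn => [/andP[f0 f1]|].
  have [_ cf] := cP f f0.
  rewrite ler_pdivlMr// mulrC cf ler_pdivrMr// [val t * _]mulrC.
  by rewrite ler_nat truncn_ge_nat.
have /andP[kn0 kn1] := kn01.
rewrite negb_and -!leNgt => f01.
have [f0|f0] := leP f 0; first by rewrite !(le_trans f0).
have {f01}f1 : 1 <= f by move: f01; rewrite leNgt f0.
have [tE|tn1] := eqVneq t unitI1.
  by rewrite /k tE /= mulr1 natrK divff// gt_eqF.
have t1' : val t < 1 by rewrite lt_neqAle t1 andbT; apply: contra_neq tn1 => /= h; exact: val_inj.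
have kn1' : (k%:R / n%:R : R) < 1.
  by rewrite ltr_pdivrMr// mul1r (le_lt_trans k1)// gtr_pMr.
by rewrite !leNgt (lt_le_trans t1' f1) (lt_le_trans kn1' f1).
Qed.

Lemma step_path_dist n v w (e : R) : (forall k, (k <= n)%N -> enorm (v k - w k) <= e) ->
  J1_dist (step_path n v) (step_path n w) <= e.
Proof.
move=> vwe; have vw0 := vwe 0%N (leq0n _).
apply: (J1_dist_le time_change_id); split=> [s t st|t].
  by rewrite log_slope_id// (le_trans (enorm_ge0 _) vw0).
apply: vwe; have /andP[t0 t1] := unitIP t.
rewrite -(@ler_nat R); apply: le_trans (_ : n%:R * val t <= _).
  by have /andP[] : _ && _ := truncn_itv (mulr_ge0 (ler0n R n) t0).
by rewrite ler_piMr.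
Qed.

End step_paths.

(** * Continuity points of multiplication *)

Section product_continuity.
Context {R : realType} {d : nat}.
Implicit Types (x y z : skorokhod R d) (s t p q : unitI R).

Lemma mulv_dist (a b c e : 'rV[R]_d) :
  enorm (mulv a b - mulv c e) <= enorm (a - c) * enorm b + enorm c * enorm (b - e).
Proof.
have -> : mulv a b - mulv c e = mulv (a - c) b + mulv c (b - e).
  by apply/rowP => i; rewrite !mxE; ring.
by apply: le_trans (enormD _ _) _; apply: lerD; exact: enorm_mulv.
Qed.

Lemma enorm_dist (a b c : 'rV[R]_d) : enorm (a - c) <= enorm (a - b) + enorm (b - c).
Proof. by rewrite -[a - c](subrKA b) enormD. Qed.

Lemma enorm_distC (a b : 'rV[R]_d) : enorm (a - b) = enorm (b - a).
Proof. by rewrite -enormN opprB. Qed.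

(** A small time change of [x] shifts its jumps relative to those of [y]. At a
common jump, with [p] and [q] on either side of it, this inserts the value
[y_q * x_p] between [y_p * x_p] and [y_q * x_q]. The product survives this in
the Skorokhod metric exactly when the inserted value is close to one of its
neighbours, whichever of [p] and [q] comes first. Times near 1 are excluded,
since time changes fix 1. *)
Definition tame_jumps y x := forall e eta : R, 0 < e -> 0 < eta ->
  exists2 dlt : R, 0 < dlt & forall p q, val p < 1 - eta -> val q < 1 - eta ->
    `|val p - val q| < dlt ->
    enorm (mulv (y q) (x p) - mulv (y p) (x p)) <= e \/
    enorm (mulv (y q) (x p) - mulv (y q) (x q)) <= e.

Lemma nbhs_skorokhod x (A : set (skorokhod R d)) :
  nbhs x A <-> exists2 e : R, 0 < e & forall z, J1_dist x z < e -> A z.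
Proof.
split=> [/nbhs_ballP[e e0 xA]|[e e0 xA]]; last apply/nbhs_ballP.
  by exists e => // z xz; apply: xA; rewrite ballEmdist.
by exists e => // z; rewrite ballEmdist; exact: xA.
Qed.

Lemma continuous_skorokhodP (f : skorokhod R d -> skorokhod R d) x :
  {for x, continuous f} <-> forall e : R, 0 < e ->
    exists2 dlt : R, 0 < dlt & forall z, J1_dist x z < dlt -> J1_dist (f x) (f z) < e.
Proof.
have pullback : {for x, continuous f} <->
    forall A, nbhs (f x) A -> nbhs x (f @^-1` A) by [].
rewrite pullback; split=> [cf e e0|cf A /nbhs_skorokhod[e e0 fA]].
  have /cf/nbhs_skorokhod[dlt d0 dP] : nbhs (f x) [set z | J1_dist (f x) z < e].
    by apply/nbhs_skorokhod; exists e.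
  by exists dlt.
have [dlt d0 dP] := cf e e0.
by apply/nbhs_skorokhod; exists dlt => // z /dP/fA.
Qed.

Section common_cells.
Variables (x y : skorokhod R d) (e1 : R) (F : seq R).
Hypothesis FE : forall u v : unitI R, same_cell F (val u) (val v) ->
  enorm (x u - x v) <= e1 /\ enorm (y u - y v) <= e1.
Let K := supnorm x + supnorm y.

Lemma same_cell_mulv s s' t t' : same_cell F (val s) (val t) ->
  same_cell F (val s') (val t') ->
  enorm (mulv (y s) (x s') - mulv (y t) (x t')) <= K * e1.
Proof.
move=> /FE[_ yst] /FE[xst _]; apply: le_trans (mulv_dist _ _ _ _) _.
rewrite /K mulrDl; apply: lerD; last by apply: ler_pM; rewrite ?enorm_ge0 ?enorm_le_supnorm.
by rewrite mulrC; apply: ler_pM; rewrite ?enorm_ge0 ?enorm_le_supnorm.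
Qed.

Variables (g dd : R).
Hypothesis dd0 : 0 < dd.
Hypothesis ddg : 4 * dd < g.
Hypothesis gF : forall a b : R, a \in 0 :: 1 :: F -> b \in 0 :: 1 :: F -> a != b -> g <= `|a - b|.

Lemma near_boundary (f : R) s t : f \in F -> (f <= val s) = (f <= val t) ->
  `|val s - f| <= 2 * dd -> `|val t - f| <= dd -> same_cell F (val s) (val t).
Proof.
have dpos := dd0; have dg := ddg.
move=> fF fst sf tf h hF; have [->//|hf] := eqVneq h f.
have := gF (a := h) (b := f); rewrite !inE hF fF !orbT => /(_ isT isT hf) ghf.
move: sf tf; rewrite !ler_norml => /andP[s1 s2] /andP[t1 t2]; rewrite /= in s1 s2 t1 t2.
move: ghf; rewrite ler_normr => /orP[] ghf.
  have hs : val s < h by rewrite /=; lra.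
  have ht : val t < h by rewrite /=; lra.
  by rewrite !leNgt hs ht.
have hs : h <= val s by rewrite /=; lra.
have ht : h <= val t by rewrite /=; lra.
by rewrite hs ht.
Qed.

Section shift.
Variable l : unitI R -> unitI R.
Hypothesis lc : time_change l.
Hypothesis l_near : forall t, `|val t - val (l t)| <= dd.

(* The time change moves [t] across the boundary [f]. *)
Let sep (f : R) t := (f <= val t) != (f <= val (l t)).

Lemma sep_near (f : R) t : sep f t -> `|val t - f| <= dd /\ `|val (l t) - f| <= dd.
Proof.
move=> ft; have := l_near t; rewrite ler_norml => /andP[t1 t2].
rewrite !ler_norml; move: ft; rewrite /sep; rewrite /= in t1 t2 *.
case: leP => f1; case: leP => f2 // _; by split; apply/andP; split; lra.
Qed.

Lemma sep_same (f : R) s t : sep f s -> sep f t -> (f <= val s) = (f <= val t).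
Proof.
rewrite /sep; case: (leP f (val s)) => s1; case: (leP f (val t)) => t1 //.
  case: (leP f (val (l s))) => s2; case: (leP f (val (l t))) => t2 // _ _.
  have := lc.1 _ _ (lt_le_trans t1 s1).
  by rewrite ltNge (ltW (lt_le_trans s2 t2)).
case: (leP f (val (l s))) => s2; case: (leP f (val (l t))) => t2 // _ _.
have := lc.1 _ _ (lt_le_trans s1 t1).
by rewrite ltNge (ltW (lt_le_trans t2 s2)).
Qed.

Lemma sep_uniq (f h : R) t : f \in F -> h \in F -> sep f t -> sep h t -> h = f.
Proof.
have dpos := dd0; have dg := ddg.
move=> fF hF /sep_near[ft _] /sep_near[ht _]; apply/eqP; apply: contraT => hf.
have := gF (a := h) (b := f); rewrite !inE hF fF !orbT => /(_ isT isT hf).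
have := ler_distD (val t) h f; rewrite (distrC h (val t)).
by rewrite /= in ft ht; lra.
Qed.

Lemma sep_cells (f : R) s t : f \in F -> sep f s -> sep f t ->
  same_cell F (val s) (val t) /\ same_cell F (val (l s)) (val (l t)).
Proof.
have dpos := dd0.
move=> fF fs ft; have [s1 s2] := sep_near fs; have [t1 t2] := sep_near ft.
have dd2 : dd <= 2 * dd by lra.
have st := sep_same fs ft.
split; apply: (near_boundary fF) => //; first exact: le_trans dd2.
  by move: fs ft st; rewrite /sep; do 4 case: (f <= _).
exact: le_trans dd2.
Qed.

(** Each cell boundary [f] is kept or moved back by the time change [l],
according to which end of the jump of the product is close to the value
inserted between them. *)
Lemma boundary_choice (f : R) : f \in F ->
  (forall t, sep f t ->
    enorm (mulv (y t) (x (l t)) - mulv (y (l t)) (x (l t))) <= e1 \/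
    enorm (mulv (y t) (x (l t)) - mulv (y t) (x t)) <= e1) ->
  exists r : R, [/\ `|f - r| <= dd, ~~ (0 < f < 1) -> r = f &
    ((forall t, (r <= val t) = (f <= val t)) /\ (forall t, sep f t ->
      enorm (mulv (y t) (x (l t)) - mulv (y t) (x t)) <= (2 * K + 1) * e1)) \/
    ((forall t, (r <= val t) = (f <= val (l t))) /\ (forall t, sep f t ->
      enorm (mulv (y t) (x (l t)) - mulv (y (l t)) (x (l t))) <= (2 * K + 1) * e1))].
Proof.
move=> fF tame.
have [f01|f01] := boolP (0 < f < 1); last first.
  exists f; split=> //; first by rewrite subrr normr0 ltW.
  by left; split=> // t; rewrite /sep time_change_outside// eqxx.
have [[t0 ft0]|nosep] := pselect (exists t, sep f t); last first.
  exists f; split=> //; first by rewrite subrr normr0 ltW.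
  by left; split=> // t ft; case: nosep; exists t.
have bound t u v u0 v0 : same_cell F (val u) (val u0) -> same_cell F (val v) (val v0) ->
    same_cell F (val t) (val t0) -> same_cell F (val (l t)) (val (l t0)) ->
    enorm (mulv (y t0) (x (l t0)) - mulv (y u0) (x v0)) <= e1 ->
    enorm (mulv (y t) (x (l t)) - mulv (y u) (x v)) <= (2 * K + 1) * e1.
  move=> uu vv tt ll h0.
  have h1 := same_cell_mulv tt ll; have h2 := same_cell_mulv uu vv.
  rewrite enorm_distC in h2.
  have := enorm_dist (mulv (y t) (x (l t))) (mulv (y t0) (x (l t0))) (mulv (y u) (x v)).
  have := enorm_dist (mulv (y t0) (x (l t0))) (mulv (y u0) (x v0)) (mulv (y u) (x v)).
  by lra.
have [k [kc lk kl]] := time_change_inv lc.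
have fin : 0 <= f <= 1 by have /andP[/ltW -> /ltW ->] := f01.
pose r := val (k (clip f)); have lr : val (l (k (clip f))) = f by rewrite kl clipE.
case: (tame t0 ft0) => h0; last first.
  exists f; split=> //; first by rewrite subrr normr0 ltW.
  left; split=> // t ft; have [tt ll] := sep_cells fF ft ft0.
  exact: bound h0.
exists r; split.
- by have := l_near (k (clip f)); rewrite lr distrC.
- by [].
- right; split=> t; last first.
    move=> ft; have [tt ll] := sep_cells fF ft ft0.
    exact: bound h0.
  rewrite -[in RHS]lr; have [rt|tr] := ltP (val t) r.
    by rewrite leNgt lc.1.
  move: tr; rewrite le_eqVlt => /predU1P[/val_inj <-|tr]; first by rewrite lexx.
  by rewrite ltW// lc.1.
Qed.

End shift.
End common_cells.

Lemma common_cells x y (e : R) : 0 < e -> exists F, forall u v : unitI R,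
  same_cell F (val u) (val v) -> enorm (x u - x v) <= e /\ enorm (y u - y v) <= e.
Proof.
move=> e0; apply: split_cells; apply: locally_splitI; apply: cadlag_split => //;
  exact: path_cadlag.
Qed.

(** Let [z] be close to [x] along a time change [l]. The product of [y] and [z]
agrees with that of [y] and [x] up to the time change that moves every cell
boundary either by [l] or not at all, as told by [boundary_choice]: a time
[t] is separated from [l t] by at most one boundary, and there the product
[y t * x (l t)] is close to the value that the new time change selects. *)
Lemma tame_continuous y x : tame_jumps y x -> {for x, continuous (path_mul y)}.
Proof.
move=> tame; apply/continuous_skorokhodP => e e0.
pose K := supnorm x + supnorm y.
have K0 : 0 <= K by rewrite addr_ge0 ?supnorm_ge0.
have yK : supnorm y <= K by rewrite /K lerDr supnorm_ge0.
(* [K * e1] for replacing [z] by [x], and [(3 * K + 1) * e1] for the cells. *)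
pose e1 := e / 2 / (4 * K + 1).
have K1 : 0 < 4 * K + 1 by lra.
have e10 : 0 < e1 by rewrite !divr_gt0.
have e1E : (4 * K + 1) * e1 = e / 2 by rewrite mulrC divfK// gt_eqF.
have [F FE] := common_cells x y e10.
have [g g0 gF] := seq_gap (0 :: 1 :: F).
have g20 : 0 < g / 2 by rewrite divr_gt0.
have [dg dg0 dgP] := tame _ _ e10 g20.
have e20 : 0 < e / 2 by rewrite divr_gt0.
have [dw dw0 warp] := cell_warp F e20.
pose dd := Num.min (g / 8) (Num.min (dg / 2) dw).
have dd0 : 0 < dd by rewrite !lt_min dw0 !divr_gt0.
have [ddg dddg dddw] : [/\ dd <= g / 8, dd <= dg / 2 & dd <= dw].
  by rewrite /dd !ge_min !lexx !orbT.
have ddg4 : 4 * dd < g by clear -ddg g0; lra.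
have [en en0 enP] := time_change_near dd0.
exists (Num.min en e1); first by rewrite lt_min en0.
move=> z; rewrite J1_sym => /J1_dist_lt[l lc [ls lz]].
have l_near t : `|val t - val (l t)| <= dd.
  by apply: enP => // s t' st; apply: le_trans (ls _ _ st) _; rewrite ge_min lexx.
have rP f : exists r : R, f \in F -> [/\ `|f - r| <= dd, ~~ (0 < f < 1) -> r = f &
    ((forall t, (r <= val t) = (f <= val t)) /\
     (forall t, (f <= val t) != (f <= val (l t)) ->
      enorm (mulv (y t) (x (l t)) - mulv (y t) (x t)) <= (2 * K + 1) * e1)) \/
    ((forall t, (r <= val t) = (f <= val (l t))) /\
     (forall t, (f <= val t) != (f <= val (l t)) ->
      enorm (mulv (y t) (x (l t)) - mulv (y (l t)) (x (l t))) <= (2 * K + 1) * e1))].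
  have [fF|fF] := boolP (f \in F); last by exists 0.
  have [|r rP] := boundary_choice FE dd0 ddg4 gF lc l_near fF; last by exists r.
  move=> t ft; have [ft1 ft2] := sep_near l_near ft.
  have f1 : f <= 1 - g.
    have [f01|f01] := boolP (0 < f < 1); last first.
      by move: ft; rewrite (time_change_outside _ lc f01) eqxx.
    have /andP[f0 f1] := f01.
    have := gF 1 f; rewrite !inE fF eqxx !orbT (gt_eqF f1) => /(_ isT isT isT).
    by rewrite gtr0_norm ?subr_gt0//; clear; lra.
  apply: dgP.
  - by move: ft2; rewrite ler_norml /= => /andP[_ ft2]; clear -ft2 f1 ddg g0; lra.
  - by move: ft1; rewrite ler_norml /= => /andP[_ ft1]; clear -ft1 f1 ddg g0; lra.
  - by rewrite distrC; apply: le_lt_trans (l_near t) _; clear -dddg dg0; lra.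
have [r {}rP] := choice rP.
have [||m [mc ms mF]] := warp r.
- by move=> f /rP[h _ _]; exact: le_trans h dddw.
- by move=> f /rP[_ h _].
have near_x t : enorm (mulv (y t) (z t) - mulv (y t) (x (l t))) <= K * e1.
  apply: le_trans (mulv_dist _ _ _ _) _; rewrite subrr enorm0 mul0r add0r.
  apply: ler_pM; rewrite ?enorm_ge0//.
    by apply: le_trans (enorm_le_supnorm _ _) yK.
  by apply: le_trans (lz t) _; rewrite ge_min lexx orbT.
suff near_m t : enorm (mulv (y t) (x (l t)) - mulv (y (m t)) (x (m t))) <= (3 * K + 1) * e1.
  rewrite J1_sym; apply: (@le_lt_trans _ _ (e / 2)); last by clear -e0; lra.
  apply: (J1_dist_le mc); split=> // t /=.
  apply: le_trans (enorm_dist _ (mulv (y t) (x (l t))) _) _.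
  by have := near_x t; have := near_m t; clear -e1E; lra.
have Ke1 : 0 <= K * e1 by rewrite mulr_ge0// ltW.
have [[f [fF ft]]|nosep] :=
    pselect (exists f, f \in F /\ (f <= val t) != (f <= val (l t))); last first.
  have tl : same_cell F (val t) (val (l t)).
    move=> f fF; apply/eqP; apply: contraT => ft; case: nosep; by exists f.
  have tm : same_cell F (val t) (val (m t)).
    move=> f fF; rewrite -mF//; have [_ _ [][rt _]] := rP f fF; rewrite rt//.
    exact: tl.
  have lm : same_cell F (val (l t)) (val (m t)) by move=> f fF; rewrite -tl// tm.
  by have := same_cell_mulv FE tm lm; rewrite -/K; clear -Ke1 e10; lra.
have others h : h \in F -> h != f -> (h <= val t) = (h <= val (l t)).
  move=> hF /eqP hf; apply/eqP; apply: contraT => ht; case: hf.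
  exact: (sep_uniq dd0 ddg4 gF l_near fF hF ft ht).
have rt_others h : h \in F -> h != f -> (r h <= val t) = (h <= val t).
  move=> hF hf; have [_ _ [][rt _]] := rP h hF; rewrite rt//.
  by rewrite others.
have [_ _ [][rt bound]] := rP f fF.
  have tm : same_cell F (val t) (val (m t)).
    move=> h hF; rewrite -mF//; have [->|hf] := eqVneq h f; first by rewrite rt.
    by rewrite rt_others.
  have := same_cell_mulv FE tm tm; have := bound t ft; rewrite -/K.
  by have := enorm_dist (mulv (y t) (x (l t))) (mulv (y t) (x t)) (mulv (y (m t)) (x (m t)));
    clear -Ke1 e10; lra.
have lm : same_cell F (val (l t)) (val (m t)).
  move=> h hF; rewrite -mF//; have [->|hf] := eqVneq h f; first by rewrite rt.
  by rewrite rt_others// others.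
have := same_cell_mulv FE lm lm; have := bound t ft; rewrite -/K.
by have := enorm_dist (mulv (y t) (x (l t))) (mulv (y (l t)) (x (l t))) (mulv (y (m t)) (x (m t)));
  clear -Ke1 e10; lra.
Qed.

Lemma cadlag_time_change (x : unitI R -> 'rV[R]_d) (l : unitI R -> unitI R) : cadlag x ->
  time_change l -> (forall s t, `|val (l s) - val (l t)| <= 2 * `|val s - val t|) ->
  cadlag (x \o l).
Proof.
move=> cx lc ll t; have [rx [v lx]] := cx (l t).
have shrink (A : set (unitI R)) (P Q : unitI R -> Prop) : (forall s, Q s -> P (l s)) ->
    within P (nbhs (l t)) A -> within Q (nbhs t) (l @^-1` A).
  move=> QP /nbhs_unitIP[e e0 lA]; apply/nbhs_unitIP.
  exists (e / 2); first by rewrite divr_gt0.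
  move=> s ts /QP; apply: lA; apply: le_lt_trans (ll _ _) _.
  by rewrite mulrC -ltr_pdivlMr.
split.
  move=> A /rx; apply: (shrink _ (fun s => val (l t) <= val s)) => s /=.
  by rewrite le_eqVlt => /predU1P[/val_inj -> //|/lc.1/ltW].
by exists v => A /lx; apply: (shrink _ (fun s => val s < val (l t))) => s /= /lc.1.
Qed.

(** The converse is tested on [x \o l], where [l] moves [q] to [p]: at time [q] its
product with [y] takes the value [y_q * x_p], and a product close to [y * x]
can only take values close to those on the two sides of the jump. *)
Lemma continuous_tame y x : {for x, continuous (path_mul y)} -> tame_jumps y x.
Proof.
move=> /continuous_skorokhodP cont e eta e0 eta0.
pose z := path_mul y x; pose K := supnorm y.
have K0 : 0 <= K by exact: supnorm_ge0.
pose e1 := e / (K + 2); have K2 : 0 < K + 2 by lra.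
have e10 : 0 < e1 by rewrite divr_gt0.
have e1E : (K + 2) * e1 = e by rewrite mulrC divfK// gt_eqF.
have Ke1 : 0 <= K * e1 by rewrite mulr_ge0// ltW.
have [F FE] := common_cells x z e10.
have [g g0 gF] := seq_gap (0 :: 1 :: F).
pose dd := g / 8; have dd0 : 0 < dd by rewrite divr_gt0.
have ddg : 4 * dd < g by rewrite /dd; lra.
have [en en0 enP] := time_change_near dd0.
have [|dc dc0 dcP] := cont (Num.min en e1); first by rewrite lt_min en0.
pose L := Num.min (1 / 2) (dc / 4); pose w := Num.min (g / 2) eta.
have L0 : 0 < L by rewrite lt_min !divr_gt0.
have [L2 Ldc] : L <= 1 / 2 /\ L <= dc / 4 by rewrite /L !ge_min !lexx orbT.
have w0 : 0 < w by rewrite lt_min eta0 divr_gt0.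
have [wg weta] : w <= g / 2 /\ w <= eta by rewrite /w !ge_min !lexx orbT.
exists (Num.min dd (L * w)); first by rewrite lt_min dd0 mulr_gt0.
move=> p q p1 q1; rewrite lt_min => /andP[pq_dd pq_L].
have [pq|] := pselect (same_cell F (val p) (val q)).
  right; apply: le_trans (mulv_dist _ _ _ _) _; rewrite subrr enorm0 mul0r add0r.
  have [h _] := FE _ _ pq.
  apply: (@le_trans _ _ (K * e1)); last by clear -e10 e1E; lra.
  by apply: ler_pM; rewrite ?enorm_ge0// enorm_le_supnorm.
move=> npq; have [f [fF fpq]] : exists f : R, f \in F /\ (f <= val p) != (f <= val q).
  apply: contrapT => h; apply: npq => f fF; apply/eqP; apply: contraT => fpq.
  by case: h; exists f.
have [pf qf] : `|val p - f| <= dd /\ `|val q - f| <= dd.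
  clear -pq_dd fpq; move: pq_dd; rewrite ltr_norml => /andP[h1 h2]; move: fpq.
  by rewrite !ler_norml; case: leP => h3; case: leP => h4 // _; split;
    apply/andP; split; lra.
have f_g : g <= f.
  have f0 : 0 < f.
    rewrite ltNge; apply/negP => f0; move: fpq.
    have /andP[p0 _] := unitIP p; have /andP[q0 _] := unitIP q.
    by rewrite !(le_trans f0).
  have := gF f 0; rewrite !inE fF eqxx !orbT (gt_eqF f0) => /(_ isT isT isT).
  by rewrite subr0 gtr0_norm.
have [|||||||l [lc ls ll lF]] := @time_warp _ [:: val p] (fun=> val q) w (L * w) L.
- by [].
- exact: w0.
- by rewrite (ltW L0).
- by rewrite mul1r.
- by move=> h; rewrite inE => /eqP ->; rewrite ltW.
- move=> h _; move: qf; rewrite ler_norml => /andP[q3 q4].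
  clear -q1 q3 q4 wg weta f_g g0; rewrite /dd /= in q1 q3 q4 *.
  by apply/andP; split; lra.
- by move=> h h'; rewrite !inE => /eqP -> /eqP ->; rewrite eqxx.
have lq : l q = p by apply: val_inj; apply: lF => //; rewrite inE.
pose x' := Skorokhod (cadlag_time_change (path_cadlag x) lc ll).
have xx' : J1_dist x x' < dc.
  rewrite J1_sym; apply: (@le_lt_trans _ _ (2 * L)); last by clear -dc0 Ldc; lra.
  by apply: (J1_dist_le lc); split=> // t; rewrite subrr enorm0 mulr_ge0// ltW.
have := dcP _ xx'; rewrite J1_sym => /J1_dist_lt[m mc [ms mz]].
have mq : `|val q - val (m q)| <= dd.
  by apply: enP => // s t st; apply: le_trans (ms _ _ st) _; rewrite ge_min lexx.
have mqf : `|val (m q) - f| <= 2 * dd.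
  have := ler_distD (val q) (val (m q)) f; rewrite (distrC (val (m q)) (val q)).
  by clear -mq qf; lra.
have zq : enorm (mulv (y q) (x p) - z (m q)) <= e1.
  by have := mz q; rewrite /= lq le_min => /andP[].
have close t : same_cell F (val (m q)) (val t) -> enorm (mulv (y q) (x p) - z t) <= e.
  move=> /FE[_ h]; apply: le_trans (enorm_dist _ (z (m q)) _) _.
  by clear -h zq e10 Ke1 e1E; lra.
have [mf|mf] := eqVneq (f <= val (m q)) (f <= val p).
  by left; apply: close; exact: (near_boundary dd0 ddg gF fF).
right; apply: close; apply: (near_boundary dd0 ddg gF fF) => //.
by move: mf fpq; do 3 case: (f <= _).
Qed.

End product_continuity.

(** * Borel sets of the path space and coordinates *)

HB.instance Definition _ (R : realType) (d : nat) :=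
  isPointed.Build (skorokhod R d) (path_cst 0).

HB.instance Definition _ (R : realType) (d : nat) :=
  @isMeasurable.Build (sigma_display (@open (skorokhod R d))) (skorokhod R d)
    <<s @open (skorokhod R d) >> (@sigma_algebra0 _ setT _)
    (@sigma_algebraC _ _) (@sigma_algebra_bigcup _ setT _).

Lemma small_inv (R : realType) (e : R) : 0 < e -> exists k : nat, k.+1%:R^-1 < e.
Proof.
move=> e0; exists (Num.truncn e^-1).
by rewrite -[ltRHS]invrK ltf_pV2 ?posrE ?invr_gt0// truncnS_gt.
Qed.

Lemma metric_ball_open (R : realType) (M : metricType R) (x : M) (r : R) :
  open (ball x r).
Proof.
rewrite openE => y; rewrite ballEmdist /= => xy; apply/nbhs_ballP.
exists (r - mdist x y) => /=; first by rewrite subr_gt0.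
move=> z; rewrite !ballEmdist /= ltrBrDl; apply: le_lt_trans.
exact: metric_triangle.
Qed.

Section measurability_tools.
Context {R : realType} {disp : measure_display} {T : measurableType disp}.

Lemma measurable_exists (I : countType) (A : I -> T -> Prop) :
  (forall i, measurable [set w | A i w]) -> measurable [set w | exists i, A i w].
Proof.
move=> mA; rewrite (_ : [set w | _] = \bigcup_i [set w | A i w]).
  by apply: countable_bigcupT_measurable.
by apply/seteqP; split=> w [i]; exists i.
Qed.

Lemma measurable_forall (I : countType) (A : I -> T -> Prop) :
  (forall i, measurable [set w | A i w]) -> measurable [set w | forall i, A i w].
Proof.
move=> mA; rewrite (_ : [set w | _] = ~` [set w | exists i, ~ A i w]).
  apply: measurableC; apply: measurable_exists => i.
  exact: (measurableC (mA i)).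
apply/seteqP; split=> w /=; first by move=> Aw [i]; apply.
by move=> h i; apply: contrapT => Ai; apply: h; exists i.
Qed.

Lemma measurable_cst_and (Q : Prop) (A : T -> Prop) :
  (Q -> measurable [set w | A w]) -> measurable [set w | Q /\ A w].
Proof.
move=> mA; have [q|q] := pselect Q.
  by rewrite (_ : [set w | _] = [set w | A w]); [exact: mA|apply/seteqP; split=> w //= []].
by rewrite (_ : [set w | _] = set0)//; apply/seteqP; split=> w //= [].
Qed.

Lemma measurable_ltr (f g : T -> R) : measurable_fun setT f -> measurable_fun setT g ->
  measurable [set w | f w < g w].
Proof.
move=> mf mg; have := measurable_fun_ltr mf mg; move=> /(_ measurableT [set true]).
by rewrite setTI; apply.
Qed.

Lemma measurable_ler (f g : T -> R) : measurable_fun setT f -> measurable_fun setT g ->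
  measurable [set w | f w <= g w].
Proof.
move=> mf mg; have := measurable_fun_ler mf mg; move=> /(_ measurableT [set true]).
by rewrite setTI; apply.
Qed.

(** Open sets of matrices are countable unions of rational boxes. *)
Lemma measurable_open_matrix m n (M : T -> 'M[R]_(m, n)) (U : set 'M[R]_(m, n)) :
  (forall i j, measurable_fun setT (fun w => M w i j)) -> open U ->
  measurable [set w | U (M w)].
Proof.
move=> mM oU.
pose box (qk : 'M[rat]_(m, n) * nat) : set 'M[R]_(m, n) :=
  [set N | forall ij : 'I_m * 'I_n, `|N ij.1 ij.2 - ratr (qk.1 ij.1 ij.2)| < qk.2.+1%:R^-1].
rewrite (_ : [set w | _] = [set w | exists qk, box qk `<=` U /\ box qk (M w)]).
  apply: measurable_exists => qk; apply: measurable_cst_and => _.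
  apply: measurable_forall => ij; apply: measurable_ltr => //.
  by apply: measurableT_comp => //; exact: measurable_funB.
apply/seteqP; split=> w /=; last by move=> [qk [bU bM]]; exact: bU.
move=> UM; have /nbhs_ballP[e e0 eU] : nbhs (M w) U by exact: open_nbhs_nbhs.
have [k ke] : exists k : nat, k.+1%:R^-1 < e / 2.
  by apply: small_inv; rewrite divr_gt0.
have k0 : 0 < k.+1%:R^-1 :> R by rewrite invr_gt0.
have qP (ij : 'I_m * 'I_n) : exists q : rat, `|M w ij.1 ij.2 - ratr q| < k.+1%:R^-1.
  move: k0; move: (k.+1%:R^-1 : R) => dl dl0.
  have : M w ij.1 ij.2 - dl < M w ij.1 ij.2 + dl by lra.
  move=> /rat_in_itvoo[q]; rewrite in_itv/= => /andP[q1 q2]; exists q.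
  by rewrite ltr_norml; apply/andP; split; lra.
have [q {}qP] := choice qP.
exists (\matrix_(i, j) q (i, j), k); split; last first.
  by move=> [i j] /=; rewrite mxE; exact: (qP (i, j)).
move=> N bN; apply: eU; split=> // i j; rewrite /ball/=.
have := bN (i, j); have := qP (i, j); rewrite /= mxE.
have := ler_distD (ratr (q (i, j))) (M w i j) (N i j); rewrite (distrC (N i j)).
by move: k0 ke; move: (k.+1%:R^-1 : R) => dl; lra.
Qed.

End measurability_tools.

Section borel_paths.
Context {R : realType} {d : nat} {disp : measure_display} {T : measurableType disp}.
Implicit Types (x : skorokhod R d) (Z : T -> skorokhod R d).

(** The Borel sets of the Skorokhod metric are generated by the coordinates:
a path is the limit of its step approximations, which depend continuously on
finitely many coordinates. *)
Lemma measurable_process Z :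
  (forall t k, measurable_fun setT (fun w => Z w t 0 k)) -> measurable_fun setT Z.
Proof.
move=> mZ; apply: (@measurability _ _ _ _ _ _ (@open (skorokhod R d))) => // _ [U oU <-]; rewrite setTI.
pose step n (M : 'M[R]_(n.+1, d)) : skorokhod R d :=
  step_path n (fun k => row (inord k) M).
have step_cont n : continuous (step n).
  move=> M A /nbhs_skorokhod[e e0 eA]; apply/nbhs_ballP.
  have d0 : 0 < d%:R + 1 :> R by rewrite ltr_wpDl.
  exists (e / (d%:R + 1)) => /=; first by rewrite divr_gt0.
  move=> N MN; apply: eA; apply: (@le_lt_trans _ _ (d%:R * (e / (d%:R + 1)))).
    apply: step_path_dist => k _; apply: enorm_le => i; rewrite !mxE ltW//.
    by case: MN => _; apply.
  by rewrite mulrCA gtr_pMr// ltr_pdivrMr// mul1r ltrDl.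
(* Open sets that exhaust [U], with [V k] at distance at least [1 / k.+1] from
   the complement of [U]. *)
pose V k : set (skorokhod R d) :=
  \bigcup_(x in [set x | ball x (2 / k.+1%:R) `<=` U]) ball x k.+1%:R^-1.
have oV k : open (V k).
  by apply: bigcup_open => x _; exact: metric_ball_open.
pose coords n (w : T) : 'M[R]_(n.+1, d) := \matrix_(k, i) sample (Z w) n k 0 i.
have coordsE n w : step n (coords n w) = step_path n (sample (Z w) n).
  apply: skorokhod_eq => t; rewrite /= /step_fun.
  apply/rowP => i; rewrite !mxE inordK// ltnS.
  have /andP[t0 t1] := unitIP t.
  rewrite -(@ler_nat R); apply: le_trans (_ : n%:R * val t <= _).
    by have /andP[] : _ && _ := truncn_itv (mulr_ge0 (ler0n R n) t0).
  by rewrite ler_piMr.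
rewrite (_ : _ @^-1` _ = [set w | exists kN : nat * nat, forall n,
    (kN.2 <= n)%N -> V kN.1 (step n (coords n w))]).
  apply: measurable_exists => -[k N]; apply: measurable_forall => n /=.
  have [Nn|Nn] := leqP N n; last first.
    by rewrite (_ : [set w | _] = setT)//; apply/seteqP; split=> w //=; rewrite leqNgt Nn.
  rewrite (_ : [set w | _] = [set w | (step n @^-1` V k) (coords n w)]).
    apply: measurable_open_matrix; last by move/continuousP : (step_cont n); exact.
    by move=> i j; under eq_fun do rewrite mxE; exact: mZ.
  by apply/seteqP; split=> w //=; exact.
apply/seteqP; split=> w /=.
  move=> UZ; have /nbhs_skorokhod[e e0 eU] : nbhs (Z w) U by exact: open_nbhs_nbhs.
  have [|k ke] := @small_inv _ (e / 2); first by rewrite divr_gt0.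
  have k0 : 0 < k.+1%:R^-1 :> R by rewrite invr_gt0.
  have [N NP] := step_path_cvg (Z w) (divr_gt0 k0 (ltr0Sn _ 1)).
  exists (k, N) => n /NP h; rewrite coordsE; exists (Z w) => /=.
    move=> z; rewrite ballEmdist => Zz; apply: eU; apply: lt_trans Zz _.
    by move: ke; move: (k.+1%:R^-1 : R) => dl; lra.
  rewrite ballEmdist/= metric_sym; apply: le_lt_trans h _.
  by move: k0; move: (k.+1%:R^-1 : R) => dl; lra.
move=> [[k N] /= VZ].
have k0 : 0 < k.+1%:R^-1 :> R by rewrite invr_gt0.
have [N' NP] := step_path_cvg (Z w) (divr_gt0 k0 (ltr0Sn _ 1)).
have := VZ (maxn N N') (leq_maxl _ _); rewrite coordsE => -[x xU].
rewrite ballEmdist/= => xs; apply: xU; rewrite ballEmdist/=.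
apply: le_lt_trans (metric_triangle _ (step_path (maxn N N') (sample (Z w) (maxn N N'))) _) _.
have := NP _ (leq_maxr N N'); move: xs k0; rewrite /mdist/=.
by move: (k.+1%:R^-1 : R) => dl; clear; lra.
Qed.

End borel_paths.

Section coordinates.
Context {R : realType} {d : nat}.

(** Right-continuity recovers a coordinate at time [t] from the suprema over
[(t, t + 1/n)], which are lower semicontinuous for the Skorokhod metric. *)
Lemma measurable_coord (t : unitI R) (k : 'I_d) :
  measurable_fun setT (fun x : skorokhod R d => x t 0 k).
Proof.
(* At [t = 1] the right neighbourhood is replaced by [1] itself, which all time
   changes fix. *)
pose I n : set (unitI R) := [set s | val t < val s < val t + n.+1%:R^-1 \/
  (s = unitI1 /\ t = unitI1)].
have coordB (u v : 'rV[R]_d) : `|u 0 k - v 0 k| <= enorm (u - v).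
  by have := abs_le_enorm (u - v) k; rewrite !mxE.
have openI n (c : R) : open [set x : skorokhod R d | exists s, I n s /\ c < x s 0 k].
  rewrite openE => x [s [Is cx]]; apply/nbhs_skorokhod.
  have [dd dd0 ddI] : exists2 dd : R, 0 < dd & forall l, time_change l ->
      `|val s - val (l s)| <= dd -> I n (l s).
    case: Is => [/andP[ts st]|[s1 t1]]; last first.
      by exists 1 => // l lc _; right; rewrite s1 time_change1.
    exists (Num.min (val s - val t) (val t + n.+1%:R^-1 - val s) / 2).
      by rewrite divr_gt0// lt_min !subr_gt0 ts.
    move=> l _; rewrite ler_pdivlMr// le_min => /andP[sl1 sl2]; left.
    move: sl1 sl2 ts st; move: (n.+1%:R^-1 : R) => a.
    have := normr_ge0 (val s - val (l s)); have := ler_norm (val s - val (l s)).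
    have := ler_norm (val (l s) - val s); rewrite (distrC (val (l s))) /=.
    by move: `|sval s - sval (l s)| => b *; apply/andP; split; lra.
  have [en en0 enP] := time_change_near dd0.
  have gap : 0 < x s 0 k - c by rewrite subr_gt0.
  exists (Num.min en ((x s 0 k - c) / 2)); first by rewrite lt_min en0 divr_gt0.
  move=> z /J1_dist_lt[l lc [ls lz]]; exists (l s); split.
    apply: ddI => //; apply: enP => // u v uv.
    by apply: le_trans (ls _ _ uv) _; rewrite ge_min lexx.
  have := lz s; rewrite le_min => /andP[_]; have := coordB (x s) (z (l s)).
  by have := ler_norm (x s 0 k - z (l s) 0 k); lra.
have near_t (x : skorokhod R d) (e : R) : 0 < e -> exists n, forall s, I n s ->
    `|x s 0 k - x t 0 k| < e.
  move=> e0.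
  have h := cvg_enorm (FF := within_filter _ (nbhs_filter _)) (path_cadlag x t).1 e0.
  rewrite near_withinE in h; have [dl dl0 dlP] := iffLR (nbhs_unitIP t _) h.
  have [n ndl] := small_inv dl0.
  exists n => s [/andP[ts st]|[-> ->]]; last by rewrite subrr normr0.
  apply: le_lt_trans (coordB _ _) (dlP s _ (ltW ts)).
  rewrite distrC gtr0_norm ?subr_gt0// ltrBlDl; apply: lt_trans st _.
  by rewrite ltrD2l.
have I_nonempty n : exists s, I n s.
  have [tE|tn1] := eqVneq t unitI1; first by exists unitI1; right.
  have /andP[t0 t1] := unitIP t.
  have {}t1 : val t < 1.
    by rewrite lt_neqAle t1 andbT; apply: contra_neq tn1 => h; exact: val_inj.
  have n0 : 0 < n.+1%:R^-1 :> R by rewrite invr_gt0.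
  pose r := Num.min 1 (val t + n.+1%:R^-1 / 2).
  have tr : val t < r by rewrite lt_min t1 ltrDl divr_gt0.
  have r01 : 0 <= r <= 1 by rewrite ge_min lexx andbT ltW// (le_lt_trans t0).
  exists (mk_unitI r01); left; rewrite /= tr /r gt_min; apply/orP; right.
  by rewrite ltrD2l ltr_pdivrMr// ltr_pMr// ltr1n.
have I_sub n n' s : (n <= n')%N -> I n' s -> I n s.
  move=> nn' [/andP[ts st]|h]; [left|by right].
  rewrite ts (lt_le_trans st)// lerD2l lef_pV2 ?posrE// ler_nat ltnS.
  exact: nn'.
apply: (measurability _ (RGenInftyO.measurableE R)) => _ [_ [c ->] <-]; rewrite setTI.
rewrite [X in measurable X](_ : _ = [set x : skorokhod R d | exists nj : nat * nat,
    ~ (exists s, I nj.1 s /\ c - nj.2.+1%:R^-1 < x s 0 k)]).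
  apply: measurable_exists => -[n j].
  by apply: measurableC; apply: sub_sigma_algebra; exact: openI.
apply/seteqP; split=> x /=; rewrite in_itv /=.
  move=> xc; have gap : 0 < (c - x t 0 k) / 2 by rewrite divr_gt0// subr_gt0.
  have [n nP] := near_t x _ gap.
  have [j jgap] := small_inv gap.
  exists (n, j) => -[s [/nP + cs]] /=; move: jgap cs => /=.
  move: (j.+1%:R^-1 : R) => r; rewrite ltr_norml.
  by move=> ? ? /andP[? ?]; lra.
move=> [[n j] /= h]; have j0 : 0 < j.+1%:R^-1 :> R by rewrite invr_gt0.
have [n' n'P] := near_t x _ j0.
have [s Is] := I_nonempty (maxn n n').
have := n'P s (I_sub _ _ _ (leq_maxr n n') Is).
move=> st; rewrite ltNge; apply/negP => ct; apply: h; exists s; split.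
  exact: I_sub (leq_maxl n n') Is.
move: st ct; rewrite ltr_norml /=; move: (j.+1%:R^-1 : R) => a.
by move=> /andP[? ?] ?; lra.
Qed.

End coordinates.

(** * Polar coordinates *)

Lemma open_lipschitz (R : realType) (M : metricType R) (f : M -> R) (c : R) :
  (forall x y, `|f x - f y| <= mdist x y) -> open [set x | f x < c].
Proof.
move=> fL; rewrite openE => x /= xc; apply/nbhs_ballP.
exists (c - f x) => /=; first by rewrite subr_gt0.
move=> y; rewrite ballEmdist /= => xy; have := fL x y.
by rewrite ler_norml => /andP[h1 h2]; lra.
Qed.

Section polar.
Context {R : realType} {d : nat}.
Implicit Types (x y z : skorokhod R d.+1) (b : Dbar0 R d.+1) (B : set (Dbar0 R d.+1)).

(** Inverse of the polar coordinates; [fine] sends the radius [+oo] to 0, so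
the added points at infinity are collapsed to the zero path. *)
Definition unpolar b : skorokhod R d.+1 := path_scale (fine (radius b)) (angle b).

(** Total version of the polar coordinates; the zero path, which has none, is
sent to an arbitrary point. *)
Definition polarize x : Dbar0 R d.+1 :=
  if pselect (x <> path_cst 0) is left x0 then projT1 (cid (polar_coord_exists x0))
  else point.

Lemma polarizeP x : x <> path_cst 0 -> polar_coord x (polarize x).
Proof.
by move=> x0; rewrite /polarize; case: pselect => // x0'; case: cid.
Qed.

Lemma polar_coord_neq0 x b : polar_coord x b -> x <> path_cst 0.
Proof.
move=> [rb _] x0; have := radius_gt0 b.
by rewrite rb x0 supnorm_path_cst enorm0 ltxx.
Qed.

Lemma in_DE B x : in_D B x <-> x <> path_cst 0 /\ B (polarize x).
Proof.
split=> [[b Bb xb]|[x0 Bx]]; last by exists (polarize x) => //; exact: polarizeP.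
have x0 := polar_coord_neq0 xb; split=> //.
by rewrite (polar_coord_unique (polarizeP x0) xb).
Qed.

Lemma unpolarK x b : polar_coord x b -> unpolar b = x.
Proof.
move=> xb; have := xb => -[rb ab]; apply: skorokhod_eq => t.
have x0 : 0 < supnorm x by apply: supnorm_gt0; exact: polar_coord_neq0 xb.
by rewrite /unpolar rb ab /= scalerA divff ?scale1r// gt_eqF.
Qed.

Lemma supnorm_unpolar b : supnorm (unpolar b) = fine (radius b).
Proof.
rewrite supnormZ angle_norm mulr1 ger0_norm// fine_ge0//.
exact/ltW/radius_gt0.
Qed.

Lemma polar_coord_unpolar b : unpolar b <> path_cst 0 -> polar_coord (unpolar b) b.
Proof.
move=> /supnorm_gt0 b0; split.
  move: b0; rewrite supnorm_unpolar; have := radius_gt0 b.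
  by case: (radius b) => //= _; rewrite ltxx.
rewrite supnorm_unpolar; rewrite supnorm_unpolar in b0.
by apply: skorokhod_eq => t; rewrite /= scalerA mulVf ?scale1r// gt_eqF.
Qed.

Lemma in_Dbar0E (A : set (skorokhod R d.+1)) :
  in_Dbar0 A = [set b | A (unpolar b) /\ unpolar b <> path_cst 0].
Proof.
apply/seteqP; split=> [b [x Ax xb]|b [Ab b0]].
  by rewrite /= (unpolarK xb); split=> //; exact: polar_coord_neq0 xb.
by exists (unpolar b) => //; exact: polar_coord_unpolar.
Qed.

Lemma path_mul0 y : path_mul y (path_cst 0) = path_cst 0.
Proof. by apply: skorokhod_eq => t; apply/rowP => i; rewrite !mxE mulr0. Qed.

Lemma in_Dbar0_mul y B :
  in_Dbar0 (path_mul y @^-1` in_D B) = [set b | in_D B (path_mul y (unpolar b))].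
Proof.
rewrite in_Dbar0E; apply/seteqP; split=> b /= => [[]//|Bb]; split=> // b0.
by move: Bb; rewrite b0 path_mul0 => /in_DE[].
Qed.

Lemma tame_jumps0 y : tame_jumps y (path_cst 0).
Proof.
move=> e eta e0 eta0; exists 1 => // p q _ _ _; left.
rewrite (_ : _ - _ = 0) ?enorm0 ?ltW//.
by apply/rowP => i; rewrite !mxE !mulr0 subrr.
Qed.

(** The discontinuity set in terms of values of the two paths, which makes it
measurable jointly in both. *)
Lemma in_Dbar0_Disc y : in_Dbar0 (Disc y) = [set b | ~ tame_jumps y (unpolar b)].
Proof.
rewrite in_Dbar0E; apply/seteqP; split=> b /=.
  by move=> [disc _] tame; apply: disc; exact: tame_continuous.
move=> ntame; split; first by move=> /continuous_tame.
by move=> b0; apply: ntame; rewrite b0; exact: tame_jumps0.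
Qed.

Lemma supnorm_le_J1 x z : supnorm x <= supnorm z + J1_dist x z.
Proof.
apply/ler_addgt0Pr => e e0; have : J1_dist x z < J1_dist x z + e by rewrite ltrDl.
move=> /J1_dist_lt[l lc [_ lz]]; apply: supnorm_le => t.
rewrite -[x t](subrK (z (l t))); apply: le_trans (enormD _ _) _.
by have := lz t; have := enorm_le_supnorm z (l t); lra.
Qed.

Lemma supnorm_lipschitz x z : `|supnorm x - supnorm z| <= J1_dist x z.
Proof.
have := supnorm_le_J1 x z; have := supnorm_le_J1 z x; rewrite [J1_dist z x]J1_sym.
by rewrite ler_norml => h1 h2; apply/andP; split; lra.
Qed.

(** A small time change for [x] and [z] serves for their normalisations too,
the norms being close to each other. *)
Lemma normalize_dist x z (e : R) : 0 < supnorm x -> 0 < supnorm z -> J1_dist x z < e ->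
  J1_dist (path_scale (supnorm x)^-1 x) (path_scale (supnorm z)^-1 z) <=
  Num.max e (2 * e / supnorm x).
Proof.
move=> x0 z0 xz; have [l lc [ls lz]] := J1_dist_lt xz.
apply: (J1_dist_le lc); split=> [s t st|t]; first by rewrite le_max ls.
rewrite le_max; apply/orP; right => /=.
rewrite (_ : _ - _ = (supnorm x)^-1 *: (x t - z (l t)) +
    ((supnorm z - supnorm x) / (supnorm x * supnorm z)) *: z (l t)); last first.
  rewrite (_ : (supnorm z - supnorm x) / (supnorm x * supnorm z) =
      (supnorm x)^-1 - (supnorm z)^-1); last by field; rewrite !gt_eqF.
  by rewrite scalerBr scalerBl addrA subrK.
apply: le_trans (enormD _ _) _; rewrite !enormZ.
rewrite (_ : 2 * e / supnorm x = (supnorm x)^-1 * e + (supnorm x)^-1 * e); last by field; rewrite gt_eqF.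
have xi0 : 0 < (supnorm x)^-1 by rewrite invr_gt0.
apply: lerD; first by rewrite gtr0_norm// ler_wpM2l// ltW.
rewrite normrM [X in _ * X * _](gtr0_norm _) ?invr_gt0 ?mulr_gt0// invfM.
have -> : `|supnorm z - supnorm x| * ((supnorm x)^-1 * (supnorm z)^-1) * enorm (z (l t)) =
  (supnorm x)^-1 * (`|supnorm z - supnorm x| * ((supnorm z)^-1 * enorm (z (l t)))).
  by ring.
rewrite ler_wpM2l ?(ltW xi0)//; apply: (@le_trans _ _ (`|supnorm z - supnorm x| * 1)).
  by rewrite ler_wpM2l// ler_pdivrMl// mulr1 enorm_le_supnorm.
by rewrite mulr1 distrC (le_trans (supnorm_lipschitz _ _))// ltW.
Qed.

Lemma fine_inv_radius b : fine (radius b)^-1%E = (fine (radius b))^-1.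
Proof.
have := radius_gt0 b; case: (radius b) => [r| |] //=; last by rewrite invr0.
by rewrite lte_fin /inve => r0; rewrite gt_eqF.
Qed.

Lemma open_in_D (U : set (Dbar0 R d.+1)) : open U -> open (in_D U).
Proof.
move=> oU; rewrite openE => x /in_DE[x0 Ux]; apply/nbhs_skorokhod.
have /nbhs_ballP[e e0 eU] : nbhs (polarize x) U by exact: open_nbhs_nbhs.
have sx0 := supnorm_gt0 x0; set n := supnorm x in sx0.
pose dl := Num.min (n / 2) (Num.min (e / 2) (Num.min (e * n / 4) (e * n ^+ 2 / 4))).
have dl0 : 0 < dl by rewrite !lt_min !divr_gt0// mulr_gt0// exprn_gt0.
have [dln dle dlen dlenn] : [/\ dl <= n / 2, dl <= e / 2, dl <= e * n / 4
    & dl <= e * n ^+ 2 / 4].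
  by rewrite /dl !ge_min !lexx !orbT.
exists dl => // z xz; have := supnorm_lipschitz x z; rewrite -/n => nz.
have {nz}nz : `|n - supnorm z| < dl by apply: le_lt_trans xz.
have sz : n / 2 < supnorm z.
  by move: nz; rewrite ltr_norml => /andP[h1 h2]; lra.
have sz0 : 0 < supnorm z by apply: lt_trans sz; rewrite divr_gt0.
have z0 : z <> path_cst 0 by move=> z0; rewrite z0 supnorm_path_cst enorm0 ltxx in sz0.
apply/in_DE; split=> //; apply: eU; rewrite ballEmdist/= /mdist/= /polar_dist.
have [rx ax] := polarizeP x0; have [rz az] := polarizeP z0.
rewrite !fine_inv_radius rx rz ax az /= -/n gt_max; apply/andP; split.
  rewrite (_ : n^-1 - (supnorm z)^-1 = (supnorm z - n) / (n * supnorm z)); last first.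
    by field; rewrite !gt_eqF.
  rewrite normrM distrC gtr0_norm ?invr_gt0 ?mulr_gt0// ltr_pdivrMr ?mulr_gt0//.
  apply: lt_le_trans nz _; apply: le_trans dlenn _.
  rewrite [e * _ / 4](_ : _ = e * (n * (n / 4))); last by rewrite expr2; ring.
  by rewrite ler_pM2l// ler_pM2l//; lra.
apply: le_lt_trans (normalize_dist sx0 sz0 xz) _; rewrite -/n gt_max.
apply/andP; split; first by lra.
rewrite ltr_pdivrMr//; apply: (@le_lt_trans _ _ (2 * (e * n / 4))); first by lra.
have : 0 < e * n by rewrite mulr_gt0.
lra.
Qed.

Lemma measurable_polarize : measurable_fun setT polarize.
Proof.
apply: (@measurability _ _ _ _ _ _ (@open (Dbar0 R d.+1))) => // _ [U oU <-].
rewrite setTI.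
have m0 : measurable [set path_cst 0 : skorokhod R d.+1].
  rewrite -[X in measurable X]setCK; apply: measurableC.
  apply: sub_sigma_algebra; rewrite openE => x x0; apply/nbhs_skorokhod.
  have /supnorm_gt0 sx0 : x <> path_cst 0 by exact: x0.
  exists (supnorm x) => // z xz z0; have := supnorm_lipschitz x z.
  by rewrite {1}z0 supnorm_path_cst enorm0 subr0 gtr0_norm// leNgt xz.
have -> : polarize @^-1` U = in_D U `|`
    ([set x | U point /\ [set path_cst 0 : skorokhod R d.+1] x]).
  apply/seteqP; split=> x /=.
    have [->|x0] := pselect (x = path_cst 0); last by left; apply/in_DE.
    by rewrite {1}/polarize; case: pselect => // _; right.
  move=> [/in_DE[]//|[Up ->]].
  by rewrite /polarize; case: pselect.
apply: measurableU; first by apply: sub_sigma_algebra; exact: open_in_D.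
exact: measurable_cst_and.
Qed.

(** The metric of the polar space makes the inverse radius, rather than the
radius, Lipschitz. *)
Lemma measurable_radius : measurable_fun setT (fun b : Dbar0 R d.+1 => fine (radius b)).
Proof.
have -> : (fun b : Dbar0 R d.+1 => fine (radius b)) =
    (fun r : R => r `^ (-1)) \o (fun b : Dbar0 R d.+1 => fine (radius b)^-1%E).
  apply/funext => b /=; rewrite fine_inv_radius powR_inv1 ?invrK// invr_ge0 fine_ge0//.
  exact/ltW/radius_gt0.
apply: measurableT_comp; first exact: measurable_powR.
apply: (measurability _ (RGenInftyO.measurableE R)) => _ [_ [c ->] <-]; rewrite setTI.
apply: sub_sigma_algebra; rewrite (_ : _ @^-1` _ = [set b | fine (radius b)^-1%E < c]).
  apply: open_lipschitz => b b'; by rewrite /mdist /= /polar_dist le_max lexx.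
by apply/seteqP; split=> b /=; rewrite in_itv.
Qed.

Lemma measurable_angle : measurable_fun setT (@angle R d.+1).
Proof.
apply: (@measurability _ _ _ _ _ _ (@open (skorokhod R d.+1))) => // _ [U oU <-].
rewrite setTI; apply: sub_sigma_algebra.
suff : open (@angle R d.+1 @^-1` U) by [].
rewrite openE => b Ub; apply/nbhs_ballP.
have /nbhs_ballP[e e0 eU] : nbhs (angle b) U by exact: open_nbhs_nbhs.
exists e => // c; rewrite ballEmdist/= => bc; apply: eU; rewrite ballEmdist/=.
by apply: le_lt_trans bc; rewrite [leRHS]/mdist/= /polar_dist le_max lexx orbT.
Qed.

Lemma measurable_unpolar : measurable_fun setT unpolar.
Proof.
apply: measurable_process => t k; under eq_fun do rewrite mxE.
apply: measurable_funM; first exact: measurable_radius.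
exact: (measurableT_comp (measurable_coord t k) measurable_angle).
Qed.

Lemma measurable_supnorm : measurable_fun setT (@supnorm R d.+1).
Proof.
apply: (measurability _ (RGenInftyO.measurableE R)) => _ [_ [c ->] <-]; rewrite setTI.
apply: sub_sigma_algebra; rewrite (_ : _ @^-1` _ = [set x | supnorm x < c]).
  by apply: open_lipschitz => x z; exact: supnorm_lipschitz.
by apply/seteqP; split=> b /=; rewrite in_itv.
Qed.

Section processes.
Context {disp : measure_display} {T : measurableType disp}.
Implicit Types (Z Y : T -> skorokhod R d.+1).

Lemma measurable_neq0 Z : measurable_fun setT Z -> measurable [set w | Z w <> path_cst 0].
Proof.
move=> mZ; rewrite (_ : [set w | _] = [set w | 0 < supnorm (Z w)]).
  apply: measurable_ltr => //.
  exact: (measurableT_comp measurable_supnorm mZ).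
apply/seteqP; split=> w /=; first exact: supnorm_gt0.
by move=> Z0 h; rewrite h supnorm_path_cst enorm0 ltxx in Z0.
Qed.

Lemma measurable_in_D Z B : measurable_fun setT Z -> measurable B ->
  measurable [set w | in_D B (Z w)].
Proof.
move=> mZ mB; rewrite (_ : [set w | _] =
    [set w | Z w <> path_cst 0] `&` (polarize \o Z) @^-1` B).
  apply: measurableI; first exact: measurable_neq0.
  rewrite -[X in measurable X]setTI.
  by apply: (measurableT_comp measurable_polarize mZ) => //.
by apply/seteqP; split=> w /in_DE.
Qed.

(** The image of [mu] under a process, as a measure on the extended polar
space: mass sent to the zero path is discarded. *)
Lemma process_image_measure (mu : {measure set T -> \bar R}) Z :
  measurable_fun setT Z -> exists nu : {measure set (Dbar0 R d.+1) -> \bar R},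
    forall B, measurable B -> nu B = mu [set w | in_D B (Z w)].
Proof.
move=> mZ; pose mN := measurable_neq0 mZ.
have mf : measurable_fun setT (polarize \o Z) := measurableT_comp measurable_polarize mZ.
exists (measure_function_pushforward__canonical__measure_function_Measure (mrestr mu mN) mf).
move=> B mB; rewrite /= /pushforward /mrestr; congr (mu _).
by apply/seteqP; split=> w /=; rewrite in_DE => -[].
Qed.

Lemma measurable_path_mul Y Z : measurable_fun setT Y -> measurable_fun setT Z ->
  measurable_fun setT (fun w => path_mul (Y w) (Z w)).
Proof.
move=> mY mZ; apply: measurable_process => t k; under eq_fun do rewrite mxE.
apply: measurable_funM.
  exact: (measurableT_comp (measurable_coord t k) mY).
exact: (measurableT_comp (measurable_coord t k) mZ).
Qed.

Lemma measurable_path_scale (c : R) Z : measurable_fun setT Z ->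
  measurable_fun setT (fun w => path_scale c (Z w)).
Proof.
move=> mZ; apply: measurable_process => t k; under eq_fun do rewrite mxE.
apply: measurable_funM => //.
exact: (measurableT_comp (measurable_coord t k) mZ).
Qed.

End processes.

End polar.

(** * Measurability of the discontinuity set *)

Section measurable_tameness.
Context {R : realType} {d : nat}.
Implicit Types (x y : skorokhod R d) (t p q : unitI R).

Lemma right_rational x y t (r s : R) : val t < 1 -> 0 < r -> 0 < s ->
  exists p : rat, [/\ val t < val (clip (ratr p)) < val t + r,
    enorm (x (clip (ratr p)) - x t) < s & enorm (y (clip (ratr p)) - y t) < s].
Proof.
move=> t1 r0 s0.
have hx := cvg_enorm (FF := within_filter _ (nbhs_filter _)) (path_cadlag x t).1 s0.
have hy := cvg_enorm (FF := within_filter _ (nbhs_filter _)) (path_cadlag y t).1 s0.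
rewrite !near_withinE in hx hy.
have [dx dx0 dxP] := iffLR (nbhs_unitIP t _) hx.
have [dy dy0 dyP] := iffLR (nbhs_unitIP t _) hy.
pose u := Num.min (Num.min 1 (val t + r)) (Num.min (val t + dx) (val t + dy)).
have /rat_in_itvoo[p] : val t < u by rewrite !lt_min t1 !ltrDl r0 dx0.
rewrite in_itv/= /u !lt_min => /andP[tp /andP[/andP[p1 pr] /andP[px py]]].
have /andP[t0 _] := unitIP t.
exists p; set P := clip (ratr p).
have pE : val P = ratr p by apply: clipE; rewrite (ltW p1) (le_trans t0 (ltW tp)).
have tP : val t < val P < val t + r by rewrite pE tp.
have tPd : `|val t - val P| = val P - val t by rewrite distrC gtr0_norm ?subr_gt0 ?pE.
have /andP[/ltW tlP _] := tP.
split=> //; first by apply: dxP => //; rewrite tPd pE ltrBlDl.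
by apply: dyP => //; rewrite tPd pE ltrBlDl.
Qed.

(** By right-continuity rational times suffice, so that tameness is expressed by
countably many operations on coordinates. *)
Lemma tame_jumps_rational y x : tame_jumps y x <->
  forall ji : nat * nat, exists k : nat, forall pq : rat * rat,
    val (clip (ratr pq.1) : unitI R) < 1 - ji.2.+1%:R^-1 /\
    val (clip (ratr pq.2) : unitI R) < 1 - ji.2.+1%:R^-1 /\
    `|val (clip (ratr pq.1) : unitI R) - val (clip (ratr pq.2) : unitI R)| < k.+1%:R^-1 ->
    let p := clip (ratr pq.1) in let q := clip (ratr pq.2) in
    enorm (mulv (y q) (x p) - mulv (y p) (x p)) <= ji.1.+1%:R^-1 \/
    enorm (mulv (y q) (x p) - mulv (y q) (x q)) <= ji.1.+1%:R^-1.
Proof.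
split=> [tame [j i] /=|tame e eta e0 eta0].
  have [||dl dl0 dlP] := tame (j.+1%:R^-1) (i.+1%:R^-1); [by rewrite invr_gt0..|].
  have [k kdl] := small_inv dl0; exists k => -[p q] /= [pi [qi pq]].
  by apply: dlP => //; exact: lt_trans kdl.
have [j je] := small_inv (divr_gt0 e0 (ltr0Sn _ 1)).
have [i ieta] := small_inv eta0.
have [k] := tame (j, i); rewrite /=.
have k0 : 0 < k.+1%:R^-1 :> R by rewrite invr_gt0.
move: k0 je ieta; move: (k.+1%:R^-1 : R) (j.+1%:R^-1 : R) (i.+1%:R^-1 : R).
move=> dl ej ei dl0 eje eieta tameP.
exists dl => // p q p1 q1 pq.
pose K := supnorm x + supnorm y.
have K0 : 0 <= K by rewrite addr_ge0 ?supnorm_ge0.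
pose s := e / 4 / (K + 1).
have s0 : 0 < s by rewrite !divr_gt0// ltr_wpDl.
have sK : s * K <= e / 4.
  by rewrite /s mulrAC ler_pdivrMr ?ltr_wpDl// ler_wpM2l ?lerDl// ltW// divr_gt0.
pose r := Num.min (dl - `|val p - val q|) (eta - ei).
have r0 : 0 < r by rewrite lt_min !subr_gt0 pq.
have [rdl reta] : r <= dl - `|val p - val q| /\ r <= eta - ei.
  by rewrite /r !ge_min !lexx orbT.
have pl1 : val p < 1 by rewrite /= in p1 *; lra.
have ql1 : val q < 1 by rewrite /= in q1 *; lra.
have [p' [/andP[pp1 pp2] xp yp]] := right_rational x y pl1 r0 s0.
have [q' [/andP[qq1 qq2] xq yq]] := right_rational x y ql1 r0 s0.
set P := clip (ratr p') in pp1 pp2 xp yp; set Q := clip (ratr q') in qq1 qq2 xq yq.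
have move_ u v u' v' : enorm (y u' - y u) < s -> enorm (x v' - x v) < s ->
    enorm (mulv (y u') (x v') - mulv (y u) (x v)) <= e / 4.
  move=> /ltW uu /ltW vv; apply: le_trans sK; apply: le_trans (mulv_dist _ _ _ _) _.
  rewrite /K mulrDr; apply: lerD; last rewrite mulrC;
    by apply: ler_pM; rewrite ?enorm_ge0 ?enorm_le_supnorm.
have PQ : `|val P - val Q| < dl.
  have := ler_norm (val p - val q); have := ler_norm (val q - val p).
  rewrite (distrC (val q)) ltr_norml /= in pp1 pp2 qq1 qq2 rdl *.
  move: `|sval p - sval q| rdl => b rdl b1 b2.
  by clear -pp1 pp2 qq1 qq2 rdl b1 b2; apply/andP; split; lra.
have [|h|h] := tameP (p', q').
- rewrite -/P -/Q; clear -p1 q1 pp2 qq2 reta PQ.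
  by split; [|split=> //]; rewrite /= in p1 q1 pp2 qq2 *; lra.
- left; rewrite /= -/P -/Q in h.
  have h1 := move_ _ _ _ _ yq xp; have h2 := move_ _ _ _ _ yp xp.
  rewrite enorm_distC in h1.
  have := enorm_dist (mulv (y q) (x p)) (mulv (y Q) (x P)) (mulv (y p) (x p)).
  have := enorm_dist (mulv (y Q) (x P)) (mulv (y P) (x P)) (mulv (y p) (x p)).
  by clear -h h1 h2 eje; lra.
- right; rewrite /= -/P -/Q in h.
  have h1 := move_ _ _ _ _ yq xp; have h2 := move_ _ _ _ _ yq xq.
  rewrite enorm_distC in h1.
  have := enorm_dist (mulv (y q) (x p)) (mulv (y Q) (x P)) (mulv (y q) (x q)).
  have := enorm_dist (mulv (y Q) (x P)) (mulv (y Q) (x Q)) (mulv (y q) (x q)).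
  by clear -h h1 h2 eje; lra.
Qed.

Context {disp : measure_display} {T : measurableType disp}.

Lemma measurable_enorm_le (v : T -> 'rV[R]_d) (e : R) : 0 <= e ->
  (forall k, measurable_fun setT (fun w => v w 0 k)) -> measurable [set w | enorm (v w) <= e].
Proof.
move=> e0 mv.
rewrite (_ : [set w | _] = [set w | \sum_i v w 0 i ^+ 2 <= e ^+ 2]).
  apply: measurable_ler => //; apply: measurable_sum => i.
  exact: measurable_funX.
apply/seteqP; split=> w /=; rewrite -enorm_sq ler_pXn2r ?nnegrE ?enorm_ge0//.
Qed.

Lemma measurable_tame_jumps (Y Z : T -> skorokhod R d) :
  (forall t k, measurable_fun setT (fun w => Y w t 0 k)) ->
  (forall t k, measurable_fun setT (fun w => Z w t 0 k)) ->
  measurable [set w | tame_jumps (Y w) (Z w)].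
Proof.
move=> mY mZ.
under eq_set do rewrite (propext (tame_jumps_rational _ _)).
apply: measurable_forall => -[j i]; apply: measurable_exists => k.
apply: measurable_forall => -[p q] /=.
have mM a b c e : forall k, measurable_fun setT
    (fun w => (mulv (Y w a) (Z w b) - mulv (Y w c) (Z w e)) 0 k).
  move=> l; under eq_fun do rewrite !mxE.
  by apply: measurable_funB; apply: measurable_funM.
have imp (Q : Prop) (A : set T) : measurable A -> measurable [set w | Q -> A w].
  move=> mA; have [HQ|HQ] := pselect Q.
    by rewrite (_ : [set w | _] = A)//; apply/seteqP; split=> w //=; exact.
  by rewrite (_ : [set w | _] = setT)//; apply/seteqP; split=> w //= _ /HQ.
apply: imp.
by apply: measurableU; apply: measurable_enorm_le => //; rewrite invr_ge0.
Qed.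

End measurable_tameness.

(** * Independence *)

Section independence.
Context {R : realType} {d : nat} {disp : measure_display} {T : measurableType disp}.
Variable P : probability T R.
Implicit Types X Y : T -> skorokhod R d.+1.

Definition coordinate_events X : set (set T) :=
  [set E | exists (t : unitI R) (k : 'I_d.+1) (A : set R),
    measurable A /\ E = (fun w => X w t 0 k) @^-1` A].

Lemma coordinate_events_measurable X : stochastic_process X ->
  <<s coordinate_events X >> `<=` @measurable _ T.
Proof.
move=> sX; apply: smallest_sub; first exact: sigma_algebra_measurable.
move=> _ [t [k [A [mA ->]]]]; rewrite -[X in measurable X]setTI.
exact: sX.
Qed.

(** Stated on arbitrary measurable spaces, because it is used for the product of
two sub-sigma-algebras. *)
Definition jointly_measurable (A : skorokhod R d.+1 -> skorokhod R d.+1 -> Prop) :=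
  forall (disp' : measure_display) (T' : measurableType disp')
    (Y X : T' -> skorokhod R d.+1),
    (forall t k, measurable_fun setT (fun w => Y w t 0 k)) ->
    (forall t k, measurable_fun setT (fun w => X w t 0 k)) ->
    measurable [set w | A (Y w) (X w)].

(** On the sub-sigma-algebras generated by the two processes, independence says
that the diagonal map sends [P] to the product of the two restrictions of [P]. *)
Lemma independent_fubini X Y A : stochastic_process X -> stochastic_process Y ->
  independent_processes P X Y -> jointly_measurable A ->
  measurable_fun setT (fun w => P [set w' | A (Y w) (X w')]) /\
  P [set w | A (Y w) (X w)] = (\int[P]_w P [set w' | A (Y w) (X w')])%E.
Proof.
move=> sX sY indep mA.
pose TX := g_sigma_algebraType (coordinate_events X).
pose TY := g_sigma_algebraType (coordinate_events Y).
have mX : measurable_fun setT (id : T -> TX).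
  by move=> _ B mB; rewrite setTI; exact: (coordinate_events_measurable sX mB).
have mY : measurable_fun setT (id : T -> TY).
  by move=> _ B mB; rewrite setTI; exact: (coordinate_events_measurable sY mB).
have mD : measurable_fun setT (fun w : T => (w : TY, w : TX)).
  exact: measurable_fun_pair.
pose idX := mfun_Sub (mem_set mX); pose idY := mfun_Sub (mem_set mY).
pose diag := mfun_Sub (mem_set mD).
have mcX t k : measurable_fun setT (fun w : TX => X w t 0 k).
  move=> _ B mB; rewrite setTI; apply: sub_sigma_algebra.
  by exists t, k, B.
have mcY t k : measurable_fun setT (fun w : TY => Y w t 0 k).
  move=> _ B mB; rewrite setTI; apply: sub_sigma_algebra.
  by exists t, k, B.
pose S := [set w : TY * TX | A (Y w.1) (X w.2)].
have mS : measurable S.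
  apply: mA => t k; first exact: (measurableT_comp (mcY t k) measurable_fst).
  exact: (measurableT_comp (mcX t k) measurable_snd).
have SE (w : T) : xsection S w = [set w' | A (Y w) (X w')].
  by rewrite xsectionE.
have mf := measurable_fun_xsection (distribution P idX) mS.
have mfP : measurable_fun setT (fun w => P [set w' | A (Y w) (X w')]).
  have := measurableT_comp mf mY.
  suff -> : (distribution P idX \o xsection S) \o (id : T -> TY) =
    (fun w => P [set w' | A (Y w) (X w')]) by [].
  by apply/funext => w /=; rewrite SE.
split=> //.
rewrite -[LHS]/(distribution P diag S).
rewrite -(@product_measure_unique _ _ _ _ _ (distribution P idY) (distribution P idX)
  (distribution P diag) _ S mS); last first.
  move=> B C mB mC; rewrite -[LHS]/(P (B `&` C)) setIC (indep C B mC mB).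
  by rewrite muleC.
rewrite /product_measure1 ge0_integral_distribution//.
by apply: eq_integral => w _ /=; rewrite SE.
Qed.

End independence.

(** * A Potter bound *)

Section potter.
Context {R : realType}.
Variables (G : R -> R) (a : nat -> R) (c alpha rho : R).

Lemma cvg_eventually (u : nat -> R) (l e : R) : u n @[n --> \oo] --> l -> 0 < e ->
  exists N, forall n, (N <= n)%N -> `|u n - l| < e.
Proof.
move=> /cvgrPdist_lt ul e0; have [N _ NP] := ul e e0.
by exists N => n Nn; rewrite distrC; exact: NP.
Qed.

Hypothesis G01 : forall x, 0 <= G x <= 1.
Hypothesis Gmono : forall x y, x <= y -> G y <= G x.
Hypothesis a0 : forall n, 0 < a n.
Hypothesis amono : nondecreasing_seq a.
Hypothesis ainfty : a n @[n --> \oo] --> +oo.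
Hypothesis c0 : 0 < c.
Hypothesis alpha0 : 0 < alpha.
Hypothesis alpha_rho : alpha < rho.
Hypothesis tailG : forall u, 0 < u -> n%:R * G (a n * u) @[n --> \oo] --> c * u `^ (- alpha).

Lemma tail_pos x : 0 < G x.
Proof.
have [N NP] := cvg_eventually (tailG ltr01) c0.
move/cvgryPge : ainfty => /(_ x)[N' _ N'P].
pose n := (maxn N N').
have := NP n (leq_maxl _ _); have := N'P n (leq_maxr _ _) => /= xa.
rewrite powR1 !mulr1 ltr_norml => /andP[h _].
have {}h : 0 < n%:R * G (a n) by rewrite -(ltrD2r (- c)) add0r.
have {}h : 0 < G (a n).
  rewrite lt_neqAle (andP (G01 _)).1 andbT eq_sym; apply/eqP => G0.
  by rewrite G0 mulr0 ltxx in h.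
exact: lt_le_trans (Gmono xa).
Qed.

Lemma two_alpha_lt : (2 : R) `^ alpha < 2 `^ rho.
Proof. by rewrite /powR pnatr_eq0 /= ltr_expR ltr_pM2r ?ln_gt0 ?ltr1n. Qed.

(** Comparing [x] with the neighbouring normalising constants, halving [x]
multiplies the tail by about [2 `^ alpha], which is less than [2 `^ rho]. *)
Lemma tail_halving : exists2 x0, 0 < x0 & forall x, x0 <= x -> G (x / 2) <= 2 `^ rho * G x.
Proof.
have c0' := c0; have ta := two_alpha_lt.
(* In the limit [n * G (a n / 2)] and [2 `^ rho * n.+1 * G (a n.+1)] differ by
   [2 * eta]; the errors of the estimates below add up to less. *)
pose eta := c * (2 `^ rho - 2 `^ alpha) / 2.
have eta0 : 0 < eta by rewrite divr_gt0// mulr_gt0// subr_gt0.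
have [N1 N1P] := cvg_eventually (tailG ltr01) (divr_gt0 eta0 (powR_gt0 (rho + 2) (ltr0Sn R 1))).
have h20 : 0 < 2^-1 :> R by rewrite invr_gt0.
have [N2 N2P] := cvg_eventually (tailG h20) (divr_gt0 eta0 (ltr0Sn R 1)).
have half_alpha : 2^-1 `^ (- alpha) = (2 : R) `^ alpha.
  by rewrite -(powR_inv1 (ler0n R 2)) -powRrM mulN1r opprK.
rewrite half_alpha in N2P.
have rhoE : (2 : R) `^ (rho + 2) = 4 * 2 `^ rho.
  rewrite powRD ?pnatr_eq0 ?implybT// mulrC (powR_mulrn 2)//; congr (_ * _); ring.
rewrite rhoE in N1P.
have r0 : 0 < (2 : R) `^ rho by rewrite powR_gt0.
pose M := c * 2 `^ alpha + eta / 2.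
have M0 : 0 < M.
  by apply: addr_gt0; [apply: mulr_gt0 => //; exact: powR_gt0|apply: divr_gt0].
have [N3 N3P] : exists N3 : nat, M / (eta / 4) < N3%:R.
  by exists (Num.truncn (M / (eta / 4))).+1; exact: truncnS_gt.
pose N := maxn N1 (maxn N2 N3).+1.
have step n : (N <= n)%N -> G (a n / 2) <= 2 `^ rho * G (a n.+1).
  rewrite geq_max gtn_max => /andP[n1 /andP[n2 n3]].
  have := N1P n.+1 (leq_trans n1 (leqnSn _)); rewrite powR1 !mulr1.
  have := N2P n (ltnW n2).
  have N3n : (N3%:R : R) <= n%:R by rewrite ler_nat ltnW.
  have np : 0 < n%:R :> R by rewrite ltr0n (leq_trans _ n3).
  rewrite !ltr_norml => /andP[_ h2] /andP[h1 _].
  have Gn : G (a n / 2) < eta / 4.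
    rewrite -(ltr_pM2l np); apply: (@lt_trans _ _ M); first by rewrite /M; lra.
    by rewrite -(ltr_pdivrMr _ _ (divr_gt0 eta0 (ltr0Sn R 3))); exact: lt_le_trans N3P N3n.
  have {}h1 : (c - eta / (4 * 2 `^ rho)) * 2 `^ rho < n.+1%:R * G (a n.+1) * 2 `^ rho.
    by rewrite ltr_pM2r//; lra.
  have e4 : eta / (4 * 2 `^ rho) * 2 `^ rho = eta / 4 by field; rewrite gt_eqF.
  rewrite mulrBl e4 in h1.
  rewrite -(ler_pM2l (ltr0Sn R n)) [leRHS]mulrCA.
  have : n.+1%:R * G (a n / 2) = n%:R * G (a n / 2) + G (a n / 2) by rewrite -natr1 mulrDl mul1r.
  rewrite /eta in h1 h2 Gn eta0 *; move: h1 h2.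
  move: (n.+1%:R * G (a n / 2)) (n.+1%:R * G (a n.+1)) (n%:R * G (a n / 2)) => A B C.
  lra.
exists (a N); first exact: a0.
move=> x Nx; have ex : exists k, x < a k.
  move/cvgryPgt : ainfty => /(_ x)[k _ kP]; exists k; exact: kP (leqnn k).
case: (ex_minnP ex) => k xk kmin.
have Nk : (N < k)%N.
  rewrite ltnNge; apply/negP => kN.
  by have := lt_le_trans xk (amono kN); rewrite ltNge Nx.
case: k xk kmin Nk => // n xn nmin Nn.
have anx : a n <= x.
  by rewrite leNgt; apply/negP => /nmin; rewrite ltnn.
apply: le_trans (_ : G (a n / 2) <= _); first by apply: Gmono; rewrite ler_pM2r.
apply: le_trans (step n Nn) _; rewrite ler_pM2l//; apply: Gmono; exact: ltW.
Qed.

Lemma two_pow_ge1 : 1 <= (2 : R) `^ rho.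
Proof.
by rewrite -[leLHS](powRr0 2) ler_powR ?ler1n// ltW// (lt_trans alpha0 alpha_rho).
Qed.

(** Capping the tail at its value at [x0] makes the halving inequality hold for
all [x], so that it can be iterated. *)
Lemma potter_dyadic : exists K N, 0 < K /\ forall n k, (N <= n)%N ->
  n%:R * G (a n * 2^-1 ^+ k) <= K * (2 `^ rho) ^+ k.
Proof.
have c0' := c0; have r1 := two_pow_ge1.
have r0 : 0 < (2 : R) `^ rho by apply: lt_le_trans r1.
have [x0 x00 halving] := tail_halving.
pose F x := Num.min (G x) (G x0).
have FG x : F x <= G x by rewrite ge_min lexx.
have Fhalf x : 0 < x -> F (x / 2) <= 2 `^ rho * F x.
  move=> xp; have [xx0|xx0] := leP x0 x.
    rewrite [F x]min_l ?Gmono//; exact: le_trans (FG _) (halving x xx0).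
  rewrite [F x]min_r; last exact/Gmono/ltW.
  apply: (@le_trans _ _ (G x0)); first by rewrite ge_min lexx orbT.
  by rewrite ler_peMl// ltW// tail_pos.
have Fiter x k : 0 < x -> F (x * 2^-1 ^+ k) <= (2 `^ rho) ^+ k * F x.
  move=> xp; elim: k => [|k IH]; first by rewrite !expr0 mulr1 mul1r.
  rewrite exprSr mulrA; apply: le_trans (Fhalf _ _) _.
    by rewrite mulr_gt0// exprn_gt0// invr_gt0.
  by rewrite exprS -mulrA ler_pM2l.
have GF x : G x <= F x / G x0.
  rewrite ler_pdivlMr ?tail_pos// /F le_min; apply/andP; split.
    by rewrite ler_piMr//; have /andP[] := G01 x; have /andP[] := G01 x0.
  by rewrite ler_piMl//; have /andP[] := G01 x; have /andP[] := G01 x0.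
have [N NP] := cvg_eventually (tailG ltr01) c0.
exists (2 * c / G x0), N; split; first by rewrite divr_gt0 ?tail_pos// mulr_gt0.
move=> n k Nn; have := NP n Nn; rewrite powR1 !mulr1 ltr_norml => /andP[_ h].
have {}h : n%:R * G (a n) <= 2 * c by lra.
apply: le_trans (_ : n%:R * ((2 `^ rho) ^+ k * G (a n) / G x0) <= _).
  rewrite ler_wpM2l//; apply: le_trans (GF _) _.
  rewrite ler_pM2r ?invr_gt0 ?tail_pos//; apply: le_trans (Fiter _ _ (a0 n)) _.
  by rewrite ler_pM2l ?exprn_gt0.
rewrite [leLHS](_ : _ = n%:R * G (a n) * ((2 `^ rho) ^+ k / G x0)); last by ring.
rewrite [leRHS](_ : _ = 2 * c * ((2 `^ rho) ^+ k / G x0)); last by ring.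
by rewrite ler_wpM2r// divr_ge0 ?exprn_ge0// ltW// tail_pos.
Qed.

(** The dyadic case at the least [k] with [2 ^- k <= s]. *)
Lemma potter_bound : exists K N, 0 < K /\ forall n s, (N <= n)%N -> 0 < s ->
  n%:R * G (a n * s) <= K * (1 + s^-1 `^ rho).
Proof.
have [K [N [K0 KN]]] := potter_dyadic; have r1 := two_pow_ge1.
have r0 : 0 < (2 : R) `^ rho by apply: lt_le_trans r1.
exists (K * 2 `^ rho), N; split; first by rewrite mulr_gt0.
move=> n s Nn s0.
have ex : exists k, 2^-1 ^+ k <= s.
  exists (Num.truncn s^-1).+1; rewrite exprVn -[leRHS]invrK lef_pV2 ?posrE ?invr_gt0 ?exprn_gt0//.
  apply: le_trans (ltW (truncnS_gt _)) _.
  by rewrite -natrX ler_nat ltnW// ltn_expl.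
case: (ex_minnP ex) => k ks kmin.
apply: le_trans (_ : n%:R * G (a n * 2^-1 ^+ k) <= _).
  by rewrite ler_wpM2l//; apply: Gmono; rewrite ler_pM2l.
apply: le_trans (KN n k Nn) _; rewrite -mulrA ler_pM2l//.
case: k ks kmin => [_ _|k _ kmin].
  by rewrite expr0 -[leLHS]mulr1 ler_pM// lerDl powR_ge0.
rewrite exprS ler_pM2l// (@le_trans _ _ (s^-1 `^ rho)) ?lerDr//.
have sk : s <= 2^-1 ^+ k.
  by apply/ltW; rewrite ltNge; apply/negP => /kmin; rewrite ltnn.
rewrite -powR_mulrn ?powR_ge0// -powRrM mulrC powRrM powR_mulrn//.
apply: ge0_ler_powR; rewrite ?nnegrE ?invr_ge0 ?exprn_ge0 ?(ltW s0)//.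
  by rewrite ltW// (lt_trans alpha0 alpha_rho).
by rewrite -[leLHS]invrK lef_pV2 ?posrE ?invr_gt0 ?exprn_gt0// -exprVn.
Qed.

End potter.

(** * Tails of a regularly varying process *)

Section tails.
Context {R : realType} {d : nat}.
Implicit Types (B : set (Dbar0 R d.+1)) (x : skorokhod R d.+1).

Definition far (u : R) : set (Dbar0 R d.+1) := [set b | (u%:E <= radius b)%E].

Lemma farE (u : R) : 0 < u -> far u = [set b | fine (radius b)^-1%E <= u^-1].
Proof.
move=> u0; rewrite /far; congr mkset; apply/funext => b.
rewrite fine_inv_radius; have := radius_gt0 b; case: (radius b) => [r| |] //=.
  by rewrite lte_fin lee_fin => r0; rewrite lef_pV2 ?posrE.
by rewrite leey invr0 invr_ge0 ltW.
Qed.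

Lemma inv_radius_lipschitz (b c : Dbar0 R d.+1) :
  `|fine (radius b)^-1%E - fine (radius c)^-1%E| <= mdist b c.
Proof. by rewrite /mdist /= /polar_dist le_max lexx. Qed.

Lemma open_near (r : R) : open [set b : Dbar0 R d.+1 | fine (radius b)^-1%E < r].
Proof. apply: open_lipschitz; exact: inv_radius_lipschitz. Qed.

Lemma closed_far (u : R) : 0 < u -> closed (far u).
Proof.
move=> u0; rewrite farE// -openC.
rewrite (_ : ~` _ = [set b : Dbar0 R d.+1 | - fine (radius b)^-1%E < - u^-1]).
  apply: open_lipschitz => b c; rewrite -opprD normrN; exact: inv_radius_lipschitz.
apply/seteqP; split=> b /=; rewrite ltrN2; first by move/negP; rewrite -ltNge.
by rewrite ltNge => /negP.
Qed.

Lemma measurable_open B : open B -> measurable B.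
Proof. exact: sub_sigma_algebra. Qed.

Lemma measurable_closed B : closed B -> measurable B.
Proof.
move=> cB; rewrite -[X in measurable X]setCK; apply: measurableC.
by apply: measurable_open; exact: closed_openC.
Qed.

Lemma measurable_far (u : R) : 0 < u -> measurable (far u).
Proof. by move=> u0; apply: measurable_closed; exact: closed_far. Qed.

Lemma bounded_far (u : R) : 0 < u -> metric_bounded (far u).
Proof. by move=> u0; apply/Dbar0_boundedP; exists u. Qed.

Lemma boundary_far (u : R) : 0 < u ->
  boundary (far u) `<=` far u `\` [set b | fine (radius b)^-1%E < u^-1].
Proof.
move=> u0 b [cb ib]; split; first by rewrite ((closure_id _).1 (closed_far u0)).
move=> bu; apply: ib.
have : nbhs b [set b : Dbar0 R d.+1 | fine (radius b)^-1%E < u^-1].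
  by apply: open_nbhs_nbhs; split=> //; exact: open_near.
by apply: filterS => c cu; rewrite farE//=; apply: ltW.
Qed.

Lemma Dbar0_scale_far (u v : R) : 0 < u -> Dbar0_scale u (far v) = far (u * v).
Proof.
move=> u0; apply/seteqP; split=> [b [c vc [rb _]]|b uvb].
  by rewrite /far /= rb EFinM lee_pmul2l ?lte_fin.
have rc0 : (0 < u^-1%:E * radius b)%E.
  by rewrite mule_gt0 ?radius_gt0// lte_fin invr_gt0.
exists (Polar rc0 (angle_norm b)); last first.
  by split=> //=; rewrite muleA -EFinM divff ?mul1e// gt_eqF.
by rewrite /far /= -(@lee_pmul2l _ u%:E) ?lte_fin// -EFinM muleA -EFinM divff ?mul1e// gt_eqF.
Qed.

Variable m : {measure set (Dbar0 R d.+1) -> \bar R}.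
Variable alpha : R.
Hypothesis alpha0 : 0 < alpha.
Hypothesis m0 : m setT <> 0%E.
Hypothesis mfin : boundedly_finite m.
Hypothesis mscale : forall (u : R) B, 0 < u -> measurable B ->
  m (Dbar0_scale u B) = ((u `^ (- alpha))%:E * m B)%E.

Lemma m_far (u : R) : 0 < u -> m (far u) = (u `^ (- alpha) * fine (m (far 1)))%:E.
Proof.
move=> u0; rewrite -[u in LHS]mulr1 -Dbar0_scale_far// mscale//; last exact: measurable_far.
rewrite EFinM fineK// ge0_fin_numE//.
by apply: mfin; [exact: measurable_far|exact: bounded_far].
Qed.

Lemma far_exhausts : \bigcup_k far k.+1%:R^-1 = [set: Dbar0 R d.+1].
Proof.
apply/seteqP; split=> // b _; have := radius_gt0 b.
case E : (radius b) => [r| |] //=; last by exists 0%N => //; rewrite /far /= E leey.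
rewrite lte_fin => r0; exists (Num.truncn r^-1) => //.
rewrite /far /= E lee_fin -[leRHS]invrK lef_pV2 ?posrE ?invr_gt0//.
exact/ltW/truncnS_gt.
Qed.

(** By scaling all the sets [far u] would be null with [far 1], and they exhaust
the space. *)
Lemma m_far1_gt0 : 0 < fine (m (far 1)).
Proof.
have mf1 : m (far 1) \is a fin_num.
  by rewrite ge0_fin_numE//; apply: mfin; [exact: measurable_far|exact: bounded_far].
rewrite lt_neqAle fine_ge0// andbT eq_sym; apply/eqP => m1; apply: m0.
apply/eqP; rewrite eq_le measure_ge0 andbT -far_exhausts.
have k0 k : 0 < k.+1%:R^-1 :> R by rewrite invr_gt0.
apply: le_trans (generalized_Boole_inequality m (fun k => measurable_far (k0 k)) _) _.
  by apply: bigcup_measurable => k _; exact: measurable_far.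
by rewrite eseries0// => k _ _; rewrite m_far// m1 mulr0.
Qed.

(** By scaling the shell between the radii [u] and [u * v] has mass
proportional to [1 - v `^ (- alpha)], which vanishes as [v] decreases to 1. *)
Lemma m_sphere (u : R) : 0 < u ->
  m (far u `\` [set b | fine (radius b)^-1%E < u^-1]) = 0%E.
Proof.
move=> u0; have c0 := m_far1_gt0.
have mS : measurable (far u `\` [set b | fine (radius b)^-1%E < u^-1]).
  by apply: measurableD; [exact: measurable_far|apply: measurable_open; exact: open_near].
suff small (e : R) : 0 < e ->
    (m (far u `\` [set b | (fine (radius b)^-1 < u^-1)%R]) <= e%:E)%E.
  apply/eqP; rewrite eq_le measure_ge0 andbT; apply/lee_addgt0Pr => e e0.
  by rewrite add0e; exact: small.
move=> e0.
have ua : 0 < u `^ (- alpha) by rewrite powR_gt0.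
pose k := u `^ (- alpha) * fine (m (far 1)); have k0 : 0 < k by rewrite mulr_gt0.
(* Chosen such that the shell has mass [k * (1 - (1 + e / k)^-1)], at most [e]. *)
pose v := (1 + e / k) `^ alpha^-1.
have ek : 0 < e / k by rewrite divr_gt0.
have v1 : 1 < v.
  have : 1 `^ alpha^-1 < v.
    by apply: gt0_ltr_powR; rewrite ?invr_gt0 ?nnegrE ?ler01 ?ltrDl// addr_ge0// ltW.
  by rewrite powR1.
have v0 : 0 < v by apply: lt_trans v1.
have va : v `^ (- alpha) = (1 + e / k)^-1.
  by rewrite /v -powRrM mulrN mulVf ?gt_eqF// powR_inv1// addr_ge0// ltW.
have uv0 : 0 < u * v by rewrite mulr_gt0.
have sub : (far u `\` [set b | fine (radius b)^-1%E < u^-1]) `|` far (u * v) `<=` far u.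
  move=> b [[]//|]; rewrite /far /=; apply: le_trans.
  by rewrite lee_fin ler_pMr// ltW.
have disj : (far u `\` [set b | fine (radius b)^-1%E < u^-1]) `&` far (u * v) = set0.
  apply/seteqP; split=> // b [[_ bu]]; rewrite farE//= => buv; apply: bu => /=.
  by apply: le_lt_trans buv _; rewrite ltf_pV2 ?posrE// ltr_pMr.
set S := (X in m X).
have : (m S + m (far (u * v)) <= m (far u))%E.
  rewrite -[leLHS](measureU m mS (measurable_far uv0) disj).
  apply: le_measure; last exact: sub.
    by apply: mem_set; exact: (measurableU _ _ mS (measurable_far uv0)).
  by apply: mem_set; exact: measurable_far.
rewrite (m_far uv0) (m_far u0) -/k powRM ?(ltW u0) ?(ltW v0)// va mulrAC -/k.
rewrite -leeBrDr// -EFinB => /le_trans; apply; rewrite lee_fin lerBlDr.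
have kek : k * (e / k) = e by rewrite mulrCA divff ?mulr1// gt_eqF.
have q0 : 0 < 1 + e / k by rewrite addr_gt0.
rewrite -(ler_pM2r q0) [leRHS]mulrDl divfK ?gt_eqF// [leLHS]mulrDr mulr1 kek.
by rewrite [leLHS]addrC lerD2r mulrDr mulr1 lerDl mulr_ge0// ltW.
Qed.

End tails.

Section process_tails.
Context {R : realType} {d : nat} {disp : measure_display} {T : measurableType disp}.
Variable P : probability T R.

Lemma in_D_far (u : R) (x : skorokhod R d.+1) : 0 < u -> in_D (far u) x <-> u <= supnorm x.
Proof.
move=> u0; rewrite in_DE /far /=; split=> [[/polarizeP[-> _]]|ux]; first by rewrite lee_fin.
have x0 : x <> path_cst 0.
  by move=> x0; move: ux; rewrite x0 supnorm_path_cst enorm0 leNgt u0.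
by split=> //; have [-> _] := polarizeP x0; rewrite lee_fin.
Qed.

Lemma measurable_boundary (B : set (Dbar0 R d.+1)) : measurable (boundary B).
Proof.
apply: measurableD; first by apply: measurable_closed; exact: closed_closure.
by apply: measurable_open; exact: open_interior.
Qed.

(** Spheres being null sets of [m], regular variation on the sets [far u] gives
the limits of the tails that the Potter bound needs. *)
Lemma tail_bound (X : T -> skorokhod R d.+1) (a : nat -> R)
    (m : {measure set (Dbar0 R d.+1) -> \bar R}) (alpha rho : R) :
  regularly_varying_index P alpha X a m -> alpha < rho ->
  exists K N, 0 < K /\ forall n s, (N <= n)%N -> 0 < s ->
    (n%:R%:E * P [set w | (a n * s <= supnorm (X w))%R] <= (K * (1 + s^-1 `^ rho))%:E)%E.
Proof.
move=> [[sX [a0 amono ainfty] [m0 mfin] _ [_ _ cvgX]] alpha0 mscale] alpha_rho.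
have mX : measurable_fun setT X by exact: measurable_process.
have mS : measurable_fun setT (fun w => supnorm (X w)).
  exact: (measurableT_comp measurable_supnorm mX).
have mtail (x : R) : measurable [set w | x <= supnorm (X w)].
  by apply: measurable_ler.
pose G (x : R) := fine (P [set w | x <= supnorm (X w)]).
have GE (x : R) : P [set w | x <= supnorm (X w)] = (G x)%:E.
  by rewrite /G fineK// fin_num_measure.
have G01 x : 0 <= G x <= 1.
  by rewrite -!lee_fin -GE measure_ge0/= probability_le1.
have Gmono x y : x <= y -> G y <= G x.
  move=> xy; rewrite -lee_fin -!GE; apply: le_measure.
  - by apply: mem_set; exact: mtail.
  - by apply: mem_set; exact: mtail.
  - by move=> w /=; apply: le_trans.
pose c := fine (m (far 1)).
have c0 : 0 < c := m_far1_gt0 m0 mfin mscale.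
have tailG u : 0 < u -> n%:R * G (a n * u) @[n --> \oo] --> c * u `^ (- alpha).
  move=> u0; have mfar : measurable (far u : set (Dbar0 R d.+1)) by exact: measurable_far.
  have b0 : m (boundary (far u)) = 0%E.
    apply/eqP; rewrite eq_le measure_ge0 andbT -(m_sphere alpha0 m0 mfin mscale u0).
    apply: le_measure; last exact: boundary_far.
      by apply: mem_set; exact: measurable_boundary.
    apply: mem_set; apply: measurableD => //.
    by apply: measurable_open; exact: open_near.
  have := cvgX (far u) mfar (bounded_far u0) b0.
  rewrite (m_far mfin mscale u0) mulrC => /fine_cvg; apply: cvg_trans.
  apply: near_eq_cvg; apply: nearW => n /=; rewrite /scaled_law.
  rewrite [X in P X](_ : _ = [set w | a n * u <= supnorm (X w)]); first by rewrite GE.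
  apply/seteqP; split=> w /=; rewrite in_D_far// supnormZ gtr0_norm ?invr_gt0//;
    by rewrite ler_pdivlMl.
have [K [N [K0 KN]]] := potter_bound G01 Gmono a0 amono ainfty c0 alpha0 alpha_rho tailG.
by exists K, N; split=> // n s Nn s0; rewrite GE -EFinM lee_fin KN.
Qed.

End process_tails.

(** * Multiplication by a fixed path *)

Section fixed_multiplier.
Context {R : realType} {d : nat}.
Implicit Types (x y : skorokhod R d.+1) (b : Dbar0 R d.+1) (B : set (Dbar0 R d.+1)).

Definition mul_preimage y B : set (Dbar0 R d.+1) :=
  [set b | in_D B (path_mul y (unpolar b))].

(** Near a point of finite radius, closeness of the inverse radii gives closeness
of the radii. *)
Lemma unpolar_continuous b : unpolar b <> path_cst 0 -> {for b, continuous unpolar}.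
Proof.
move=> /supnorm_gt0; rewrite supnorm_unpolar => r0.
move=> A /nbhs_skorokhod[e e0 eA]; apply/nbhs_ballP.
set r := fine (radius b) in r0.
pose k := 2 * r ^+ 2 + 2 * r + 1.
have r2 : 0 < r ^+ 2 by rewrite exprn_gt0.
have k0 : 0 < k by rewrite /k; lra.
pose dl := Num.min (r^-1 / 2) (e / 2 / k).
have dl0 : 0 < dl by rewrite lt_min !divr_gt0// invr_gt0.
have [dlr dle] : dl <= r^-1 / 2 /\ dl <= e / 2 / k by rewrite /dl !ge_min !lexx orbT.
exists dl => // c; rewrite ballEmdist/= /mdist/= /polar_dist gt_max !fine_inv_radius -/r.
move=> /andP[rc ac]; apply: eA; set s := fine (radius c) in rc.
have ri0 : 0 < r^-1 by rewrite invr_gt0.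
have s0 : 0 < s^-1.
  by move: rc; rewrite ltr_norml => /andP[h1 h2]; lra.
have {}s0 : 0 < s by rewrite -invr_gt0.
have sr : s <= 2 * r.
  rewrite -[s]invrK -[leRHS]invrK lef_pV2 ?posrE ?invr_gt0 ?mulr_gt0// invfM.
  by move: rc; rewrite ltr_norml => /andP[h1 h2]; lra.
have rs : `|r - s| <= 2 * r ^+ 2 * dl.
  have -> : r - s = r * s * - (r^-1 - s^-1) by field; rewrite !gt_eqF.
  rewrite normrM normrN gtr0_norm ?mulr_gt0//.
  apply: ler_pM; rewrite ?(ltW rc) ?mulr_ge0 ?(ltW r0) ?(ltW s0)//.
  by rewrite expr2 mulrCA ler_pM2l.
have [l lc [ls lz]] := J1_dist_lt ac.
have kdl : k * dl <= e / 2 by rewrite mulrC -ler_pdivlMr.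
have k1 : dl <= k * dl.
  by rewrite ler_peMl ?(ltW dl0)// /k; lra.
apply: (@le_lt_trans _ _ (k * dl)); last by lra.
apply: (J1_dist_le lc); split=> [p q pq|t]; first by rewrite (le_trans (ls _ _ pq)).
rewrite /unpolar /= -/r -/s.
have -> : r *: angle b t - s *: angle c (l t) =
    (r - s) *: angle b t + s *: (angle b t - angle c (l t)).
  by rewrite scalerBl scalerBr addrA subrK.
apply: le_trans (enormD _ _) _; rewrite !enormZ (gtr0_norm s0).
have h1 : `|r - s| * enorm (angle b t) <= 2 * r ^+ 2 * dl * 1.
  by apply: ler_pM; rewrite ?enorm_ge0// -(angle_norm b) enorm_le_supnorm.
have h2 : s * enorm (angle b t - angle c (l t)) <= 2 * r * dl.
  by apply: ler_pM; rewrite ?enorm_ge0 ?(ltW s0).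
by rewrite /k; lra.
Qed.

Lemma supnorm_mul y x : supnorm (path_mul y x) <= supnorm y * supnorm x.
Proof.
apply: supnorm_le => t; apply: le_trans (enorm_mulv _ _) _.
by apply: ler_pM; rewrite ?enorm_ge0 ?enorm_le_supnorm.
Qed.

Lemma in_D_bounded (e : R) B x : 0 < e -> (forall b, B b -> (e%:E <= radius b)%E) ->
  in_D B x -> e <= supnorm x.
Proof. by move=> e0 Be [b Bb xb]; apply/(in_D_far _ e0); exists b => //; exact: Be. Qed.

Lemma mul_preimage_sub (e : R) y B : 0 < e -> (forall b, B b -> (e%:E <= radius b)%E) ->
  mul_preimage y B `<=` [set b | 0 < supnorm y /\ far (e / supnorm y) b].
Proof.
move=> e0 Be b /(in_D_bounded e0 Be) eyb.
have := le_trans eyb (supnorm_mul y (unpolar b)); rewrite supnorm_unpolar => {}eyb.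
have y0 : 0 < supnorm y.
  rewrite lt_neqAle supnorm_ge0 andbT eq_sym; apply/eqP => y0.
  by move: eyb; rewrite y0 mul0r leNgt e0.
split=> //; rewrite /far /=; move: eyb; rewrite mulrC -ler_pdivrMr//.
have := radius_gt0 b; case: (radius b) => [r| |] //= _.
by rewrite leey.
Qed.

Lemma bounded_mul_preimage y B : metric_bounded B -> metric_bounded (mul_preimage y B).
Proof.
move=> /Dbar0_boundedP[e e0 Be]; apply/Dbar0_boundedP.
have sub := mul_preimage_sub e0 Be.
have [y0|y0] := ltP 0 (supnorm y).
  by exists (e / supnorm y); [rewrite divr_gt0|move=> b /sub[]].
by exists 1 => // b /sub[]; rewrite ltNge y0.
Qed.

Lemma in_D_mul_preimage y B x : in_D (mul_preimage y B) x <-> in_D B (path_mul y x).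
Proof.
split=> [[b Bb xb]|Bx]; first by move: Bb; rewrite /mul_preimage /= (unpolarK xb).
have x0 : x <> path_cst 0 by move=> x0; move: Bx; rewrite x0 path_mul0 => /in_DE[].
have xb := polarizeP x0; exists (polarize x) => //.
by rewrite /mul_preimage /= (unpolarK xb).
Qed.

Lemma measurable_mul_preimage y B : measurable B -> measurable (mul_preimage y B).
Proof.
move=> mB; apply: measurable_in_D => //; apply: measurable_path_mul.
  exact: measurable_cst.
exact: measurable_unpolar.
Qed.

(** At a continuity point of multiplication by [y] the preimage of [B] has no
boundary but the preimage of the boundary of [B]. Boundedness of [B] keeps the
product away from the zero path, which has no polar coordinates. *)
Lemma boundary_mul_preimage y B : metric_bounded B ->
  boundary (mul_preimage y B) `<=`
    ~` in_Dbar0 setT `|` (in_Dbar0 (Disc y) `|` mul_preimage y (boundary B)).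
Proof.
move=> /Dbar0_boundedP[e e0 Be] b [clb intb].
have [b0|b0] := pselect (unpolar b = path_cst 0).
  by left; rewrite in_Dbar0E => -[].
right; have [disc|cont] := pselect (Disc y (unpolar b)).
  by left; rewrite in_Dbar0E.
right; have {}cont : {for b, continuous (fun c => path_mul y (unpolar c))}.
  apply: (continuous_comp (f := unpolar)); first exact: unpolar_continuous.
  exact: contrapT cont.
have yb0 : path_mul y (unpolar b) <> path_cst 0.
  move=> yb0; have : nbhs b [set c | supnorm (path_mul y (unpolar c)) < e].
    apply: (cont [set z | supnorm z < e]); apply/nbhs_skorokhod; exists e => // z.
    rewrite yb0 => h; have := supnorm_le_J1 z (path_cst 0).
    rewrite supnorm_path_cst enorm0 add0r => /le_lt_trans; apply.
    by rewrite J1_sym.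
  by move=> /clb[c [/(in_D_bounded e0 Be) ec]] /=; rewrite ltNge ec.
have pull (V : set (Dbar0 R d.+1)) : nbhs (polarize (path_mul y (unpolar b))) V ->
    nbhs b (mul_preimage y V).
  move=> bV; pose U := interior V; have oU : open U by exact: open_interior.
  have UV : U `<=` V by exact: interior_subset.
  have : nbhs b (mul_preimage y U).
    apply: (cont (in_D U)); apply: open_nbhs_nbhs; split; first exact: open_in_D.
    exact/in_DE.
  by apply: filterS => c [z Uz zc]; exists z => //; exact: UV.
apply/in_DE; split=> //; split.
  move=> V /pull /clb[c [/in_DE[_ Bc] /in_DE[_ Vc]]].
  by exists (polarize (path_mul y (unpolar c))).
by move=> /pull.
Qed.

End fixed_multiplier.

(** * The limit measure and domination *)

Section sigma_finiteness.
Context {R : realType} {d : nat}.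
Variable m : {measure set (Dbar0 R d.+1) -> \bar R}.
Hypothesis mfin : boundedly_finite m.

(** A copy of [m] that can carry the sigma-finite structure, which depends on
the proof that [m] is finite on bounded sets. *)
Definition sigma_finite_copy of boundedly_finite m : set (Dbar0 R d.+1) -> \bar R := m.

Lemma boundedly_finite_sigma_finite : sigma_finite setT (sigma_finite_copy mfin).
Proof.
exists (fun k => far k.+1%:R^-1); first by rewrite far_exhausts.
move=> k; have k0 : 0 < k.+1%:R^-1 :> R by rewrite invr_gt0.
split; first exact: measurable_far.
by apply: mfin; [exact: measurable_far|exact: bounded_far].
Qed.

HB.instance Definition _ := isMeasure.Build _ _ _ (sigma_finite_copy mfin)
  (measure0 m) (measure_ge0 m) (@measure_semi_sigma_additive _ _ _ m).

HB.instance Definition _ := Measure_isSigmaFinite.Build _ _ _ (sigma_finite_copy mfin)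
  boundedly_finite_sigma_finite.

End sigma_finiteness.

Section limit_measure.
Context {R : realType} {d : nat} {disp : measure_display} {T : measurableType disp}.
Variable P : probability T R.
Variable m : {measure set (Dbar0 R d.+1) -> \bar R}.
Hypothesis mfin : boundedly_finite m.
Notation ms := (sigma_finite_copy mfin).

Lemma measurable_sections (A : T -> Dbar0 R d.+1 -> Prop) :
  measurable [set wb : T * Dbar0 R d.+1 | A wb.1 wb.2] ->
  measurable_fun setT (fun w => m [set b | A w b]).
Proof.
move=> mA.
rewrite (_ : (fun w => _) = ms \o xsection [set wb : T * Dbar0 R d.+1 | A wb.1 wb.2]).
  exact: measurable_fun_xsection.
by apply/funext => w /=; rewrite xsectionE.
Qed.

Variable Y : T -> skorokhod R d.+1.
Hypothesis mY : measurable_fun setT Y.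

Lemma measurable_mul_unpolar :
  measurable_fun setT (fun wb : T * Dbar0 R d.+1 => path_mul (Y wb.1) (unpolar wb.2)).
Proof.
apply: measurable_path_mul.
  exact: (measurableT_comp mY measurable_fst).
exact: (measurableT_comp measurable_unpolar measurable_snd).
Qed.

Lemma measurable_mul_preimages B : measurable B ->
  measurable_fun setT (fun w => m (mul_preimage (Y w) B)).
Proof.
move=> mB; apply: (measurable_sections (A := fun w b => mul_preimage (Y w) B b)).
exact: measurable_in_D measurable_mul_unpolar mB.
Qed.

(** The limit is the image of the product of [P] and [m] under multiplication,
whence its countable additivity. *)
Lemma limit_measure : exists nu : {measure set (Dbar0 R d.+1) -> \bar R},
  forall B, measurable B -> nu B = (\int[P]_w m (mul_preimage (Y w) B))%E.
Proof.
have [nu nuE] := process_image_measure (P \x ms)%E measurable_mul_unpolar.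
exists nu => B mB; rewrite nuE//= /product_measure1.
by apply: eq_integral => w _ /=; rewrite xsectionE.
Qed.

(** Measurability is what turns a vanishing mean of these masses into almost sure
vanishing. *)
Lemma measurable_Disc_mass : measurable_fun setT (fun w => m (in_Dbar0 (Disc (Y w)))).
Proof.
under eq_fun do rewrite in_Dbar0_Disc.
apply: (measurable_sections (A := fun w b => ~ tame_jumps (Y w) (unpolar b))).
apply: measurableC; apply: measurable_tame_jumps => t k.
  exact: (measurableT_comp (measurable_coord t k) (measurableT_comp mY measurable_fst)).
exact: (measurableT_comp (measurable_coord t k)
  (measurableT_comp measurable_unpolar measurable_snd)).
Qed.

End limit_measure.

Lemma ge0_integral_eq0_ae {R : realType} {disp : measure_display} {T : measurableType disp}
    (P : probability T R) (f : T -> \bar R) : measurable_fun setT f ->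
  (forall w, 0 <= f w)%E -> (\int[P]_w f w = 0)%E -> {ae P, forall w, f w = 0%E}.
Proof.
move=> mf f0 If; have : (\int[P]_w `|f w| = 0)%E.
  by rewrite -[RHS]If; apply: eq_integral => w _; rewrite gee0_abs.
move=> /(ae_eq_integral_abs P measurableT mf); apply: filterS => w h.
exact: h.
Qed.

Section domination.
Context {R : realType} {d : nat} {disp : measure_display} {T : measurableType disp}.
Variable P : probability T R.
Variables (X : T -> skorokhod R d.+1) (a : nat -> R).
Implicit Types (B : set (Dbar0 R d.+1)).
Hypothesis mX : measurable_fun setT X.
Hypothesis a0 : forall n, 0 < a n.

Lemma path_mul_scale (c : R) (y x : skorokhod R d.+1) :
  path_mul y (path_scale c x) = path_scale c (path_mul y x).
Proof. by apply: skorokhod_eq => t; apply/rowP => i; rewrite !mxE mulrCA. Qed.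

Lemma scaled_mul_tail (e : R) B (y : skorokhod R d.+1) n : 0 < e -> measurable B ->
  (forall b, B b -> (e%:E <= radius b)%E) ->
  (P [set w | in_D B (path_scale (a n)^-1 (path_mul y (X w)))] <=
   if (0 < supnorm y)%R then P [set w | (a n * (e / supnorm y) <= supnorm (X w))%R] else 0)%E.
Proof.
move=> e0 mB Be.
have sub w : in_D B (path_scale (a n)^-1 (path_mul y (X w))) ->
    0 < supnorm y /\ a n * (e / supnorm y) <= supnorm (X w).
  move=> /(in_D_bounded e0 Be); rewrite supnormZ gtr0_norm ?invr_gt0// ler_pdivlMl// => h.
  have {}h := le_trans h (supnorm_mul _ _).
  have y0 : 0 < supnorm y.
    rewrite lt_neqAle supnorm_ge0 andbT eq_sym; apply/eqP => y0.
    by move: h; rewrite y0 mul0r leNgt mulr_gt0.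
  by split=> //; rewrite mulrA ler_pdivrMr// [leRHS]mulrC.
have mX' : measurable_fun setT (fun w => supnorm (X w)).
  exact: (measurableT_comp measurable_supnorm mX).
case: ifPn => [y0|y0]; last first.
  rewrite (_ : [set w | _] = set0) ?measure0//.
  by apply/seteqP; split=> w //= /sub[]; rewrite (negbTE y0).
apply: le_measure.
- apply: mem_set; apply: measurable_in_D => //; apply: measurable_path_scale.
  by apply: measurable_path_mul => //; exact: measurable_cst.
- by apply: mem_set; apply: measurable_ler.
- by move=> w /sub[].
Qed.

(** Multiplication by a fixed path transfers the regular variation of [X], by
the mapping theorem for sets. *)
Lemma fixed_multiplier_cvg (m : {measure set (Dbar0 R d.+1) -> \bar R}) B y :
  m (~` in_Dbar0 setT) = 0%E ->
  (forall C : set (Dbar0 R d.+1), measurable C -> metric_bounded C ->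
    m (boundary C) = 0%E -> scaled_law P a X n C @[n --> \oo] --> m C) ->
  measurable B -> metric_bounded B ->
  m (in_Dbar0 (Disc y)) = 0%E -> m (mul_preimage y (boundary B)) = 0%E ->
  (n%:R%:E * P [set w | in_D B (path_scale (a n)^-1 (path_mul y (X w)))])%E @[n --> \oo]
    --> m (mul_preimage y B).
Proof.
move=> minf cvgX mB bB disc0 bd0.
have mDisc : measurable (in_Dbar0 (Disc y)).
  rewrite in_Dbar0_Disc; apply: measurableC; apply: measurable_tame_jumps => t k.
    exact: measurable_cst.
  exact: (measurableT_comp (measurable_coord t k) measurable_unpolar).
have mfinite : measurable (~` in_Dbar0 [set: skorokhod R d.+1]).
  apply: measurableC; rewrite in_Dbar0E.
  rewrite (_ : [set b | _] = [set b : Dbar0 R d.+1 | unpolar b <> path_cst 0]).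
    exact: measurable_neq0 measurable_unpolar.
  by apply/seteqP; split=> b //= [].
have mbd : measurable (mul_preimage y (boundary B)).
  by apply: measurable_mul_preimage; exact: measurable_boundary.
have b0 : m (boundary (mul_preimage y B)) = 0%E.
  apply: (subset_measure0 _ _ (boundary_mul_preimage bB)).
  - exact: measurable_boundary.
  - by apply: measurableU => //; apply: measurableU.
  - by apply: null_set_setU => //; [exact: measurableU|apply: null_set_setU].
have := cvgX _ (measurable_mul_preimage y mB) (bounded_mul_preimage y bB) b0.
apply: cvg_trans; apply: near_eq_cvg; apply: nearW => n /=; rewrite /scaled_law.
congr (_ * P _)%E; apply/seteqP; split=> w /=; by rewrite in_D_mul_preimage path_mul_scale.
Qed.

End domination.

Section envelope.
Context {R : realType} {disp : measure_display} {T : measurableType disp}.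
Variable P : probability T R.

Lemma powR_le_1D (u alpha rho : R) : 0 <= u -> 0 < alpha -> alpha <= rho ->
  u `^ alpha <= 1 + u `^ rho.
Proof.
move=> u0 alpha0 ar; have [u1|u1] := leP u 1.
  apply: (@le_trans _ _ 1); last by rewrite lerDl powR_ge0.
  have : u `^ alpha <= 1 `^ alpha by rewrite ge0_ler_powR ?nnegrE// ltW.
  by rewrite powR1.
by apply: le_trans (ler_powR (ltW u1) ar) _; rewrite lerDr.
Qed.

(** The right-hand side of [tail_bound] at [s = e / S], which dominates [n]
times the conditional probabilities given [Y]. *)
Lemma integrable_envelope (S : T -> R) (K e rho : R) : measurable_fun setT S ->
  (forall w, 0 <= S w) -> 0 < e -> ('E_P[fun w => (S w `^ rho)%R] < +oo)%E ->
  P.-integrable setT (fun w => (K * (1 + (e / S w)^-1 `^ rho))%:E).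
Proof.
move=> mS S0 e0 ES.
have mSr : measurable_fun setT (fun w => S w `^ rho).
  by apply: (measurableT_comp (f := fun r : R => r `^ rho)) => //; exact: measurable_powR.
have iS : P.-integrable setT (fun w => (S w `^ rho)%:E).
  apply/integrableP; split; first exact/measurable_EFinP.
  move: ES; rewrite unlock; apply: le_lt_trans; rewrite le_eqVlt; apply/orP; left.
  by apply/eqP; apply: eq_integral => w _; rewrite gee0_abs// lee_fin powR_ge0.
rewrite (_ : (fun w => _) = (fun w => K%:E * (cst 1 w + (e^-1 `^ rho)%:E * (S w `^ rho)%:E))%E).
  apply: integrableZl => //; apply: integrableD => //; last exact: integrableZl.
  exact: finite_measure_integrable_cst.
apply/funext => w; rewrite invf_div powRM ?invr_ge0 ?(ltW e0)//.
by rewrite EFinM EFinD EFinM muleC [in RHS]muleC [(_ * (S w `^ rho)%:E)%E]muleC.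
Qed.

End envelope.

Theorem theorem3p1 (R : realType) (d : nat) (disp : measure_display)
    (T : measurableType disp) (P : probability T R)
    (X Y : T -> skorokhod R d.+1) (alpha : R) (a : nat -> R)
    (m : {measure set (Dbar0 R d.+1) -> \bar R}) :
  stochastic_process X -> stochastic_process Y ->
  independent_processes P X Y ->
  regularly_varying_index P alpha X a m ->
  (exists2 delta : R, 0 < delta &
    ('E_P[(fun w => supnorm (Y w) `^ (alpha + delta))%R] < +oo)%E) ->
  {ae P, forall w, forall k : 'I_d.+1, 0 < coord_supnorm k (Y w)} ->
  (\int[P]_w m (in_Dbar0 (Disc (Y w))) = 0)%E ->
  hatw_cvg
    (scaled_law P a (fun w => path_mul (Y w) (X w)))
    (fun B => \int[P]_w m (in_Dbar0 (path_mul (Y w) @^-1` in_D B)))%E.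
Proof.
move=> sX sY indep rv [delta delta0 EY] _ disc0.
have [[_ [a0 _ _] [_ mfin] minf [_ _ cvgX]] alpha0 scale_m] := rv.
have mX : measurable_fun setT X by exact: measurable_process.
have mY : measurable_fun setT Y by exact: measurable_process.
have mS : measurable_fun setT (fun w => supnorm (Y w)).
  exact: (measurableT_comp measurable_supnorm mY).
have S0 w : 0 <= supnorm (Y w) by exact: supnorm_ge0.
pose rho := alpha + delta.
have alpha_rho : alpha < rho by rewrite ltrDl.
have envelope K e : 0 < e ->
    P.-integrable setT (fun w => (K * (1 + (e / supnorm (Y w))^-1 `^ rho))%:E).
  by move=> e0; exact: integrable_envelope.
rewrite (_ : (fun B => _) = (fun B => \int[P]_w m (mul_preimage (Y w) B))%E); last first.
  by apply/funext => B; apply: eq_integral => w _; rewrite in_Dbar0_mul.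
have mpre B : measurable B -> measurable_fun setT (fun w => m (mul_preimage (Y w) B)).
  exact: measurable_mul_preimages.
split.
- move=> n.
  have mZ : measurable_fun setT (fun w => path_scale (a n)^-1 (path_mul (Y w) (X w))).
    by apply: measurable_path_scale; exact: measurable_path_mul.
  split.
    have [nu nuE] := process_image_measure P mZ.
    exists (mscale (n%:R : R)%:nng nu) => B mB.
    by rewrite /scaled_law -nuE.
  move=> B mB _; rewrite /scaled_law.
  apply: (@le_lt_trans _ _ (n%:R%:E * 1)%E); last by rewrite mule1 ltry.
  by apply: lee_pmul => //; apply: probability_le1; exact: measurable_in_D.
- split; first by have [nu nuE] := limit_measure P mfin mY; exists nu => B mB; rewrite nuE.
  move=> B mB /Dbar0_boundedP[e e0 Be].
  pose c := fine (m (far 1)).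
  have c0 : 0 <= c by rewrite fine_ge0.
  have /integrableP[menv envoo] := envelope c e e0.
  apply: le_lt_trans envoo; apply: ge0_le_integral => //; first exact: mpre.
    exact: measurableT_comp.
  move=> w _; have sub := mul_preimage_sub (y := Y w) e0 Be.
  rewrite gee0_abs; last by rewrite lee_fin mulr_ge0// addr_ge0// powR_ge0.
  have [y0|y0] := ltP 0 (supnorm (Y w)); last first.
    rewrite (_ : mul_preimage _ _ = set0).
      by rewrite measure0 lee_fin mulr_ge0// addr_ge0// powR_ge0.
    by apply/seteqP; split=> // b /sub[]; rewrite ltNge y0.
  have es0 : 0 < e / supnorm (Y w) by rewrite divr_gt0.
  apply: (@le_trans _ _ (m (far (e / supnorm (Y w))))).
    apply: le_measure; last by move=> b /sub[].
      by apply: mem_set; exact: measurable_mul_preimage.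
    by apply: mem_set; exact: measurable_far.
  rewrite (m_far mfin scale_m es0) lee_fin mulrC; apply: ler_wpM2l => //.
  rewrite (_ : (e / supnorm (Y w)) `^ (- alpha) = (e / supnorm (Y w))^-1 `^ alpha).
    by apply: powR_le_1D => //; [rewrite invr_ge0 ltW|rewrite ltW].
  by rewrite -(powR_inv1 (ltW es0)) -powRrM mulN1r.
- move=> B mB bB bd0.
  have [e e0 Be] := iffLR (Dbar0_boundedP B) bB.
  pose F n w := P [set w' | in_D B (path_scale (a n)^-1 (path_mul (Y w) (X w')))].
  have joint n : jointly_measurable
      (fun y x : skorokhod R d.+1 => in_D B (path_scale (a n)^-1 (path_mul y x))).
    move=> disp' T' Y' X' mY' mX'; apply: measurable_in_D => //.
    by apply: measurable_path_scale; apply: measurable_path_mul; exact: measurable_process.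
  have mF n : measurable_fun setT (F n) by case: (independent_fubini sX sY indep (joint n)).
  have lawE n : scaled_law P a (fun w => path_mul (Y w) (X w)) n B =
      (\int[P]_w (n%:R%:E * F n w))%E.
    rewrite ge0_integralZl//.
    by rewrite /scaled_law; case: (independent_fubini sX sY indep (joint n)) => _ ->.
  have [K [N [K0 KN]]] := tail_bound rv alpha_rho.
  (* The Potter bound holds from the rank [N] on. *)
  suff : [sequence (\int[P]_w ((n + N)%:R%:E * F (n + N)%N w))%E]_n @ \oo -->
      (\int[P]_w m (mul_preimage (Y w) B))%E.
    rewrite (cvg_shiftn N (fun n => (\int[P]_w (n%:R%:E * F n w))%E)).
    by apply: cvg_trans; apply: near_eq_cvg; apply: nearW => n; rewrite lawE.
  have Disc_ae : {ae P, forall w, m (in_Dbar0 (Disc (Y w))) = 0%E}.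
    by apply: ge0_integral_eq0_ae => //; exact: measurable_Disc_mass.
  have bd_ae : {ae P, forall w, m (mul_preimage (Y w) (boundary B)) = 0%E}.
    by apply: ge0_integral_eq0_ae => //; apply: mpre; exact: measurable_boundary.
  have [] // := @dominated_convergence _ _ _ P setT measurableT
    (fun n w => ((n + N)%:R%:E * F (n + N)%N w)%E) (fun w => m (mul_preimage (Y w) B))
    (fun w => (K * (1 + (e / supnorm (Y w))^-1 `^ rho))%:E).
  + by move=> n; apply: measurable_funeM.
  + exact: mpre.
  + apply: filterS2 Disc_ae bd_ae => w D0 b0 _.
    have := fixed_multiplier_cvg minf cvgX mB bB D0 b0.
    by rewrite -(cvg_shiftn N).
  + exact: envelope.
  + apply: nearW => w n _; rewrite gee0_abs; last by rewrite mule_ge0// measure_ge0.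
    have := scaled_mul_tail P mX a0 (Y w) (n + N)%N e0 mB Be.
    have [y0 h|y0 h] := ltP 0 (supnorm (Y w)).
      apply: le_trans (KN _ _ (leq_addl n N) _); last by rewrite divr_gt0.
      by apply: lee_wpmul2l.
    rewrite [X in (_ * X)%E](_ : _ = 0%E).
      by rewrite mule0 lee_fin mulr_ge0// ?(ltW K0)// addr_ge0// powR_ge0.
    by apply/eqP; rewrite eq_le h measure_ge0.
Qed.
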